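(* Let $(\mathcal G,\mathfrak c)$ be a locally finite, connected, transient weighted graph and let $\mathfrak m$ be admissible (see context). Suppose that one (equivalently all) of the following holds: (A) every harmonic function on $\mathcal G$ of finite Dirichlet energy is constant; (B) for every $x\in V$, $\{X^\infty_{\tau_\infty+s}\}_{s\ge0}$ under $\mathbb P^\infty_x$ and $\{Z_t\}_{t\ge0}$ under $\mathbb P^{\mathrm{RI}}$ are identically distributed; (C) the $\mathfrak c$-free and $\mathfrak c$-wired spanning forests of $\mathcal G$ have the same law. Then random walk reflected off of infinity on $(\mathcal G,\mathfrak c)$ has the strong Markov property: for every starting point $z\in V\cup\{\infty\}$ and every stopping time $\tau$ of the filtration generated by $X^\infty$, on the event $\{\tau<\infty\}$ the $\mathbb P^\infty_z$-conditional law of $\{X^\infty_{\tau+s}\}_{s\ge0}$ given $\{X^\infty_s\}_{s\le\tau}$ is $\mathbb P^\infty_{X^\infty_\tau}$.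
   Context: **Graph.** $\mathcal G=(V,E)$ is a locally finite connected graph with conductances $\mathfrak c:E\to(0,\infty)$ on unoriented edges; $\pi(x)=\sum_{y\sim x}\mathfrak c(x,y)$. The random walk $\{X_n\}_{n\ge0}$ has transition kernel $p(x,y)=\mathfrak c(x,y)/\pi(x)$ and is assumed transient; $\mathbb P^{\mathrm{RW}}_x$ is its law started from $x$. **Harmonic functions.** $f:V\to\mathbb R$ is harmonic if $f(x)=\sum_{y\sim x}p(x,y)f(y)$ for all $x$. $\mathrm{Energy}(f)=\sum_{(u,v)\in E}\mathfrak c(u,v)[f(u)-f(v)]^2$ is its Dirichlet energy. **Random interlacements (RI).** $W_+$ and $W$ are the spaces of infinite and doubly infinite nearest-neighbour paths in $\mathcal G$, with Borel $\sigma$-algebras $\mathcal W_+$, $\mathcal W$. $W^*=W/\!\sim$ is the quotient by time shift, $\pi^*:W\to W^*$ the projection, and $A\in\mathcal W^*$ iff $(\pi^* )^{-1}(A)\in\mathcal W$. For finite $K\subset V$, $W_K$ is the set of $w\in W$ that visit $K$ and $W_K^*=\pi^*(W_K)$. Let $\widetilde H_K=\inf\{n\ge1: X_n\in K\}$, $\mathrm e_K(y)=\pi(y)\mathbb P^{\mathrm{RW}}_y[\widetilde H_K=\infty]$ for $y\in K$. Let $\mathbb Q_K$ be the measure on $(W,\mathcal W)$ with $$\mathbb Q_K[(X_{-n})_{n\ge0}\in A,\,X_0=y,\,(X_n)_{n\ge0}\in B]=\mathbb P^{\mathrm{RW}}_y[A\mid\widetilde H_K=\infty]\,\mathrm e_K(y)\,\mathbb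 P^{\mathrm{RW}}_y[B],\quad A,B\in\mathcal W_+,\ y\in K$$ (zero if $\mathrm e_K(y)=0$). There is a unique $\sigma$-finite measure $\nu$ on $(W^*,\mathcal W^* )$ with $\nu(A)=\mathbb Q_K[(\pi^* )^{-1}(A)]$ for every finite $K$ and $A\in\mathcal W^*$, $A\subset W_K^*$ (it is carried by paths visiting every finite set finitely often). RI is the Poisson point process $\boldsymbol\omega=\sum_{m\ge0}\delta_{(w_m^*,u_m)}$ on $W^*\times\mathbb R_+$ with intensity $\nu\otimes\text{Lebesgue}$; its law is $\mathbb P^{\mathrm{RI}}$. **Process version $Z$ of RI.** For each $m$ choose a representative $w_m\in(\pi^* )^{-1}(w_m^* )$ depending only on $w_m^*$. Conditionally on RI, let $\tilde t(m,n)$, $m\ge0,n\in\mathbb Z$, be independent $\mathrm{Exp}(1)$ variables (the joint law is still called $\mathbb P^{\mathrm{RI}}$). Given $\mathfrak m:V\to(0,\infty)$ set $t(m,n)=\tilde t(m,n)/\mathfrak m(w_m(n))$, $I(m,n)=\{(k,j):u_k<u_m\}\cup\{(m,j):j<n\}$, $T(m,n)=\sum_{(k,j)\in I(m,n)}t(k,j)$. For $t\ge0$, $Z_t=w_m(n)$ if $T(m,n)\le t<T(m,n)+t(m,n)$ for some $(m,n)$, and $Z_t=\infty$ otherwise. **Random walk reflected off of infinity (RW$^\infty$).** For non-empty finite $A\subset V$ and $\phi:A\to\mathbb R$ there is a unique $h^\phi:V\to\mathbb R$ that equals $\phi$ on $A$ and has minimal Dirichlet energy among functions equal to $\phi$ on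 $A$. RW$^\infty$ with rate function $\mathfrak m$ started at $z\in V$ is the unique (in law) process $X^\infty:[0,\infty)\to V\cup\{\infty\}$, $X_0^\infty=z$, satisfying: (i) for each $t\ge0$, a.s. $X_t^\infty\in V$ and $X^\infty$ is constant on a neighbourhood of $t$; (ii) a.s., for every $t$ with $X_t^\infty\in V$ there is $\varepsilon>0$ with $X_s^\infty=X_t^\infty$ for $s\in[t,t+\varepsilon]$; (iii) with $\tau=\min\{t>0:X_t^\infty\ne z\}$, $\tau$ and $X_\tau^\infty$ are independent, $\tau$ is exponential with rate $\mathfrak m(z)$, and $\mathbb P[X^\infty_\tau=y]=p(z,y)$ for $y\sim z$; (iv) for every $t\ge0$, $x\in V$, on $\{X_t^\infty=x\}$ the conditional law of $\{X^\infty_{s+t}\}_{s\ge0}$ given $\{X^\infty_s\}_{s\le t}$ is the law of the process started from $x$; (v) a.s. there are arbitrarily large $t$ with $X_t^\infty=z$; (vi) for every non-empty finite $A\subset V$ and $\phi:A\to\mathbb R$, with $\tau=\min\{t\ge0:X_t^\infty\in A\}$, $h^\phi(z)=\mathbb E_z[\phi(X_\tau^\infty)]$ for each starting vertex $z$. Its law started from $x\in V$ is $\mathbb P_x^\infty$, and $\tau_\infty=\inf\{t\ge 0:X_t^\infty=\infty\}$. **RW$^\infty$ started from $\infty$.** Under the conditions (A)–(C), $\mathbb P^\infty_\infty$ denotes the law of $\{X^\infty_{\tau_\infty+s}\}_{s\ge0}$ under $\mathbb P^\infty_z$, which under these conditions does not depend on $z\in V$. **Admissible $\mathfrak m$.**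 $\mathfrak m$ is admissible if both models can be defined with it: $\mathbb P^{\mathrm{RI}}$-a.s. all $T(m,n)$ are finite and $\sup_{m,n}T(m,n)=\infty$, and RW$^\infty$ with rate function $\mathfrak m$ exists and is unique in law for each starting vertex. It is known that there are functions $\mathfrak m_*,\mathfrak m_{**}:V\to(0,\infty)$ such that every $\mathfrak m$ with $\mathfrak m(x)>\max\{\mathfrak m_*(x),\mathfrak m_{**}(x)\}$ for all $x$ is admissible. **Spanning forests.** For a finite weighted graph, the $\mathfrak c$-spanning tree is the random spanning tree $\mathcal T$ with $\mathbb P[\mathcal T=\mathfrak t]\propto\prod_{e\in\mathfrak t}\mathfrak c(e)$. Let $\{\mathcal G_n\}$ be an increasing family of finite connected subgraphs with $\bigcup_n\mathcal G_n=\mathcal G$, and let $\mathcal G_n^{\mathrm W}$ be obtained from $\mathcal G$ by identifying all vertices outside $\mathcal G_n$ to a single vertex $z_n$. The $\mathfrak c$-free (resp. $\mathfrak c$-wired) spanning forest is the random subgraph of $\mathcal G$ which is the weak limit of the $\mathfrak c$-spanning trees of $\mathcal G_n$ (resp. $\mathcal G_n^{\mathrm W}$), i.e. the intersection with every finite edge set converges in law; the limits exist and do not depend on the exhaustion.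
   Formalization: Trajectories of the reflected walk are also assumed a.s. right-continuous at times when they are at infinity (one-point compactification of V); conditions (i)–(vi) alone do not determine the first visit time to infinity, nor hence the law started from infinity. *)

(* Defs.v *)
From HB Require Import structures.
From Stdlib Require Import Relation_Operators.
From mathcomp Require Import all_boot all_order all_algebra.
From mathcomp Require Import finmap.
From mathcomp Require Import all_classical all_reals all_analysis.
Import Order.TTheory GRing.Theory Num.Theory.
Import numFieldNormedType.Exports.

Set Implicit Arguments.
Unset Strict Implicit.
Unset Printing Implicit Defensive.

Local Open Scope classical_set_scope.
Local Open Scope ring_scope.

(** * Weighted graphs *)

(* Unoriented edges are two-element finite sets.  The values of [conductance]
   off [edges] are never used.  Vertex sets are [pointedType]s because the
   measurable spaces of the library are pointed; countability is not assumed,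
   it follows from connectedness and local finiteness. *)
Record network (R : realType) (V : pointedType) := Network {
  edges : set {fset V};
  conductance : {fset V} -> R;
  edge_card : forall e, edges e -> #|` e| = 2%N;
  conductance_gt0 : forall e, edges e -> 0 < conductance e;
  locally_finite : forall x, finite_set [set e | edges e /\ x \in e];
  connected_network : forall x y,
    clos_refl_trans V (fun a b => edges [fset a; b]%fset) x y
}.

Section network_defs.
Context {R : realType} {V : pointedType}.
Variable G : network R V.

Definition adj (x y : V) : Prop := edges G [fset x; y]%fset.

Definition cond (x y : V) : R :=
  if `[< adj x y >] then conductance G [fset x; y]%fset else 0.

Definition vweight (x : V) : R := \sum_(y \in [set y | adj x y]) cond x y.

Definition trans_prob (x y : V) : R := cond x y / vweight x.

Definition harmonic_function (f : V -> R) : Prop :=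
  forall x, f x = \sum_(y \in [set y | adj x y]) trans_prob x y * f y.

(* For e = {u, v} the inner double sum is 2 (f u - f v)^2. *)
Definition energy (f : V -> R) : \bar R :=
  \esum_(e in edges G)
    (conductance G e * ((\sum_(u <- e) \sum_(v <- e) (f u - f v) ^+ 2) / 2))%:E.

(* h = h^phi; only the values of phi on A matter. *)
Definition min_energy_ext (A : {fset V}) (phi h : V -> R) : Prop :=
  (forall x, x \in A -> h x = phi x) /\
  (forall g : V -> R, (forall x, x \in A -> g x = phi x) ->
     (energy h <= energy g)%E).

Definition finite_energy_harmonic_constant : Prop :=
  forall f : V -> R, harmonic_function f -> (energy f < +oo)%E -> forall x y, f x = f y.

End network_defs.

(** * Random walk *)

Definition path_cylinders (V : pointedType) : set (set (nat -> V)) :=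
  [set A | exists n x, A = [set w | w n = x]].

(* W_+.  The space contains all sequences of vertices; the measures below are
   carried by the nearest-neighbour ones. *)
Notation wpath V := (g_sigma_algebraType (@path_cylinders V)).

Definition rw_law (R : realType) (V : pointedType) (G : network R V) (x : V)
    (P : probability (wpath V) R) : Prop :=
  forall (n : nat) (s : nat -> V),
    P [set w : wpath V | forall i, (i <= n)%N -> w i = s i] =
    ((s 0%N == x)%:R * \prod_(i < n) trans_prob G (s i) (s i.+1))%:E.

(* The event that the hitting time inf {n >= 1 : X_n \in K} is infinite. *)
Definition no_return (V : pointedType) (K : {fset V}) : set (wpath V) :=
  [set w | forall n, (1 <= n)%N -> w n \notin K].

Definition transient (R : realType) (V : pointedType)
    (PRW : V -> probability (wpath V) R) : Prop :=
  forall x, (0 < PRW x (no_return [fset x]%fset))%E.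

(** * Doubly infinite paths modulo time shift *)

Definition dpath_cylinders (V : pointedType) : set (set (int -> V)) :=
  [set A | exists n x, A = [set w | w n = x]].

Notation dpath V := (g_sigma_algebraType (@dpath_cylinders V)).

Section time_shift.
Variable V : pointedType.

Definition shift_eq (w w' : dpath V) : bool :=
  `[< exists k : int, forall n : int, w' n = w (n + k) >].

Lemma shift_eq_equiv : equiv_class_of shift_eq.
Proof.
split.
- by move=> w; apply/asboolP; exists 0 => n; rewrite addr0.
- move=> w w'; apply/asboolP/asboolP => -[k kE]; exists (- k) => n.
  + by rewrite kE subrK.
  + by rewrite kE subrK.
- move=> w' w w'' /asboolP[k kE] /asboolP[l lE]; apply/asboolP.
  by exists (l + k) => n; rewrite lE kE addrA.
Qed.

Canonical shift_eq_rel := EquivRelPack shift_eq_equiv.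

Definition dpath_quot := {eq_quot shift_eq_rel}%qT.
HB.instance Definition _ := EqQuotient.on dpath_quot.
HB.instance Definition _ := Choice.on dpath_quot.

Definition proj_star (w : dpath V) : dpath_quot := \pi_(dpath_quot)%qT w.

HB.instance Definition _ := isPointed.Build dpath_quot (proj_star point).

(* W^*: the generating family, all A whose preimage in W is measurable, is
   already a sigma-algebra. *)
Definition star_events : set (set dpath_quot) :=
  [set A | measurable (proj_star @^-1` A)].

End time_shift.

Notation dpath_star V := (g_sigma_algebraType (@star_events V)).

(** * Random interlacements *)

Section interlacement_intensity.
Context {R : realType} {V : pointedType}.
Variables (G : network R V) (PRW : V -> probability (wpath V) R).

Definition equilibrium (K : {fset V}) (y : V) : R :=
  vweight G y * fine (PRW y (no_return K)).

(* When e_K(y) = 0 the right-hand side is 0, division by 0 being 0. *)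
Definition is_QK (K : {fset V}) (Q : {measure set (dpath V) -> \bar R}) : Prop :=
  (forall (y : V) (A B : set (wpath V)),
     y \in K -> measurable A -> measurable B ->
     Q [set w : dpath V | [/\ A (fun n : nat => w (- n%:Z)),
                              w 0 = y
                            & B (fun n : nat => w n%:Z)]] =
     ((fine (PRW y (A `&` no_return K)) / fine (PRW y (no_return K))
         * equilibrium K y)%:E * PRW y B)%E) /\
  Q [set w : dpath V | w 0 \notin K] = 0%E.

Definition visits (K : {fset V}) : set (dpath V) :=
  [set w | exists n : int, w n \in K].

Definition interlacement_intensity
    (nu : {sigma_finite_measure set (dpath_star V) -> \bar R}) : Prop :=
  forall K : {fset V},
    exists2 Q : {measure set (dpath V) -> \bar R}, is_QK K Q &
      forall A : set (dpath_star V), measurable A ->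
        A `<=` @proj_star V @` visits K -> nu A = Q (@proj_star V @^-1` A).

End interlacement_intensity.

(* A complete probability space carrying points (w^*_m, u_m), clocks
   \tilde t(m, n) and a choice of representatives. *)
Record interlacement (R : realType) (V : pointedType) := Interlacement {
  ri_disp : measure_display;
  ri_space : measurableType ri_disp;
  ri_prob : probability ri_space R;
  ri_complete : measure_is_complete ri_prob;
  wstar : nat -> ri_space -> dpath_star V;
  label : nat -> ri_space -> R;
  clock : nat -> int -> ri_space -> R;
  repr_path : dpath_star V -> dpath V
}.
Arguments ri_complete {R V}.
Arguments wstar {R V}.
Arguments label {R V}.
Arguments clock {R V}.
Arguments repr_path {R V}.

Section interlacement_defs.
Context {R : realType} {V : pointedType}.
Variable I : interlacement R V.

Definition poisson_weight (lambda : R) (k : nat) : R :=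
  lambda ^+ k / k`!%:R * expR (- lambda).

(* Poisson point process on W^* x R_+ with intensity nu (x) Lebesgue; the
   counts on sets of infinite intensity are determined by sigma-finiteness. *)
Definition poisson_points
    (nu : {sigma_finite_measure set (dpath_star V) -> \bar R}) : Prop :=
  [/\ forall m, measurable_fun setT (wstar I m),
      forall m, measurable_fun setT (label I m),
      forall m w, 0 <= label I m w &
      forall (k : nat) (A : 'I_k -> set (dpath_star V * R)) (j : 'I_k -> nat),
        (forall i, measurable (A i)) ->
        (forall i, A i `<=` [set p | 0 <= p.2]) ->
        trivIset setT A ->
        (forall i, ((nu \x lebesgue_measure) (A i) < +oo)%E) ->
        ri_prob I [set w | forall i,
          ([set m | A i (wstar I m w, label I m w)] #= `I_(j i))%card] =
        (\prod_(i < k)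
           poisson_weight (fine ((nu \x lebesgue_measure)%E (A i))) (j i))%:E].

Definition point_events : set (set (ri_space I)) :=
  <<s [set E | exists m,
        (exists2 A, measurable A & E = wstar I m @^-1` A) \/
        (exists2 B, measurable B & E = label I m @^-1` B)] >>.

(* Given the points, the clocks are independent Exp(1) variables. *)
Definition exponential_clocks : Prop :=
  (forall m n, measurable_fun setT (clock I m n)) /\
  forall (D : set (ri_space I)) (S : {fset nat * int}) (B : nat * int -> set R),
    point_events D -> (forall p, measurable (B p)) ->
    ri_prob I (D `&` [set w | forall p, p \in S -> B p (clock I p.1 p.2 w)]) =
    (ri_prob I D * \prod_(p <- S) exponential_prob 1 (B p))%E.

(* Representatives can only be chosen measurably off a nu-null set: the
   quotient of all of W by the shift has no measurable section. *)
Definition representatives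
    (nu : {sigma_finite_measure set (dpath_star V) -> \bar R}) : Prop :=
  (forall a, proj_star (repr_path I a) = a) /\
  exists D : set (dpath_star V),
    [/\ measurable D, nu (~` D) = 0%E & measurable_fun D (repr_path I)].

Definition is_interlacement
    (nu : {sigma_finite_measure set (dpath_star V) -> \bar R}) : Prop :=
  [/\ poisson_points nu, exponential_clocks & representatives nu].

Variable m : V -> R.

Definition site (w : ri_space I) (p : nat * int) : V :=
  repr_path I (wstar I p.1 w) p.2.

Definition holding (w : ri_space I) (p : nat * int) : R :=
  clock I p.1 p.2 w / m (site w p).

Definition before (w : ri_space I) (p : nat * int) : set (nat * int) :=
  [set q | label I q.1 w < label I p.1 w \/ q.1 = p.1 /\ q.2 < p.2].

Definition start_time (w : ri_space I) (p : nat * int) : \bar R :=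
  \esum_(q in before w p) (holding w q)%:E.

Definition occupied (w : ri_space I) (t : R) : set (nat * int) :=
  [set p | (start_time w p <= t%:E)%E /\
           (t%:E < start_time w p + (holding w p)%:E)%E].

(* None is the point at infinity.  Almost surely [occupied w t] has at most
   one element, so that [xget] makes no choice. *)
Definition Zpath (w : ri_space I) (t : R) : option V :=
  if `[< occupied w t !=set0 >] then Some (site w (xget (0%N, 0) (occupied w t)))
  else None.

Definition admissible_clocks : Prop :=
  {ae ri_prob I, forall w,
     (forall p, (start_time w p < +oo)%E) /\
     ereal_sup (range (start_time w)) = +oo%E}.

End interlacement_defs.

(** * Processes with values in V \cup {infinity} *)

(* Trajectories are functions on R of which only the restriction to [0, +oo[
   is used; None is the point at infinity. *)
Record process (R : realType) (V : pointedType) := Process {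
  pr_disp : measure_display;
  pr_space : measurableType pr_disp;
  pr_prob : probability pr_space R;
  pr_complete : measure_is_complete pr_prob;
  traj : pr_space -> R -> option V
}.
Arguments pr_complete {R V}.
Arguments traj {R V}.

Section processes.
Context {R : realType} {V : pointedType}.
Implicit Types X Y : process R V.

Definition traj_events : set (set (R -> option V)) :=
  <<s [set C | exists (t : R) a, 0 <= t /\ C = [set x : R -> option V | x t = a]] >>.

Definition law X (C : set (R -> option V)) : \bar R :=
  pr_prob X (traj X @^-1` C).

Definition same_law X Y : Prop := forall C, traj_events C -> law X C = law Y C.

Definition shift_traj (x : R -> option V) (s : R) : R -> option V :=
  fun t => x (s + t).

(* sigma(X_s : s <= t), completed by the null sets. *)
Definition history X (t : R) : set (set (pr_space X)) :=
  <<s [set E | (exists (s : R) a, [/\ 0 <= s, s <= t &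
                  E = [set w | traj X w s = a]])
               \/ (pr_prob X).-negligible E] >>.
Arguments history : clear implicits.

Definition stopping_time X (tau : pr_space X -> \bar R) : Prop :=
  (forall w, (0 <= tau w)%E) /\
  (forall t : R, 0 <= t -> history X t [set w | (tau w <= t%:E)%E]).

Definition stopped_history X (tau : pr_space X -> \bar R) :
    set (set (pr_space X)) :=
  [set B | measurable B /\
     forall t : R, 0 <= t -> history X t (B `&` [set w | (tau w <= t%:E)%E])].

(* [start a] is the process started from a. *)
Definition strong_markov (start : option V -> process R V) : Prop :=
  forall (z : option V) (tau : pr_space (start z) -> \bar R),
    stopping_time tau ->
    forall (B : set (pr_space (start z))) (a : option V)
      (C : set (R -> option V)),
      stopped_history tau B -> traj_events C ->
      let X := traj (start z) in
      let D := B `&` [set w | (tau w < +oo)%E] `&`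
               [set w | X w (fine (tau w)) = a] in
      let E := [set w | C (shift_traj (X w) (fine (tau w)))] in
      [/\ measurable D, measurable (D `&` E) &
          pr_prob (start z) (D `&` E) =
          (pr_prob (start z) D * law (start a) C)%E].

Definition hit_infinity (x : R -> option V) : R :=
  inf [set t : R | 0 <= t /\ x t = None].

Definition from_infinity X : process R V :=
  @Process R V (pr_disp X) (pr_space X) (pr_prob X) (pr_complete X)
    (fun w => shift_traj (traj X w) (hit_infinity (traj X w))).

(* The family (P^infty_z) for z in V \cup {infinity}, P^infty_infty being
   realized from the process started at z0. *)
Definition rwinf_family (X : V -> process R V) (z0 : V) (a : option V) :
    process R V :=
  if a is Some x then X x else from_infinity (X z0).

Definition Zprocess (I : interlacement R V) (m : V -> R) : process R V :=
  @Process R V (ri_disp I) (ri_space I) (ri_prob I) (ri_complete I)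
    (@Zpath R V I m).

End processes.
Arguments history {R V}.

(** * Random walk reflected off of infinity *)

Section reflected_walk.
Context {R : realType} {V : pointedType}.
Variables (G : network R V) (m : V -> R).

Definition exit_set (z : V) (x : R -> option V) : set R :=
  [set t : R | 0 < t /\ x t <> Some z].

Definition hit_set (A : {fset V}) (x : R -> option V) : set R :=
  [set t : R | 0 <= t /\ exists2 a, a \in A & x t = Some a].

Definition extend0 (phi : V -> R) (a : option V) : R :=
  if a is Some x then phi x else 0.

(* [X z] is the process started from z.  The first exit and hitting times are
   infima that are almost surely attained.  [rwinf_rc] is right-continuity at
   infinity for the one-point compactification of the discrete space V:
   together with [rwinf_step] it makes trajectories right-continuous, without
   which finite-dimensional distributions do not determine the law of
   first-passage functionals such as [hit_infinity]. *)
Record is_rwinf (X : V -> process R V) : Prop := {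
  rwinf_meas : forall z (t : R) a, 0 <= t ->
    measurable [set w | traj (X z) w t = a];
  rwinf_rc : forall z, {ae pr_prob (X z), forall w,
    forall (t : R) (A : {fset V}), 0 <= t -> traj (X z) w t = None ->
    exists2 eps : R, 0 < eps & forall (s : R) a, t <= s <= t + eps -> a \in A ->
      traj (X z) w s <> Some a};
  rwinf_start : forall z,
    {ae pr_prob (X z), forall w, traj (X z) w 0 = Some z};
  rwinf_locally_constant : forall z (t : R), 0 <= t ->
    {ae pr_prob (X z), forall w, exists2 x, traj (X z) w t = Some x &
       exists2 eps : R, 0 < eps & forall s : R, 0 <= s -> `|s - t| < eps ->
         traj (X z) w s = Some x};
  rwinf_step : forall z, {ae pr_prob (X z), forall w,
    forall (t : R) x, 0 <= t -> traj (X z) w t = Some x ->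
    exists2 eps : R, 0 < eps & forall s : R, t <= s <= t + eps ->
      traj (X z) w s = Some x};
  rwinf_exit : forall z,
    let tau w := inf (exit_set z (traj (X z) w)) in
    let Xtau w := traj (X z) w (tau w) in
    [/\ {ae pr_prob (X z), forall w,
           exit_set z (traj (X z) w) (tau w)},
        forall B a, measurable B ->
          pr_prob (X z) (tau @^-1` B `&` Xtau @^-1` [set a]) =
          (pr_prob (X z) (tau @^-1` B) * pr_prob (X z) (Xtau @^-1` [set a]))%E,
        forall B, measurable B ->
          pr_prob (X z) (tau @^-1` B) = exponential_prob (m z) B &
        forall y, adj G z y ->
          pr_prob (X z) (Xtau @^-1` [set Some y]) = (trans_prob G z y)%:E];
  rwinf_markov : forall z (t : R) x B C, 0 <= t ->
    history (X z) t B -> traj_events C ->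
    let D := B `&` [set w | traj (X z) w t = Some x] in
    pr_prob (X z)
      (D `&` [set w | C (shift_traj (traj (X z) w) t)]) =
    (pr_prob (X z) D * law (X x) C)%E;
  rwinf_recurrent : forall z, {ae pr_prob (X z), forall w,
    forall T : R, exists2 t : R, T <= t & 0 <= t /\ traj (X z) w t = Some z};
  rwinf_hitting : forall z (A : {fset V}) (phi h : V -> R),
    A != fset0 -> min_energy_ext G A phi h ->
    let tau w := inf (hit_set A (traj (X z) w)) in
    {ae pr_prob (X z), forall w, hit_set A (traj (X z) w) (tau w)} /\
    ('E_(pr_prob (X z))[fun w => extend0 phi (traj (X z) w (tau w))] =
     (h z)%:E)%E
}.

Definition rwinf_exists_unique : Prop :=
  (exists X, is_rwinf X) /\
  (forall X Y, is_rwinf X -> is_rwinf Y -> forall z, same_law (X z) (Y z)).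

Definition admissible
    (nu : {sigma_finite_measure set (dpath_star V) -> \bar R}) : Prop :=
  (forall I : interlacement R V, is_interlacement I nu ->
     admissible_clocks I m) /\
  rwinf_exists_unique.

Definition reflected_from_infinity_is_Z (X : V -> process R V)
    (I : interlacement R V) : Prop :=
  forall x, same_law (from_infinity (X x)) (Zprocess I m).

End reflected_walk.

(** * Free and wired spanning forests *)

Section spanning_forests.
Context {R : realType} {V : pointedType}.
Variable G : network R V.

(* A finite multigraph is given by a set D of vertices and a finite set F of
   edges of G, the edge {x, y} joining k x to k y. *)
Definition joined (U : Type) (k : V -> U) (F : {fset {fset V}}) : U -> U -> Prop :=
  clos_refl_trans U (fun a b =>
    exists x y, [/\ [fset x; y]%fset \in F, a = k x & b = k y]).

(* Acyclicity: no edge joins vertices already joined by the other edges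
   (this excludes loops and parallel edges). *)
Definition spanning_tree (U : Type) (k : V -> U) (D : set U)
    (F : {fset {fset V}}) : Prop :=
  (forall a b, D a -> D b -> joined k F a b) /\
  (forall x y, [fset x; y]%fset \in F ->
     ~ joined k (F `\ [fset x; y])%fset (k x) (k y)).

Definition tree_weight (F : {fset {fset V}}) : R :=
  \prod_(e <- F) conductance G e.

(* P[T \cap S = A] for the spanning tree T of the multigraph (D, E). *)
Definition ust_prob (U : Type) (k : V -> U) (D : set U)
    (E S A : {fset {fset V}}) : R :=
  (\sum_(F <- fpowerset E | `[< spanning_tree k D F >] && (F `&` S == A)%fset)
     tree_weight F) /
  (\sum_(F <- fpowerset E | `[< spanning_tree k D F >]) tree_weight F).

Record exhaustion (vs : nat -> {fset V}) (es : nat -> {fset {fset V}}) : Prop := {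
  exhaustion_sub : forall n e, e \in es n -> edges G e /\ (e `<=` vs n)%fset;
  exhaustion_incr : forall n,
    (vs n `<=` vs n.+1)%fset /\ (es n `<=` es n.+1)%fset;
  exhaustion_connected : forall n x y, x \in vs n -> y \in vs n ->
    joined id (es n) x y;
  exhaustion_vertices : forall x, exists n, x \in vs n;
  exhaustion_edges : forall e, edges G e -> exists n, e \in es n
}.

(* Contraction of all the vertices outside vs to the vertex z_n = None. *)
Definition contract (vs : {fset V}) (x : V) : option V :=
  if x \in vs then Some x else None.

Definition contracted_vertices (vs : {fset V}) : set (option V) :=
  [set a | a = None \/ exists2 x, x \in vs & a = Some x].

(* Edges with both ends outside vs become loops and are left out. *)
Definition contracted_edges (vs : {fset V}) : {fset {fset V}} :=
  fset_set [set e | edges G e /\ exists2 x, x \in vs & x \in e].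

Definition forest_cylinders : set (set (set {fset V})) :=
  [set A | exists e, A = [set F : set {fset V} | F e]].

Local Notation subgraph := (g_sigma_algebraType forest_cylinders).

Definition trace_event (S A : {fset {fset V}}) : set subgraph :=
  [set F : subgraph | forall e, (e \in S /\ F e) <-> e \in A].

Definition free_forest_law (mu : probability subgraph R) : Prop :=
  forall vs es, exhaustion vs es -> forall S A : {fset {fset V}},
    ust_prob id [set` vs n] (es n) S A @[n --> \oo] -->
    fine (mu (trace_event S A)).

Definition wired_forest_law (mu : probability subgraph R) : Prop :=
  forall vs es, exhaustion vs es -> forall S A : {fset {fset V}},
    ust_prob (contract (vs n)) (contracted_vertices (vs n))
      (contracted_edges (vs n)) S A @[n --> \oo] -->
    fine (mu (trace_event S A)).

Definition free_wired_coincide : Prop :=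
  exists mu, free_forest_law mu /\ wired_forest_law mu.

End spanning_forests.

(* Main.v *)
(** The theorem follows from one property of the reflected walk: the law of its
    trajectory after the first visit to infinity does not depend on the starting
    vertex.  Under (B) this is immediate.  Under (A), the probability to first
    hit a finite set [A] at [a] after infinity is a harmonic function of the
    starting vertex; it has finite energy, because the probability to hit [A] at
    [a] is the energy minimizing extension of [1_a], and the probability to do
    so before infinity is a limit of Dirichlet solutions on finite sets.  So it
    is constant, and [A] may then exhaust the graph.

    (C) implies (A): in a finite network, the edge potential of Kirchhoff's
    theorem has both energy and gradient along [e] equal to [P[e \in T] / c(e)].
    In the free case this bounds [c(e) (f x - f y)^2] by [P[e \in T]] times the
    energy of [f]; in the wired case the potential is finitely supported, hence
    orthogonal to a harmonic [f].  If the two probabilities agree in the limit,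
    the bound for all [a * potential + f] forces [f x = f y].

    At an optional time [T] with [X_T] in [V], the strong Markov property follows
    from the Markov property at grid times decreasing to [T] and from
    right-continuity.  When [X_T] is infinity, finite energy shows that a walk
    started far away is unlikely to reach a given finite set before infinity;
    hence infinity is visited at times decreasing to [T].  The trajectory after
    the first visit to infinity following a grid time is independent of the past,
    with a fixed law, and one lets the grid times tend to [T].
    Infinity is visited at all because the random walk is transient. *)

Require Import Defs.
From HB Require Import structures.
From Stdlib Require Import Relation_Operators.
From mathcomp Require Import all_boot all_order all_algebra.
From mathcomp Require Import finmap.
From mathcomp Require Import all_classical all_reals.
From mathcomp Require Import ereal normedtype sequences esum numfun exp.
From mathcomp Require Import measure lebesgue_measure measurable_realfun.
From mathcomp Require Import lebesgue_integral probability.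
From mathcomp Require Import ring lra.
Import Order.TTheory GRing.Theory Num.Theory.
Import numFieldNormedType.Exports.

Set Implicit Arguments.
Unset Strict Implicit.
Unset Printing Implicit Defensive.

Local Open Scope classical_set_scope.
Local Open Scope ring_scope.

(** * Sigma-algebras of events *)

(** Hitting times involve uncountably many times, whereas almost sure statements are available at
    countably many. On right-continuous trajectories a visit to a finite set is seen at a rational
    time, but almost surely no rational time is spent at infinity. A visit to infinity can be
    detected only if a trajectory avoiding infinity on a compact interval stays in a finite set, and
    this needs control from the left: just before a time spent at a vertex, the trajectory lies in a
    finite set. That is not a defining property and is derived. The expected number of exits from a
    vertex seen on a grid is bounded uniformly in the mesh, so the indicator of each vertex has left
    limits, and a walk outside a vertex and its neighbours does not enter the vertex before one of
    the neighbours. Events are therefore handled modulo bad trajectories, at two levels: those not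
    right-continuous, then those not in [good_path]. The reflected walk is compared with the random
    walk only through harmonic functions: Dirichlet solutions on finite sets are dominated by return
    probabilities. *)

Section sigma_algebra_events.
Variables (T : Type) (F : set (set T)).
Hypothesis sF : sigma_algebra setT F.

Lemma sa_not (P : T -> Prop) : F [set w | P w] -> F [set w | ~ P w].
Proof.
case: sF => _ sC _ FP; suff -> : [set w | ~ P w] = setT `\` [set w | P w] by exact: sC.
by apply/seteqP; split => w /=; tauto.
Qed.

Lemma sa_const (P : Prop) : F [set w | P].
Proof.
have [p|np] := pselect P.
- rewrite (_ : [set w | P] = [set w | ~ set0 w]); first by apply: sa_not; case: sF => ? _ _.
  by apply/seteqP; split => w //=; tauto.
- rewrite (_ : [set w | P] = set0); first by case: sF => ? _ _.
  by apply/seteqP; split => w //=.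
Qed.

Lemma sa_bigcup (A : nat -> set T) : (forall n, F (A n)) -> F (\bigcup_n A n).
Proof. by case: sF => _ _; apply. Qed.

Lemma sa_existsc (I : choiceType) (D : set I) (P : I -> T -> Prop) :
  countable D -> (forall i, D i -> F [set w | P i w]) ->
  F [set w | exists2 i, D i & P i w].
Proof.
have [->|D0] := pselect (D = set0).
  move=> _ _; rewrite (_ : [set w | _] = [set w | False]); first exact: sa_const.
  by apply/seteqP; split => w //= -[i].
move=> /pfcard_geP [De|[f]] FP; first by case: D0.
rewrite (_ : [set w | _] = \bigcup_n [set w | P (f n) w]).
  by apply: sa_bigcup => n; apply: FP; exact: funS.
apply/seteqP; split => w /=.
- by move=> [i /(@surj _ _ _ _ f)[n _ <-] Pi]; exists n.
- by move=> [n _ /= Pn]; exists (f n) => //; exact: funS.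
Qed.

Lemma sa_exists (I : choiceType) (P : I -> T -> Prop) : countable [set: I] ->
  (forall i, F [set w | P i w]) -> F [set w | exists i, P i w].
Proof.
move=> cI FP; rewrite (_ : [set w | _] = [set w | exists2 i, [set: I] i & P i w]).
  by apply: sa_existsc => // i _; exact: FP.
by apply/seteqP; split => w /= [i]; exists i.
Qed.

Lemma sa_forall (I : choiceType) (P : I -> T -> Prop) : countable [set: I] ->
  (forall i, F [set w | P i w]) -> F [set w | forall i, P i w].
Proof.
move=> cI FP; rewrite (_ : [set w | _] = [set w | ~ exists i, ~ P i w]).
  by apply: sa_not; apply: sa_exists => // i; exact: sa_not.
apply/seteqP; split => w /=; first by move=> Pw [i]; apply; exact: Pw.
by move=> Pw i; apply: contrapT => Pi; apply: Pw; exists i.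
Qed.

Lemma sa_or (P Q : T -> Prop) :
  F [set w | P w] -> F [set w | Q w] -> F [set w | P w \/ Q w].
Proof.
move=> FP FQ; rewrite (_ : [set w | _] = [set w | exists b : bool, (if b then P else Q) w]).
  by apply: sa_exists; [exact: countableP | case].
apply/seteqP; split => w /=; first by move=> [|]; [exists true|exists false].
by move=> [[|]]; tauto.
Qed.

Lemma sa_and (P Q : T -> Prop) :
  F [set w | P w] -> F [set w | Q w] -> F [set w | P w /\ Q w].
Proof.
move=> FP FQ; rewrite (_ : [set w | _] = [set w | ~ (~ P w \/ ~ Q w)]).
  by apply: sa_not; apply: sa_or; exact: sa_not.
by apply/seteqP; split => w /=; have [] := pselect (P w); have [] := pselect (Q w); tauto.
Qed.

Lemma sa_imply (P Q : T -> Prop) :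
  F [set w | P w] -> F [set w | Q w] -> F [set w | P w -> Q w].
Proof.
move=> FP FQ; rewrite (_ : [set w | _] = [set w | ~ P w \/ Q w]).
  by apply: sa_or => //; exact: sa_not.
by apply/seteqP; split => w /=; have [] := pselect (P w); tauto.
Qed.

Lemma sa_ext (P Q : T -> Prop) : F [set w | P w] -> (forall w, P w <-> Q w) ->
  F [set w | Q w].
Proof using sF.
move=> FP PQ; rewrite (_ : [set w | Q w] = [set w | P w]) //.
by apply/seteqP; split => w /= /PQ.
Qed.

(** Every subset of [N] being an event, an event only has to be described correctly off [N]. With
    [N] the bad trajectories, conditions on uncountably many times are replaced by countable
    ones. *)
Lemma sa_mod (N P Q : T -> Prop) :
  (forall E : set T, (forall w, E w -> N w) -> F E) ->
  F [set w | P w] -> (forall w, ~ N w -> P w <-> Q w) -> F [set w | Q w].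
Proof.
move=> FN FP PQ.
apply: (@sa_ext (fun w => (P w /\ ~ N w) \/ (Q w /\ N w))).
  apply: sa_or; last by apply: FN => w /= [].
  by apply: sa_and => //; apply: sa_not; exact: FN.
by move=> w; have := PQ w; have [] := pselect (N w); tauto.
Qed.

End sigma_algebra_events.

Section eventually_equal_events.
Context d (T : measurableType d) (R : realType) (mu : probability T R).

(** Dominated convergence for indicators. Limits along grid times and along exhaustions are taken
    through this lemma. *)
Lemma cvg_prob_eventually (E : nat -> set T) (E' : set T) :
  (forall n, measurable (E n)) -> measurable E' ->
  {ae mu, forall w, exists N, forall n, (N <= n)%N -> E n w <-> E' w} ->
  mu (E n) @[n --> \oo] --> mu E'.
Proof.
move=> mE mE' aeE.
have mi (A : set T) : measurable A -> measurable_fun setT (fun x => (\1_A x)%:E : \bar R).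
  by move=> mA; apply/measurable_EFinP; exact: measurable_indic.
rewrite -(setIT E') -integral_indic //.
rewrite (_ : (fun n => _) = (fun n => \int[mu]_(x in setT) (\1_(E n) x)%:E)%E); last first.
  by apply/funext => n; rewrite integral_indic // setIT.
have [//|||||_ _ //] := @dominated_convergence _ T R mu setT measurableT
  (fun n x => (\1_(E n) x)%:E) (fun x => (\1_E' x)%:E) (cst 1%E).
- by move=> n; exact: mi.
- exact: mi.
- move: aeE; apply: filterS => w [N H] _; apply: cvg_near_cst; exists N => // n /= Nn.
  have {}H := H _ Nn; congr (_%:R%:E); congr nat_of_bool.
  by apply/idP/idP; rewrite !inE => /H.
- by have := finite_measure_integrable_cst mu 1 measurableT.
- by apply: aeW => x n _ /=; rewrite indicE; case: (_ \in _); rewrite ?normr1 ?normr0 ?lee_fin.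
Qed.

End eventually_equal_events.

(** * Right-continuous trajectories *)

Lemma inf_min (R : realType) (E : set R) (t : R) :
  E t -> (forall r, E r -> t <= r) -> inf E = t.
Proof.
move=> Et lb; apply/eqP; rewrite eq_le; apply/andP; split.
- by apply: ge_inf => //; exists t.
- by apply: lb_le_inf => //; exists t.
Qed.

Lemma rat_between (R : realType) (a b : R) : a < b ->
  exists q : rat, a < ratr q < b.
Proof. by move=> /rat_in_itvoo[q]; rewrite in_itv /= => ?; exists q. Qed.

(** * Grid times decreasing to a given time *)

Section grid.
Context {R : realType}.
Implicit Types (n k : nat) (t : R).

Definition grid n k : R := k%:R / n.+1%:R.
Definition grid_index n t : nat := Num.truncn (t * n.+1%:R).
(** Strictly after [t] even when [t] is on the grid: an optional time [T] is known only through the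
    events [T < t], so its grid index is known at the right end of the grid interval. *)
Definition grid_up n t : R := grid n (grid_index n t).+1.

Lemma grid_ge0 n k : 0 <= grid n k. Proof. exact: divr_ge0. Qed.

Lemma gridS n k : grid n k.+1 = grid n k + n.+1%:R^-1.
Proof. by rewrite /grid -natr1 mulrDl mul1r. Qed.

Lemma grid_indexP n t k : 0 <= t ->
  grid_index n t = k <-> grid n k <= t < grid n k.+1.
Proof.
move=> t0; have n0 : (0 : R) < n.+1%:R by [].
have tn0 : 0 <= t * n.+1%:R by rewrite mulr_ge0.
rewrite /grid ler_pdivrMr // ltr_pdivlMr //; split.
- by move=> <-; exact: truncn_itv.
- by move=> h; exact: truncn_def.
Qed.

Lemma grid_up_gt n t : 0 <= t -> t < grid_up n t.
Proof. by move=> t0; have /(grid_indexP _ _ t0)/andP[] := erefl (grid_index n t). Qed.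

Lemma grid_up_le n t : 0 <= t -> grid_up n t <= t + n.+1%:R^-1.
Proof.
move=> t0; have /(grid_indexP _ _ t0)/andP[] := erefl (grid_index n t).
by rewrite /grid_up gridS lerD2r.
Qed.

Lemma invn_lt (e : R) : 0 < e -> exists N, forall n, (N <= n)%N -> n.+1%:R^-1 < e.
Proof.
move=> e0; exists (Num.truncn e^-1) => n Nn.
rewrite -[ltRHS]invrK ltf_pV2 ?posrE ?invr_gt0 //.
apply: lt_le_trans (_ : (Num.truncn e^-1).+1%:R <= _); last by rewrite ler_nat.
have e1 : 0 <= e^-1 by rewrite invr_ge0 ltW.
by have /andP[] := truncn_itv e1.
Qed.

Lemma grid_up_near t e : 0 <= t -> 0 < e ->
  exists N, forall n, (N <= n)%N -> t <= grid_up n t <= t + e.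
Proof.
move=> t0 /invn_lt[N HN]; exists N => n /HN ne.
rewrite (ltW (grid_up_gt _ t0)) /=; apply: le_trans (grid_up_le _ t0) _.
by rewrite lerD2l ltW.
Qed.

End grid.

(** * Trajectories, first hits and good paths *)

Section paths.
Context {R : realType} {V : pointedType}.
Local Notation path := (R -> option V).
Implicit Types (x : path) (S : set (option V)) (A : {fset V}).

Definition in_fset (A : {fset V}) : set (option V) :=
  [set a | if a is Some v then v \in A else false].

Definition right_open S x := forall t, 0 <= t -> S (x t) ->
  exists2 eps, 0 < eps & forall s, t <= s <= t + eps -> S (x s).

Definition right_cont x := (forall v, right_open [set Some v] x) /\
  (forall A, right_open (~` in_fset A) x).

(** The clopen sets of the one-point compactification of the discrete space [V]. For infinite [V]
    the singleton of infinity is closed but not among them, hence the separate treatment of infinity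
    throughout. *)
Definition clopen S := exists A, S = in_fset A \/ S = ~` in_fset A.

Lemma clopenC S : clopen S -> clopen (~` S).
Proof. by move=> [A [->|->]]; exists A; rewrite ?setCK; [right|left]. Qed.

Lemma clopen1 v : clopen [set Some v].
Proof.
exists [fset v]%fset; left; apply/seteqP; split => [a ->|[a|] //=].
  by rewrite /= inE.
by rewrite inE => /eqP->.
Qed.

Lemma clopen_right_open S x : clopen S -> right_cont x -> right_open S x.
Proof.
move=> [A [->|->]] [rV rA]; last exact: rA.
move=> t t0; case E : (x t) => [v|] //= vA.
have [//|//|e e0 H] := rV v t; exists e => // s /H /= ->.
by rewrite /= vA.
Qed.

Lemma right_open_shift S x s : 0 <= s -> right_open S x ->
  right_open S (shift_traj x s).
Proof.
move=> s0 rS t t0 Sx; have [||e e0 H] := rS (s + t) => //; first exact: addr_ge0.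
by exists e => // r rt; apply: H; rewrite -addrA !lerD2l.
Qed.

Lemma right_cont_shift x s : 0 <= s -> right_cont x -> right_cont (shift_traj x s).
Proof. by move=> s0 [H1 H2]; split => ?; exact: right_open_shift. Qed.

Lemma right_open_None x : right_cont x -> right_open (~` [set None]) x.
Proof.
move=> [rV _] t t0; case E : (x t) => [v|] //= _.
by have [//|//|e e0 H] := rV v t; exists e => // s /H ->.
Qed.

Definition first_hit S x s t :=
  [/\ s <= t, S (x t) & forall r, s <= r < t -> ~ S (x r)].

(** The infimum of the empty set is 0, so the value is meaningful only if [S] is visited after [s];
    [first_hit] says in addition that the infimum is attained. *)
Definition hit_time S x s : R := inf [set r | s <= r /\ S (x r)].

Lemma first_hit_time S x s t : first_hit S x s t -> hit_time S x s = t.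
Proof.
move=> [st St H]; apply: inf_min => //= r [sr Sr].
by rewrite leNgt; apply/negP => rt; apply: (H r); rewrite ?sr.
Qed.

(** Were the infimum not in [S], right-openness of the complement would keep the path off [S] on an
    interval to its right. Only the complement has to be right-open, so that [[set None]] is
    covered. *)
Lemma first_hit_exists S x s u : right_open (~` S) x -> 0 <= s -> s <= u ->
  S (x u) -> first_hit S x s (hit_time S x s) /\ hit_time S x s <= u.
Proof.
move=> rS s0 su Su; set E := [set r | s <= r /\ S (x r)].
have lbE : lbound E s by move=> r [].
have hE : has_inf E by split; [exists u|exists s].
have st : s <= hit_time S x s by apply: lb_le_inf => //; exists u.
have tu : hit_time S x s <= u by apply: ge_inf => //; exists s.
split => //; split => //.
- apply: contrapT => nS; have [|e e0 H] := rS _ _ nS; first exact: le_trans st.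
  have [r [sr Sr] rt] := inf_adherent e0 hE.
  apply: (H r _ Sr); apply/andP; split; last exact: ltW.
  by apply: ge_inf; [exists s|split].
- move=> r /andP[sr rt] Sr; move: rt; apply/negP; rewrite -leNgt.
  by apply: ge_inf => //; exists s.
Qed.

Lemma first_hit_shift S x s t u : first_hit S x (s + t) (s + u) <->
  first_hit S (shift_traj x s) t u.
Proof.
rewrite /first_hit /shift_traj lerD2l; split=> -[tu Su H]; split=> // r.
- by move=> rtu; apply: H; rewrite lerD2l ltrD2l.
- move=> rtu; rewrite -[r](subrKC s); apply: H.
  by rewrite lerBrDl ltrBlDl.
Qed.

(** Infinity is not a left accumulation point at a time spent in [V]. Right-continuity alone would
    allow a trajectory to come from infinity and be at a vertex at once. *)
Definition left_finite x := forall t v, 0 < t -> x t = Some v ->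
  exists A, exists2 eps, 0 < eps &
    forall s, 0 <= s -> t - eps < s < t -> in_fset A (x s).

Lemma left_finite_shift x s : 0 <= s -> left_finite x -> left_finite (shift_traj x s).
Proof.
move=> s0 lx t v t0 xt; have [||A [e e0 H]] := lx (s + t) v => //.
  exact: ltr_wpDl.
exists A, e => // r r0 rt; apply: H; first exact: addr_ge0.
by rewrite -addrA !ltrD2l.
Qed.

Definition good_path : set path := [set x | right_cont x /\ left_finite x].

Lemma good_path_shift x s : 0 <= s -> good_path x -> good_path (shift_traj x s).
Proof. by move=> s0 [? ?]; split; [exact: right_cont_shift|exact: left_finite_shift]. Qed.

(** Continuous induction on [[0, q]]: at the supremum of the times up to which the range is finite,
    [left_finite] gives finiteness up to this time and right-continuity carries it beyond. *)
Lemma finite_range x q : good_path x -> 0 <= q ->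
  (forall s, 0 <= s <= q -> x s <> None) ->
  exists A, forall s, 0 <= s <= q -> in_fset A (x s).
Proof.
move=> [[rV _] lx] q0 xV.
pose E := [set u | 0 <= u <= q /\ exists A, forall s, 0 <= s <= u -> in_fset A (x s)].
have E0 : E 0.
  split; first by rewrite lexx.
  case x0 : (x 0) (xV 0) => [v|]; last by move=> /(_ _)[]//; rewrite lexx.
  move=> _; exists [fset v]%fset => s /le_anti <-.
  by rewrite x0 /= inE.
have hE : has_sup E by split; [exists 0|exists q => u [/andP[]]].
have u0 : 0 <= sup E by apply: ub_le_sup => //; case: hE.
have uq : sup E <= q by apply: ge_sup; [exists 0|move=> u [/andP[]]].
have xu : exists v, x (sup E) = Some v.
  by case: (x (sup E)) (xV (sup E)) => [v|]; [exists v|rewrite u0 uq => /(_ isT)].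
case: xu => v xu; have [//|e e0 He] := rV v (sup E) u0.
have [A HA] : exists A, forall s, 0 <= s < sup E -> in_fset A (x s).
  have [z|z] := leP (sup E) 0; first by exists fset0 => s; lra.
  have [A [d d0 HA]] := lx _ _ z xu.
  have [u [/andP[u0' _] [B HB]] ul] := sup_adherent d0 hE.
  exists (A `|` B)%fset => s /andP[s0 su].
  have [sl|sl] := leP s u.
    have := HB s; rewrite s0 sl => /(_ isT).
    by case: (x s) => //= a aB; rewrite inE aB orbT.
  have := HA s s0; rewrite su (lt_trans ul sl) => /(_ isT).
  by case: (x s) => //= a aB; rewrite inE aB.
have Ee : E (Num.min (sup E + e) q).
  split; first by rewrite le_min ge_min lexx orbT q0 addr_ge0 // ltW.
  exists (v |` A)%fset => s; rewrite le_min => /andP[s0 /andP[se sq]].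
  have [su|su] := ltP s (sup E).
    by have := HA s; rewrite s0 su => /(_ isT); case: (x s) => //= a aB; rewrite !inE aB orbT.
  by rewrite He ?su //= !inE eqxx.
have := ub_le_sup (proj2 hE) Ee; rewrite ge_min; case/orP; first by lra.
move=> qu; case: Ee => _; rewrite (_ : Num.min _ _ = q) //.
by apply/min_idPr; lra.
Qed.

Lemma fset_exhaustion A : countable [set: V] ->
  exists K : nat -> {fset V}, [/\ forall n, (A `<=` K n)%fset,
    forall n k, (n <= k)%N -> (K n `<=` K k)%fset & forall B, exists n, (B `<=` K n)%fset].
Proof.
move=> /pfcard_geP[V0|[f]].
  exists (fun=> A); split => // B; exists 0%N; apply/fsubsetP => v _.
  by have : [set: V] v by []; rewrite V0.
pose K n := (A `|` [fset f i | i in iota 0 n])%fset.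
have Kmono i j : (i <= j)%N -> (K i `<=` K j)%fset.
  move=> ij; apply: fsetUS; apply/fsubsetP => v /imfsetP[k /= kn ->]; apply/imfsetP; exists k => //=.
  by move: kn; rewrite !mem_iota /= !add0n => /leq_trans; apply.
exists K; split=> // [n|]; first exact: fsubsetUl.
elim/finSet_rect => B IH; have [->|[v vB]] := fset_0Vmem B; first by exists 0%N.
have [n Hn] := IH _ (fproperD1 vB).
have [k _ fk] := 'surj_f (I : [set: V] v).
exists (maxn n k.+1); rewrite -(fsetD1K vB) fsubUset fsub1set; apply/andP; split.
  rewrite inE; apply/orP; right; apply/imfsetP; exists k; rewrite //= mem_iota /= add0n.
  by rewrite leq_max ltnSn orbT.
by apply: fsubset_trans Hn _; apply: Kmono; exact: leq_maxl.
Qed.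

End paths.
Arguments good_path {R V}.

Lemma good_path_right (R : realType) (V : pointedType) : good_path `<=` (@right_cont R V).
Proof. by move=> x []. Qed.

(** * Optional times *)

Section path_events.
Context {R : realType} {V : pointedType}.
Local Notation path := (R -> option V).
Variable good : set path.

(* Events are taken modulo sets of bad trajectories, so that events defined by
   uncountably many conditions become available once these reduce to countably
   many on good trajectories. *)
Definition path_events : set (set path) :=
  <<s [set C | (exists (t : R) a, 0 <= t /\ C = [set x : path | x t = a]) \/
               (forall x, C x -> ~ good x)] >>.

Lemma path_events_sa : sigma_algebra setT path_events.
Proof. exact: smallest_sigma_algebra. Qed.

Lemma traj_events_path : traj_events `<=` path_events.
Proof.
apply: smallest_sub; first exact: smallest_sigma_algebra.
by move=> C h; apply: sub_sigma_algebra; left.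
Qed.

(** Induction on the generated sigma-algebra, sets of bad trajectories being replaced by the empty
    set. The Markov property is given for [traj_events]; this carries it over to [path_events]. *)
Lemma path_events_traj C : path_events C ->
  exists2 C', traj_events C' & forall x, good x -> C x <-> C' x.
Proof.
move: C; apply: smallest_sub.
- split=> [|C [C' tC' CC']|C HC].
  + by exists set0 => //; exact: sigma_algebra0.
  + exists (~` C'); first by rewrite -setTD; exact: sigma_algebraCD.
    by move=> x /CC' h; rewrite /= /setD /setC /=; tauto.
  + have /choice[C' HC'] : forall n, exists C', traj_events C' /\ forall x, good x -> C n x <-> C' x.
      by move=> n; have [C' ? ?] := HC n; exists C'.
    exists (\bigcup_n C' n); first by apply: sigma_algebra_bigcup => n; case: (HC' n).
    move=> x gx; split=> -[n _ Cx]; exists n => //.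
      by case: (HC' n) => _ /(_ x gx)/iffLR; apply.
    by case: (HC' n) => _ /(_ x gx)/iffRL; apply.
- move=> C [[t [a [t0 ->]]]|bad].
  + exists [set x | x t = a] => //; apply: sub_sigma_algebra.
    by exists t, a.
  + exists set0; first exact: sigma_algebra0.
    by move=> x gx; split => // /bad.
Qed.

End path_events.

Section filtrations.
Context {R : realType} {V : pointedType}.
Hypothesis countV : countable [set: V].
Local Notation path := (R -> option V).
Variables (good : set path) (Om : Type) (X : Om -> path).
Variables (F : R -> set (set Om)) (G : set (set Om)).
Hypothesis good_right : good `<=` right_cont.
Hypothesis good_shift : forall x s, 0 <= s -> good x -> good (shift_traj x s).

(** Common interface of the two filtrations in use: the completed [history] on a probability space,
    where bad trajectories are negligible, and [path_filtration] on the trajectories themselves,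
    where their subsets are adjoined. *)
Record adapted : Prop := {
  ad_sa : forall t, sigma_algebra setT (F t);
  ad_saG : sigma_algebra setT G;
  ad_sub : forall t, F t `<=` G;
  ad_mono : forall s t, s <= t -> F s `<=` F t;
  ad_state : forall s t a, 0 <= s -> s <= t -> F t [set w | X w s = a];
  ad_bad : forall t (E : set Om), (forall w, E w -> ~ good (X w)) -> F t E
}.
Hypothesis adF : adapted.

(* [T] is only relevant on [B]; for [B] the event that it is finite, this is an
   optional time and [B] may then be shrunk to any event in its past. *)
Definition optional (B : set Om) (T : Om -> R) : Prop :=
  (forall w, B w -> 0 <= T w) /\
  (forall t, F t [set w | B w /\ T w < t]).

Let sF t := ad_sa adF t.

Lemma optional_ext (B B' : set Om) (T T' : Om -> R) : optional B T ->
  (forall w, B' w -> 0 <= T' w) ->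
  (forall w, good (X w) -> (B w <-> B' w) /\ (B w -> T w = T' w)) ->
  optional B' T'.
Proof.
move=> [T0 FT] T'0 BB; split => // t.
apply: (sa_mod (sF t) (N := fun w => ~ good (X w)) _ (FT t)); first exact: ad_bad.
move=> w /contrapT/BB[B1 B2]; split=> -[Bw Tt].
  by rewrite -B2 //; split=> //; exact/B1.
by move/B1 : Bw => Bw; rewrite B2.
Qed.

Lemma optional_const (s : R) : 0 <= s -> optional setT (fun=> s).
Proof.
move=> s0; split => // t; apply: (sa_ext (sF t) (P := fun=> s < t)).
  exact: (sa_const (sF t)).
by move=> w; split => [|[]].
Qed.

Lemma optional_mem B T : optional B T -> G B.
Proof.
move=> [T0 FT]; apply: (@sa_ext _ _ (ad_saG adF) (fun w => exists n : nat, B w /\ T w < n%:R)).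
  apply: (sa_exists (ad_saG adF)); first exact: countableP.
  by move=> n; apply: (ad_sub adF (t := n%:R)); exact: FT.
move=> w; split=> [[n []]//|Bw]; exists (Num.truncn (T w)).+1; split => //.
by have /truncn_itv/andP[] := T0 w Bw.
Qed.

Lemma optional_grid B T n k : optional B T ->
  F (grid n k.+1) [set w | B w /\ grid_index n (T w) = k].
Proof.
move=> [T0 FT]; apply: (@sa_ext _ _ (sF _) (fun w => (B w /\ T w < grid n k.+1) /\
    ~ (B w /\ T w < grid n k))).
  apply: sa_and => //; apply: sa_not => //.
  by apply: (ad_mono adF _ (FT _)); rewrite gridS lerDl invr_ge0.
move=> w; split.
- move=> [[Bw Tk]] nT; split => //; apply/grid_indexP; first exact: T0.
  by rewrite Tk andbT leNgt; apply/negP => h; apply: nT.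
- move=> [Bw /grid_indexP]; rewrite T0 // => /(_ isT)/andP[lk ->].
  by split => // -[_]; rewrite ltNge lk.
Qed.

Lemma optional_add B T s : 0 <= s -> optional B T -> optional B (fun w => T w + s).
Proof.
move=> s0 [T0 FT]; split; first by move=> w /T0 ?; exact: addr_ge0.
move=> t; apply: (sa_ext (sF t) (P := fun w => B w /\ T w < t - s)).
  by apply: (ad_mono adF _ (FT _)); rewrite lerBlDr lerDl.
by move=> w; rewrite ltrBrDr.
Qed.

Lemma optional_and (B D : set Om) T : optional B T ->
  (forall t, F t [set w | D w /\ (B w /\ T w < t)]) -> optional (B `&` D) T.
Proof.
move=> [T0 FT] H; split; first by move=> w [/T0].
by move=> t; apply: (sa_ext (sF t) (H t)) => w /=; tauto.
Qed.

Lemma optional_grid_up B T n t (P : R -> Om -> Prop) : optional B T ->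
  (forall s, 0 <= s -> s < t -> F t [set w | P s w]) ->
  F t [set w | B w /\ grid_up n (T w) < t /\ P (grid_up n (T w)) w].
Proof.
move=> oT FP; apply: (@sa_ext _ _ (sF t) (fun w => exists k, grid n k.+1 < t /\
    ((B w /\ grid_index n (T w) = k) /\ P (grid n k.+1) w))).
  apply: (sa_exists (sF t)); first exact: countableP.
  move=> k; have [kt|kt] := pselect (grid n k.+1 < t); last first.
    by apply: (sa_ext (sF t) (sa_const (sF t) False)) => w; tauto.
  apply: (sa_and (sF t)); first exact: (sa_const (sF t)).
  apply: (sa_and (sF t)); last exact: (FP _ (grid_ge0 _ _)).
  by apply: (ad_mono adF _ (optional_grid n k oT)); exact: ltW.
move=> w; split; first by move=> [k [kt [[Bw ek] Pw]]]; rewrite /grid_up ek.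
by move=> [Bw [kt Pw]]; exists (grid_index n (T w)).
Qed.

(** The converse is the direct implication applied to the complement, which is clopen too. The state
    at [t] is thus a countable condition on grid times after [t]. *)
Lemma eventually_grid_up (S : set (option V)) (x : path) t : clopen S -> right_cont x -> 0 <= t ->
  S (x t) <-> exists N, forall n, (N <= n)%N -> S (x (grid_up n t)).
Proof.
have H S' : clopen S' -> right_cont x -> 0 <= t -> S' (x t) ->
    exists N, forall n, (N <= n)%N -> S' (x (grid_up n t)).
  move=> cS rx t0 Sx; have [//|//|e e0 He] := clopen_right_open cS rx (t := t).
  by have [N HN] := grid_up_near t0 e0; exists N => n /HN /He.
move=> cS rx t0; split; first exact: H.
move=> [N HN]; apply: contrapT => nS.
have [//|//|//|//|M HM] := H (~` S); first exact: clopenC.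
by apply: (HM (maxn M N)); rewrite ?leq_maxl //; apply: HN; exact: leq_maxr.
Qed.

(** When [T < t], the grid times decreasing to [T] are eventually less than [t], so the state at [T]
    is read off from states observed before [t]. *)
Lemma optional_state0 B T a : optional B T -> optional (B `&` [set w | X w (T w) = a]) T.
Proof.
move=> oT; have HV v : optional (B `&` [set w | X w (T w) = Some v]) T.
  apply: (optional_and oT) => t; have [T0 _] := oT.
  apply: (@sa_mod _ _ (sF t) (fun w => ~ good (X w)) (fun w => (B w /\ T w < t) /\
    exists N, forall n, (N <= n)%N -> B w /\ (grid_up n (T w) < t /\
        X w (grid_up n (T w)) = Some v))).
  - exact: ad_bad.
  - apply: sa_and => //; first by case: oT.
    apply: (sa_exists (sF t)); first exact: countableP.
    move=> N; apply: (sa_forall (sF t)); first exact: countableP.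
    move=> n; apply: (sa_imply (sF t)); first exact: (sa_const (sF t)).
    apply: (@optional_grid_up B T n t (fun s w => X w s = Some v)) => // s s0 st.
    by apply: (ad_state adF) => //; exact: ltW.
  - move=> w /contrapT/good_right rX; split.
    + move=> [[Bw Tt] [N HN]]; split => //.
      apply/(eventually_grid_up (clopen1 v)) => //; first exact: T0.
      by exists N => n /HN [_ []].
    + move=> [Xv [Bw Tt]]; split => //; have tw := T0 w Bw.
      move/(eventually_grid_up (clopen1 v) rX tw) : Xv => [N HN].
      have e0 : 0 < (t - T w) / 2 by lra.
      have [M HM] := grid_up_near tw e0; exists (maxn M N) => n.
      rewrite geq_max => /andP[/HM Mn /HN /= ?]; split => //; split => //; lra.
(* [[set None]] is in general not clopen, so infinity is obtained as the complement of the countably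
   many vertices. *)
case: a => [v|]; first exact: HV.
apply: (optional_and oT) => t; have [T0 FT] := oT.
apply: (@sa_ext _ _ (sF t) (fun w => (B w /\ T w < t) /\
    forall v, ~ ((B `&` [set w | X w (T w) = Some v]) w /\ T w < t))).
  apply: sa_and => //; apply: (sa_forall (sF t) countV) => v.
  by apply: sa_not => //; case: (HV v).
move=> w /=; split.
- move=> [[Bw Tt] H]; split => //; case E : (X w (T w)) => [v|] //.
  by case: (H v).
- by move=> [-> [Bw Tt]]; split => // v -[[]].
Qed.

Lemma optional_state B T s a : 0 <= s -> optional B T ->
  optional (B `&` [set w | X w (T w + s) = a]) (fun w => T w + s).
Proof. by move=> s0 oT; exact: (optional_state0 a (optional_add s0 oT)). Qed.

Lemma optional_event B T C : optional B T -> path_events good C ->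
  G [set w | B w /\ C (shift_traj (X w) (T w))].
Proof.
have sG := ad_saG adF; move=> oT; have GB := optional_mem oT; have [T0 _] := oT.
move: C; apply: smallest_sub.
- split.
  + by apply: (sa_ext sG (sa_const sG False)) => w; split => // -[].
  + move=> C GC; apply: (@sa_ext _ _ sG (fun w => B w /\ ~ (B w /\ C (shift_traj (X w) (T w))))).
      by apply: sa_and => //; exact: sa_not.
    by move=> w; rewrite /= /setD /=; tauto.
  + move=> C GC; apply: (@sa_ext _ _ sG (fun w => exists n, B w /\ C n (shift_traj (X w) (T w)))).
      by apply: (sa_exists sG) => //; exact: countableP.
    move=> w; split; first by move=> [n [Bw Cn]]; split => //; exists n.
    by move=> [Bw [n _ Cn]]; exists n.
- move=> C [[s [a [s0 ->]]]|bad]; first exact: (optional_mem (optional_state a s0 oT)).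
  apply: (ad_sub adF (t := 0)); apply: (ad_bad adF) => w [Bw /bad h] gX.
  by apply: h; apply: good_shift => //; exact: T0.
Qed.

(** By right-continuity a visit to [S] before [t] persists for a while, and is therefore seen at a
    rational time between [T] and [t]. *)
Lemma optional_hit S B T : clopen S -> optional B T ->
  optional [set w | B w /\ exists2 r, T w <= r & S (X w r)]
           (fun w => hit_time S (X w) (T w)).
Proof.
move=> cS [T0 FT]; have HT w : [set w | B w /\ exists2 r, T w <= r & S (X w r)] w ->
    T w <= hit_time S (X w) (T w).
  by move=> [Bw [r Tr Sr]]; apply: lb_le_inf; [exists r|move=> ? []].
split; first by move=> w Bw; apply: le_trans (HT w Bw); apply: T0; case: Bw.
move=> t; apply: (@sa_mod _ _ (sF t) (fun w => ~ good (X w)) (fun w => exists q : rat,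
    0 <= ratr q :> R /\ (ratr q < t /\ ((B w /\ T w < ratr q) /\ S (X w (ratr q)))))).
- exact: ad_bad.
- apply: (sa_exists (sF t)); first exact: countableP.
  move=> q; have [q0|q0] := pselect (0 <= ratr q :> R); last first.
    by apply: (sa_ext (sF t) (sa_const (sF t) False)) => w; tauto.
  apply: sa_and => //; first exact: (sa_const (sF t)).
  have [qt|qt] := pselect (ratr q < t); last first.
    by apply: (sa_ext (sF t) (sa_const (sF t) False)) => w; tauto.
  apply: sa_and => //; first exact: (sa_const (sF t)).
  apply: sa_and => //; first by apply: (ad_mono adF _ (FT _)); exact: ltW.
  have FA A : F t [set w | in_fset A (X w (ratr q))].
    apply: (@sa_ext _ _ (sF t) (fun w => exists v, v \in A /\ X w (ratr q) = Some v)).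
      apply: (sa_exists (sF t) countV) => v; apply: sa_and => //; first exact: (sa_const (sF t)).
      by apply: (ad_state adF) => //; exact: ltW.
    move=> w; split; first by move=> [v [vA ->]].
    by case E : (X w (ratr q)) => [v|] //= vA; exists v.
  by case: cS => A [->|->]; [exact: FA|exact: (sa_not (sF t) (FA A))].
- move=> w /contrapT/good_right rX; split.
  + move=> [q [q0 [qt [[Bw Tq] Sq]]]]; split; first by split => //; exists (ratr q) => //; exact: ltW.
    apply: le_lt_trans qt; apply: ge_inf; first by exists (T w) => ? [].
    by split => //; exact: ltW.
  + move=> [[Bw [r Tr Sr]] ht]; have tw := T0 w Bw.
    have rS : right_open (~` S) (X w) by apply: clopen_right_open rX; exact: clopenC.
    have [[Th Sh _] hr] := first_hit_exists rS tw Tr Sr.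
    have [|//|e e0 He] := clopen_right_open cS rX (t := hit_time S (X w) (T w)).
      exact: le_trans Th.
    have [|q /andP[hq]] := @rat_between R (hit_time S (X w) (T w))
        (Num.min (hit_time S (X w) (T w) + e) t).
      by rewrite lt_min ht andbT ltrDl.
    rewrite lt_min => /andP[qe qt]; exists q.
    have Tq : T w < ratr q by exact: le_lt_trans hq.
    split; first by rewrite (le_trans tw) // ltW.
    split => //; split => //; apply: He; rewrite (ltW hq) /= ltW //.
Qed.

(** A visit to infinity need not be seen at any rational time. It is detected through
    [finite_range]: infinity is visited before [t] when, for some rational [q < t], the states at
    rational times up to [q] leave every finite set. *)
Lemma optional_infinity : good `<=` good_path ->
  optional [set w | exists2 r, 0 <= r & X w r = None] (fun w => hit_infinity (X w)).
Proof.
have [K [_ _ KA]] := fset_exhaustion fset0 countV.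
move=> gg; have HT w : (exists2 r, 0 <= r & X w r = None) -> 0 <= hit_infinity (X w).
  by move=> [r r0 Xr]; apply: lb_le_inf; [exists r|move=> ? []].
split => // t; apply: (@sa_mod _ _ (sF t) (fun w => ~ good (X w)) (fun w => exists q : rat,
    0 <= ratr q :> R /\ (ratr q < t /\ (forall n : nat, exists r : rat,
      0 <= ratr r :> R /\ (ratr r <= ratr q :> R /\ ~ in_fset (K n) (X w (ratr r))))))).
- exact: ad_bad.
- apply: (sa_exists (sF t)); first exact: countableP.
  move=> q; have [qt|qt] := pselect (ratr q < t); last first.
    by apply: (sa_ext (sF t) (sa_const (sF t) False)) => w; tauto.
  apply: sa_and => //; first exact: (sa_const (sF t)).
  apply: sa_and => //; first exact: (sa_const (sF t)).
  apply: (sa_forall (sF t)); first exact: countableP.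
  move=> n; apply: (sa_exists (sF t)); first exact: countableP.
  move=> r; have [r0|r0] := pselect (0 <= ratr r :> R); last first.
    by apply: (sa_ext (sF t) (sa_const (sF t) False)) => w; tauto.
  apply: sa_and => //; first exact: (sa_const (sF t)).
  have [rq|rq] := pselect (ratr r <= ratr q :> R); last first.
    by apply: (sa_ext (sF t) (sa_const (sF t) False)) => w; tauto.
  apply: sa_and => //; first exact: (sa_const (sF t)).
  apply: (sa_not (sF t)).
  apply: (@sa_ext _ _ (sF t) (fun w => exists v, v \in K n /\ X w (ratr r) = Some v)).
    apply: (sa_exists (sF t) countV) => v; apply: sa_and => //; first exact: (sa_const (sF t)).
    by apply: (ad_state adF) => //; apply: le_trans rq _; exact: ltW.
  move=> w; split; first by move=> [v [vA ->]].
  by case E : (X w (ratr r)) => [v|] //= vA; exists v.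
- move=> w /contrapT gX; have rX := good_right gX; split.
  + move=> [q [q0 [qt H]]]; have [s /andP[s0 sq] Xs] : exists2 s, 0 <= s <= ratr q & X w s = None.
      apply: contrapT => nN; have [|A HA] := finite_range (gg _ gX) q0.
        by move=> s sq Xs; apply: nN; exists s.
      have [n /fsubsetP An] := KA A; have [r [r0 [rq]]] := H n; apply.
      by have := HA (ratr r); rewrite r0 rq => /(_ isT); case: (X w _) => //= v /An.
    split; first by exists s.
    apply: le_lt_trans qt; apply: le_trans sq; apply: ge_inf; first by exists 0 => ? [].
    by [].
  + move=> [[r r0 Xr] ht].
    have [[_ Xs _] _] := first_hit_exists (right_open_None rX) (lexx 0) r0 Xr.
    have s0 : 0 <= hit_infinity (X w) by apply: HT; exists r.
    have [q /andP[sq qt]] := rat_between ht.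
    exists q; split; first by rewrite (le_trans s0) // ltW.
    split => // n; have [//|//|e e0 He] := rX.2 (K n) (hit_infinity (X w)).
      by rewrite /hit_infinity -/(hit_time [set None] (X w) 0) Xs.
    have [|u /andP[su]] := @rat_between R (hit_infinity (X w))
        (Num.min (hit_infinity (X w) + e) (ratr q)).
      by rewrite lt_min sq andbT ltrDl.
    rewrite lt_min => /andP[ue uq]; exists u.
    split; first by rewrite (le_trans s0) // ltW.
    by split; [exact: ltW|apply: He; rewrite !ltW].
Qed.

End filtrations.

(** * Dirichlet energy *)

Lemma cvg_sum_seq (R : realType) (I : Type) (r : seq I) (f : I -> nat -> R) (g : I -> R) :
  (forall i, f i n @[n --> \oo] --> g i) ->
  \sum_(i <- r) f i n @[n --> \oo] --> \sum_(i <- r) g i.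
Proof.
move=> fg; elim: r => [|i r IH].
  by rewrite big_nil (_ : (fun n => _) = cst 0); [exact: cvg_cst|apply/funext => n; rewrite big_nil].
rewrite big_cons (_ : (fun n => _) = (fun n => f i n + \sum_(j <- r) f j n)).
  by apply: cvgD; [exact: fg|exact: IH].
by apply/funext => n; rewrite big_cons.
Qed.

Section network_basics.
Context {R : realType} {V : pointedType}.
Variable G : network R V.
Local Notation adj := (adj G).
Local Notation edges := (edges G).

Lemma adj_neq x y : adj x y -> x != y.
Proof. by move=> /edge_card; rewrite cardfs2; case: (x != y). Qed.

Lemma edge_pair e : edges e -> exists x y, x != y /\ e = [fset x; y]%fset.
Proof.
move=> /edge_card e2; have [e0|[x xe]] := fset_0Vmem e.
  by move: e2; rewrite e0 cardfs0.
have : #|` (e `\ x)%fset| == 1%N by move: e2; rewrite (cardfsD1 x) xe add1n => -[->].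
move=> /cardfs1P[y ey]; exists x, y; rewrite -(fsetD1K xe) ey; split => //.
by have : y \in (e `\ x)%fset by [rewrite ey inE]; rewrite !inE eq_sym => /andP[].
Qed.

Lemma star_finite (K : {fset V}) : finite_set [set e | edges e /\ exists2 x, x \in K & x \in e].
Proof.
rewrite (_ : [set e | _] = \bigcup_(x in [set` K]) [set e | edges e /\ x \in e]).
  by apply: bigcup_finite => [|x _]; [exact: finite_fset|exact: locally_finite].
by apply/seteqP; split => e /=; [move=> [ee [x xK xe]]; exists x|move=> [x xK [ee xe]]; split =>
    //; exists x].
Qed.

Lemma mem_contracted_edges K e :
  (e \in contracted_edges G K) <-> edges e /\ exists2 x, x \in K & x \in e.
Proof. by rewrite /contracted_edges in_fset_set ?inE //; exact: star_finite. Qed.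

Lemma neighbours_finite x : finite_set [set y | adj x y].
Proof.
apply: (@sub_finite_set _ _ (\bigcup_(e in [set e | edges e /\ x \in e]) [set` e])).
  by move=> y /= xy; exists [fset x; y]%fset; rewrite /= ?inE ?eqxx ?orbT.
by apply: bigcup_finite => [|e _]; [exact: locally_finite|exact: finite_fset].
Qed.

Definition nbr x : {fset V} := fset_set [set y | adj x y].

Lemma mem_nbr x y : (y \in nbr x) <-> adj x y.
Proof. by rewrite in_fset_set ?inE //; exact: neighbours_finite. Qed.

Lemma sum_nbr (F : V -> R) x : \sum_(y \in [set y | adj x y]) F y = \sum_(y <- nbr x) F y.
Proof. by rewrite fsbig_finite //; exact: neighbours_finite. Qed.

Lemma vweightE x : vweight G x = \sum_(y <- nbr x) cond G x y.
Proof. exact: sum_nbr. Qed.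

Lemma condE x y : adj x y -> cond G x y = conductance G [fset x; y]%fset.
Proof. by rewrite /cond => xy; rewrite asboolT. Qed.

Lemma cond_gt0 x y : adj x y -> 0 < cond G x y.
Proof. by move=> xy; rewrite condE //; exact: conductance_gt0. Qed.

Lemma cond_ge0 x y : 0 <= cond G x y.
Proof.
by rewrite /cond; case: asboolP => // /(@conductance_gt0 _ _ G)/ltW.
Qed.

Lemma trans_prob_ge0 x y : 0 <= trans_prob G x y.
Proof.
rewrite divr_ge0 ?cond_ge0 // vweightE.
by apply: sumr_ge0 => z _; exact: cond_ge0.
Qed.

Lemma connected_ind (P : V -> Prop) x : P x -> (forall y z, adj y z -> P y -> P z) ->
  forall y, P y.
Proof.
move=> Px PA y; elim: (connected_network G x y) Px => [a b /PA //|//|a b c _ IH1 _ IH2 /IH1/IH2 //].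
Qed.

Fixpoint nball (o : V) (n : nat) : {fset V} :=
  if n is n'.+1 then (nball o n' `|` \bigcup_(x <- nball o n') nbr x)%fset
  else [fset o]%fset.

Lemma nball_sub o n : (nball o n `<=` nball o n.+1)%fset.
Proof. exact: fsubsetUl. Qed.

Lemma nballS o n x y : x \in nball o n -> adj x y -> y \in nball o n.+1.
Proof.
move=> xn xy; rewrite /= inE; apply/orP; right.
by apply/bigfcupP; exists x; rewrite ?xn //; exact/mem_nbr.
Qed.

Lemma nball_cover o x : exists n, x \in nball o n.
Proof.
move: x; apply: (@connected_ind _ o); first by exists 0%N; rewrite inE.
by move=> y z yz [n yn]; exists n.+1; exact: nballS yn yz.
Qed.

Lemma countable_vertices : countable [set: V].
Proof.
rewrite (_ : setT = \bigcup_n [set` nball point n]).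
  by apply: bigcup_countable => // n _; exact/finite_set_countable/finite_fset.
by apply/seteqP; split => // x _; have [n xn] := nball_cover point x; exists n.
Qed.

End network_basics.

Section energy.
Context {R : realType} {V : pointedType}.
Variable G : network R V.
Local Notation adj := (adj G).
Local Notation edges := (edges G).
Local Notation nbr := (nbr G).
Implicit Types (f g h : V -> R) (S : {fset {fset V}}).

Definition edge_form e f g : R := conductance G e *
  ((\sum_(u <- e) \sum_(v <- e) (f u - f v) * (g u - g v)) / 2).

Definition energy_form S f g : R := \sum_(e <- S) edge_form e f g.

Definition of_edges S := forall e, e \in S -> edges e.

(** The energy is only used through finite edge sets, on which it is a genuine bilinear form;
    [energy_leP] relates this to the sum in the extended reals. *)
Definition energy_le f (M : R) := forall S, of_edges S -> energy_form S f f <= M.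

Lemma edge_form_pair x y f g : adj x y ->
  edge_form [fset x; y]%fset f g = cond G x y * ((f x - f y) * (g x - g y)).
Proof.
move=> xy; have nxy := adj_neq xy; rewrite /edge_form condE //; congr (_ * _).
have E (F : V -> R) : \sum_(u <- [fset x; y]%fset) F u = F x + F y.
  by rewrite big_fsetU1 ?inE //= big_seq_fset1.
by rewrite !E; lra.
Qed.

Lemma edge_form_ge0 e f : edges e -> 0 <= edge_form e f f.
Proof.
move=> ee; have [x [y [_ exy]]] := edge_pair ee; rewrite exy in ee *.
by rewrite edge_form_pair // mulr_ge0 ?cond_ge0 // -expr2 sqr_ge0.
Qed.

Lemma edge_form_sym e f g : edge_form e f g = edge_form e g f.
Proof.
by rewrite /edge_form; congr (_ * (_ / _)); apply: eq_bigr => u _; apply: eq_bigr => v _; exact: mulrC.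
Qed.

Lemma edge_form_linear e a f b g h :
  edge_form e (fun x => a * f x + b * g x) h = a * edge_form e f h + b * edge_form e g h.
Proof.
rewrite /edge_form; set c := conductance G e.
rewrite !mulrA ![a * c]mulrC ![b * c]mulrC -!mulrA -mulrDr; congr (c * _).
rewrite !mulrA -mulrDl; congr (_ / _); rewrite !mulr_sumr -big_split /=.
apply: eq_bigr => u _; rewrite !mulr_sumr -big_split /=.
by apply: eq_bigr => v _; ring.
Qed.

Lemma energy_form_sym S f g : energy_form S f g = energy_form S g f.
Proof. by apply: eq_bigr => e _; exact: edge_form_sym. Qed.

Lemma energy_form_linear S a f b g h :
  energy_form S (fun x => a * f x + b * g x) h =
  a * energy_form S f h + b * energy_form S g h.
Proof.
rewrite /energy_form !mulr_sumr -big_split /=; apply: eq_bigr => e _.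
exact: edge_form_linear.
Qed.

Lemma energy_form_linr S a f b g h :
  energy_form S h (fun x => a * f x + b * g x) =
  a * energy_form S h f + b * energy_form S h g.
Proof. by rewrite energy_form_sym energy_form_linear !(energy_form_sym S _ h). Qed.

Lemma energy_form_sq S a f b g :
  energy_form S (fun x => a * f x + b * g x) (fun x => a * f x + b * g x) =
  a ^+ 2 * energy_form S f f + 2 * a * b * energy_form S f g + b ^+ 2 * energy_form S g g.
Proof.
by rewrite energy_form_linear !energy_form_linr (energy_form_sym S g f); ring.
Qed.

Lemma energy_form_ge0 S f : of_edges S -> 0 <= energy_form S f f.
Proof.
move=> eS; rewrite /energy_form big_seq; apply: sumr_ge0 => e /eS.
exact: edge_form_ge0.
Qed.

Lemma energy_form_mono S S' f : (S `<=` S')%fset -> of_edges S' ->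
  energy_form S f f <= energy_form S' f f.
Proof.
move=> SS eS'; rewrite /energy_form [leRHS](big_fsetID _ (mem S)) /=.
rewrite (_ : [fset x in S' | x \in mem S]%fset = S); last first.
  by apply/fsetP => e; rewrite !inE /= andb_idl // => /(fsubsetP SS).
rewrite lerDl big_seq; apply: sumr_ge0 => e; rewrite !inE /= => /andP[/eS' ee _].
exact: edge_form_ge0.
Qed.

Lemma of_edgesU S S' : of_edges S -> of_edges S' -> of_edges (S `|` S')%fset.
Proof. by move=> h h' e; rewrite inE => /orP[/h|/h']. Qed.

Lemma of_edges_star K : of_edges (contracted_edges G K).
Proof. by move=> e /mem_contracted_edges[]. Qed.

Lemma energyE f : energy G f = \esum_(e in edges) (edge_form e f f)%:E.
Proof.
by apply: eq_esum => e _; rewrite /edge_form; congr (_ * (_ / _))%:E.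
Qed.

Lemma energy_leP f M : (energy G f <= M%:E)%E <-> energy_le f M.
Proof.
rewrite energyE /esum; split.
- move=> H S eS; rewrite -lee_fin; apply: le_trans H; apply: ereal_sup_ubound.
  exists [set` S]; first by split; [exact: finite_fset|move=> e /= /eS].
  by rewrite fsbig_finite //= set_fsetK sumEFin.
- move=> H; apply: ge_ereal_sup => _ [S [fS eS] <-].
  rewrite fsbig_finite //= sumEFin lee_fin.
  by apply: H => e; rewrite in_fset_set // inE => /eS.
Qed.

Lemma energy_ge0 f : (0 <= energy G f)%E.
Proof.
apply: esum_ge0 => e ee; rewrite lee_fin; apply: mulr_ge0; first exact/ltW/conductance_gt0.
apply: divr_ge0 => //; apply: sumr_ge0 => u _; apply: sumr_ge0 => v _; exact: sqr_ge0.
Qed.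

Lemma energy_ltP f : (energy G f < +oo)%E <-> exists M, energy_le f M.
Proof.
split=> [fin|[M /energy_leP h]]; last by apply: le_lt_trans h _; rewrite ltry.
exists (fine (energy G f)); apply/energy_leP; rewrite fineK //.
by rewrite ge0_fin_numE ?energy_ge0.
Qed.

(** The cross term is bounded because [a * f - b * g] has nonnegative energy. *)
Lemma energy_le_lin f g a b M N : energy_le f M -> energy_le g N ->
  energy_le (fun x => a * f x + b * g x) (2 * a ^+ 2 * M + 2 * b ^+ 2 * N).
Proof.
move=> fM gN S eS; rewrite energy_form_sq.
have := energy_form_ge0 (fun x => a * f x + (- b) * g x) eS; rewrite energy_form_sq sqrrN => h.
have := ler_wpM2l (sqr_ge0 a) (fM S eS); have := ler_wpM2l (sqr_ge0 b) (gN S eS).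
by move: h; lra.
Qed.

(** [vweight G x] times the difference between [f x] and the mean of [f] after one step; without
    normalisation it is the gradient of the energy form. *)
Definition lap f x : R := \sum_(y <- nbr x) cond G x y * (f x - f y).

Definition dirac_at (x : V) : V -> R := fun v => (v == x)%:R.

Lemma energy_form_dirac S f x : of_edges S ->
  (contracted_edges G [fset x] `<=` S)%fset -> energy_form S f (dirac_at x) = lap f x.
Proof.
move=> eS xS; rewrite /energy_form -(big_fset_incl _ xS); last first.
  move=> e eSe ex; rewrite /edge_form; have [u [v [uv eE]]] := edge_pair (eS _ eSe).
  have nx z : z \in e -> (z == x) = false.
    move=> ze; apply/negP => /eqP zx; move/negP: ex; apply.
    by apply/mem_contracted_edges; split; [exact: eS|exists x; rewrite ?inE -?zx].
  rewrite big1_seq ?mul0r ?mulr0 // => a /andP[_ ae]; rewrite big1_seq // => b /andP[_ be].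
  by rewrite /dirac_at !nx // subrr mulr0.
rewrite (_ : contracted_edges G [fset x] = [fset [fset x; y] | y in nbr x])%fset; last first.
  apply/fsetP => e; apply/idP/imfsetP => /=.
  - move=> /mem_contracted_edges[ee [_ /fset1P-> xe]]; have [u [v [uv eE]]] := edge_pair ee.
    move: xe; rewrite eE !inE => /orP[/eqP ux|/eqP vx].
      by exists v; rewrite ux //; apply/mem_nbr; rewrite /Defs.adj -eE.
    by exists u; [apply/mem_nbr; rewrite vx /Defs.adj fsetUC -eE|rewrite vx fsetUC].
  - move=> [y /mem_nbr xy ->]; apply/mem_contracted_edges; split => //.
    by exists x; rewrite !inE eqxx.
rewrite big_imfset /=; last first.
  move=> y z /mem_nbr xy /mem_nbr xz /fsetP/(_ y); rewrite !inE eqxx orbT eq_sym.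
  by rewrite (negbTE (adj_neq xy)) => /esym/eqP.
rewrite /lap big_seq [RHS]big_seq; apply: eq_bigr => y /mem_nbr xy.
have yx : (y == x) = false by rewrite eq_sym (negbTE (adj_neq xy)).
by rewrite edge_form_pair // /dirac_at eqxx yx subr0 mulr1.
Qed.

Lemma contracted_edges_sub (K K' : {fset V}) : (K `<=` K')%fset ->
  (contracted_edges G K `<=` contracted_edges G K')%fset.
Proof.
move=> /fsubsetP KK; apply/fsubsetP => e /mem_contracted_edges[ee [x /KK xK xe]].
by apply/mem_contracted_edges; split => //; exists x.
Qed.

(** Discrete Green formula. There is no boundary term since [S] contains all edges meeting the
    support of [g]; in particular the value does not depend on [S]. *)
Lemma energy_form_fin_supp S (K : {fset V}) f g : of_edges S ->
  (contracted_edges G K `<=` S)%fset -> (forall x, x \notin K -> g x = 0) ->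
  energy_form S f g = \sum_(x <- K) g x * lap f x.
Proof.
move=> eS KS g0.
have gE x : g x = \sum_(z <- K) g z * dirac_at z x.
  have [xK|xK] := boolP (x \in K).
    rewrite (big_fsetD1 x xK) /= /dirac_at eqxx mulr1 big1_seq ?addr0 // => z.
    by rewrite !inE => /andP[_ /andP[/negbTE zx _]]; rewrite eq_sym zx mulr0.
  rewrite g0 // big1_seq // => z /andP[_ zK]; rewrite /dirac_at.
  by case: eqP zK xK => [->->//|]; rewrite mulr0.
rewrite (_ : g = fun x => \sum_(z <- K) g z * dirac_at z x); last exact/funext.
have -> : energy_form S f (fun x => \sum_(z <- K) g z * dirac_at z x) =
    \sum_(z <- K) g z * energy_form S f (dirac_at z).
  elim: (enum_fset K) => [|z r IH].
    rewrite big_nil /energy_form big1 // => e _; rewrite /edge_form.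
    rewrite big1 ?mul0r ?mulr0 // => u _; rewrite big1 // => v _.
    by rewrite !big_nil subrr mulr0.
  rewrite big_cons -IH -[X in _ + X]mul1r -energy_form_linr.
  by congr (energy_form S f _); apply/funext => x; rewrite big_cons mul1r.
rewrite big_seq [RHS]big_seq; apply: eq_bigr => x xK.
rewrite -[in RHS]gE energy_form_dirac //; apply: fsubset_trans KS.
by apply: contracted_edges_sub; rewrite fsub1set.
Qed.

Lemma cvg_energy_form S (f_ g_ : nat -> V -> R) f g :
  (forall x, f_ n x @[n --> \oo] --> f x) -> (forall x, g_ n x @[n --> \oo] --> g x) ->
  energy_form S (f_ n) (g_ n) @[n --> \oo] --> energy_form S f g.
Proof.
move=> ff gg; apply: cvg_sum_seq => e; apply: cvgMr; apply: cvgMl.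
apply: cvg_sum_seq => u; apply: cvg_sum_seq => v.
by apply: cvgM; apply: cvgB.
Qed.

(** Lower semicontinuity of the energy under pointwise convergence. *)
Lemma energy_le_lim (f_ : nat -> V -> R) f M :
  (forall x, f_ n x @[n --> \oo] --> f x) ->
  (exists N, forall n, (N <= n)%N -> energy_le (f_ n) M) -> energy_le f M.
Proof.
move=> ff [N fM] S eS; apply: (cvgr_to_le (cvg_energy_form ff ff)).
by exists N => // n /= /fM; apply.
Qed.

Lemma energy_le_diff x a : exists2 C : R, 0 <= C &
  forall f M, energy_le f M -> (f x - f a) ^+ 2 <= C * M.
Proof.
move: x; apply: (@connected_ind _ _ G _ a).
  by exists 0 => // f M _; rewrite subrr mul0r expr0n.
move=> y z yz [C C0 HC]; have c0 := cond_gt0 yz.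
exists (2 * C + 2 / cond G y z); first by apply: addr_ge0; [exact: mulr_ge0|apply: divr_ge0 => //;
    exact: ltW].
move=> f M fM; have h1 := HC f M fM.
have h2 : (f y - f z) ^+ 2 <= M / cond G y z.
  rewrite ler_pdivlMr // mulrC; have := fM [fset [fset y; z]]%fset.
  rewrite /energy_form big_seq_fset1 edge_form_pair // -expr2; apply.
  by move=> e /fset1P ->.
have -> : f z - f a = (f y - f a) - (f y - f z) by ring.
set p := f y - f a in h1 *; set q := f y - f z in h2 *.
have -> : (2 * C + 2 / cond G y z) * M = 2 * (C * M) + 2 * (M / cond G y z) by ring.
have -> : (p - q) ^+ 2 = 2 * p ^+ 2 + 2 * q ^+ 2 - (p + q) ^+ 2 by ring.
by have := sqr_ge0 (p + q); lra.
Qed.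

End energy.

Lemma cauchy_cvg_real (R : realType) (u : nat -> R) :
  (forall e, 0 < e -> exists N, forall k l, (N <= k)%N -> (N <= l)%N -> `|u k - u l| <= e) ->
  cvgn u.
Proof.
move=> H; apply/cauchy_cvgP/cauchy_ballP => _/posnumP[e].
have e2 : 0 < e%:num / 2 by [].
have [N HN] := H _ e2; rewrite near_map2; exists ([set n | (N <= n)%N], [set n | (N <= n)%N]) => /=.
  by split; exists N.
move=> [k l] /= [Nk Nl]; rewrite /ball /=; apply: le_lt_trans (HN _ _ Nk Nl) _.
by rewrite ltr_pdivrMr // ltr_pMr // ltr1n.
Qed.

Lemma energy_le_ge0 (R : realType) (V : pointedType) (G : network R V) (f : V -> R) M :
  energy_le G f M -> 0 <= M.
Proof. by move=> /(_ fset0); rewrite /energy_form big_seq_fset0; apply. Qed.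

Lemma energy_form_cst (R : realType) (V : pointedType) (G : network R V) S c (f : V -> R) :
  energy_form G S (fun=> c) f = 0.
Proof.
rewrite /energy_form big1 // => e _; rewrite /edge_form big1 ?mul0r ?mulr0 // => u _.
by rewrite big1 // => v _; rewrite subrr mul0r.
Qed.

(** * Energy minimisers with prescribed values on a finite set *)

Section minimal_energy.
Context {R : realType} {V : pointedType}.
Variable G : network R V.
Local Notation energy_form := (energy_form G).
Local Notation energy_le := (energy_le G).
Local Notation of_edges := (of_edges G).
Local Notation lap := (lap G).
Local Notation dirac_at := (@dirac_at R V).
Implicit Types (f g h : V -> R) (S : {fset {fset V}}).

Lemma fin_supp_energy_le f (K : {fset V}) : (forall x, x \notin K -> f x = 0) ->
  energy_le f (energy_form (contracted_edges G K) f f).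
Proof.
move=> f0 S eS; set S' := (S `|` contracted_edges G K)%fset.
have eS' : of_edges S' by apply: of_edgesU => //; exact: of_edges_star.
apply: le_trans (energy_form_mono _ (fsubsetUl S (contracted_edges G K)) eS') _.
rewrite (energy_form_fin_supp _ eS' (fsubsetUr _ _) f0).
by rewrite -(energy_form_fin_supp _ (@of_edges_star _ _ G K) (fsubset_refl _) f0).
Qed.

(** Direct method: the parallelogram identity makes a minimising sequence Cauchy in energy. As its
    members agree at a point of [A], it also converges pointwise, and lower semicontinuity
    concludes. *)
Lemma min_energy_ext_exists (A : {fset V}) (phi : V -> R) : A != fset0 ->
  exists2 h, min_energy_ext G A phi h & (energy G h < +oo)%E.
Proof.
move=> /fset0Pn[a aA].
pose ext f := forall x, x \in A -> f x = phi x.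
pose E := [set M | exists2 f, ext f & energy_le f M].
pose f0 x := if x \in A then phi x else 0.
have E0 : E !=set0.
  exists (energy_form (contracted_edges G A) f0 f0), f0; first by move=> x xA; rewrite /f0 xA.
  by apply: fin_supp_energy_le => x /negbTE xA; rewrite /f0 xA.
have hE : has_inf E by split => //; exists 0 => M [f _ /energy_le_ge0].
set I := inf E.
have I_le M f : ext f -> energy_le f M -> I <= M.
  by move=> ef fM; apply: ge_inf; [case: hE|exists f].
have I0 : 0 <= I by apply: lb_le_inf => // M [f _ /energy_le_ge0].
have /choice[f_ Hf] : forall n : nat, exists f, ext f /\ energy_le f (I + n.+1%:R^-1).
  move=> n; have n0 : (0 : R) < n.+1%:R^-1 by rewrite invr_gt0.
  have [M [f ef fM] MI] := inf_adherent n0 hE; exists f; split => // S eS.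
  by apply: le_trans (fM _ eS) _; exact: ltW.
have diff k l : energy_le (fun x => 1 * f_ k x + (- 1) * f_ l x) (2 * k.+1%:R^-1 + 2 * l.+1%:R^-1).
  move=> S eS; apply/ler_addgt0Pr => e e0.
  (* The midpoint is a competitor, so its energy on some finite edge set exceeds [I - e / 4]; it
     enters the parallelogram identity with the factor 4, leaving an error of [e]. *)
  pose mid x := 2^-1 * f_ k x + 2^-1 * f_ l x.
  have [S0 eS0 midI] : exists2 S0, of_edges S0 & I - e / 4 < energy_form S0 mid mid.
    apply: contrapT => nS; suff : I <= I - e / 4 by lra.
    apply: (@I_le _ mid) => [x xA|S' eS'].
      by rewrite /mid !(proj1 (Hf _)) //; lra.
    by rewrite leNgt; apply/negP => h; apply: nS; exists S'.
  have eSS : of_edges (S `|` S0)%fset by exact: of_edgesU.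
  apply: le_trans (energy_form_mono _ (fsubsetUl S S0) eSS) _.
  have mm := energy_form_mono mid (fsubsetUr S S0) eSS.
  have midE : energy_form (S `|` S0)%fset mid mid = _ := energy_form_sq _ _ 2^-1 (f_ k) 2^-1 (f_ l).
  rewrite energy_form_sq.
  have := proj2 (Hf k) _ eSS; have := proj2 (Hf l) _ eSS.
  move: midE mm midI.
  set a1 := energy_form _ (f_ k) (f_ k); set a2 := energy_form _ (f_ k) (f_ l).
  set a3 := energy_form _ (f_ l) (f_ l); set a4 := energy_form _ mid mid.
  set a5 := energy_form _ mid mid; set p := k.+1%:R^-1; set q := l.+1%:R^-1.
  by move=> -> *; lra.
have cvf x : cvgn (fun n => f_ n x).
  have [C C0 HC] := energy_le_diff G x a.
  apply: cauchy_cvg_real => e e0.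
  (* The error [2 / k.+1 + 2 / l.+1] costs [4 * C] times this quantity; adding 1 keeps the
     denominator positive. *)
  have d0 : 0 < e ^+ 2 / (4 * C + 1) by rewrite divr_gt0 ?exprn_gt0 // ltr_wpDl ?mulr_ge0.
  have [N HN] := invn_lt d0; exists N => k l Nk Nl.
  rewrite -(@ler_pXn2r _ 2%N) ?nnegrE ?(ltW e0) // real_normK ?num_real //.
  have := HC _ _ (diff k l); rewrite !(proj1 (Hf _) a aA) => h.
  have -> : (f_ k x - f_ l x) = 1 * f_ k x + -1 * f_ l x - (1 * phi a + -1 * phi a) by lra.
  apply: le_trans h _.
  have pk := ltW (HN _ Nk); have ql := ltW (HN _ Nl); set d := e ^+ 2 / _ in pk ql.
  apply: (@le_trans _ _ (C * (4 * d))).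
    by apply: ler_wpM2l => //; move: pk ql; set p := k.+1%:R^-1; set q := l.+1%:R^-1; lra.
  have dE : d * (4 * C + 1) = e ^+ 2 by rewrite /d divfK // gt_eqF // ltr_wpDl ?mulr_ge0.
  have d_ge0 : 0 <= d by rewrite divr_ge0 ?sqr_ge0 // addr_ge0 // mulr_ge0.
  by rewrite -dE; lra.
pose h x := limn (fun n => f_ n x).
have hI : energy_le h I.
  move=> S eS; apply/ler_addgt0Pr => e e0; have [N HN] := invn_lt e0.
  suff : energy_le h (I + e) by apply.
  apply: (energy_le_lim (f_ := f_)); first by move=> x; exact: cvf.
  exists N => n /HN ne S' eS'; apply: le_trans (proj2 (Hf n) _ eS') _.
  by rewrite lerD2l ltW.
exists h; last by apply/energy_ltP; exists I.
split=> [x xA|g eg].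
  apply: (cvg_lim (@Rhausdorff R)); apply: cvg_near_cst.
  by exists 0%N => // n _; rewrite (proj1 (Hf n)).
have [gfin|] := boolP (energy G g < +oo)%E; last first.
  by rewrite -leNgt leye_eq => /eqP ->; exact: leey.
have gE : (energy G g = (fine (energy G g))%:E)%E by rewrite fineK // ge0_fin_numE ?energy_ge0.
rewrite gE; apply/energy_leP => S eS; apply: le_trans (hI S eS) _.
by apply: (I_le _ g) => //; apply/energy_leP; rewrite -gE.
Qed.

(** Normal contraction: the map that sends a real to its absolute value cut at 1 is 1-Lipschitz. *)
Lemma clamp_energy_le f M : energy_le f M ->
  energy_le (fun x => Num.min `|f x| 1) M.
Proof.
move=> fM S eS; apply: le_trans (fM S eS).
rewrite /energy_form big_seq [leRHS]big_seq; apply: ler_sum => e /eS ee.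
have [x [y [_ eE]]] := edge_pair ee; rewrite eE in ee *; rewrite !edge_form_pair //.
rewrite ler_wpM2l ?cond_ge0 // -!expr2 -real_normK ?num_real // -[leRHS]real_normK ?num_real //.
rewrite ler_pXn2r ?nnegrE // /Order.min.
have := ler_normD (f x - f y) (f y); have := ler_normD (f y - f x) (f x).
rewrite !subrK (distrC (f y)).
have := normr_ge0 (f x - f y).
move=> h3 h4 h5; case: (ltP `|f x| 1) => h1; case: (ltP `|f y| 1) => h2; rewrite ler_norml;
    apply/andP; split; lra.
Qed.

(* Perturbing the minimizer [h] towards [1 - 1_o] only changes the energy of
   the edges at [o] beyond scaling, so that [lap] at [o] bounds its energy
   from below. *)
Lemma min_energy_flow (B : {fset V}) (phi h : V -> R) o M :
  o \notin B -> (forall x, x \in B -> phi x = 1) -> phi o = 0 ->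
  min_energy_ext G (o |` B)%fset phi h -> energy_le h M ->
  (forall M', energy_le h M' -> M <= M') ->
  \sum_(y <- nbr G o) cond G o y * h y <= M.
Proof.
move=> oB phiB phio [hA hmin] hM Mmin.
have ho : h o = 0 by rewrite hA ?phio // !inE eqxx.
have lapE : lap h o = - \sum_(y <- nbr G o) cond G o y * h y.
  by rewrite /lap -sumrN; apply: eq_bigr => y _; rewrite ho sub0r mulrN.
set Q := (X in X <= M) in lapE *.
pose P := lap (dirac_at o) o.
pose g x : R := 1 - dirac_at o x.
have key s : 0 < s -> M <= (1 + s) ^+ 2 * M - 2 * s * (1 + s) * Q + s ^+ 2 * P.
  move=> s0; pose hs x := (1 + s) * h x + (- s) * g x.
  suff hsM : energy_le hs ((1 + s) ^+ 2 * M - 2 * s * (1 + s) * Q + s ^+ 2 * P).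
    apply: Mmin; apply/energy_leP.
    apply: le_trans (iffRL (energy_leP G hs _) hsM); apply: hmin => x.
    rewrite !inE => /orP[/eqP ->|xB].
      by rewrite /hs /g /dirac_at eqxx ho phio /=; lra.
    have xo : x != o by apply: contraNneq oB => <-.
    rewrite /hs /g /dirac_at (negbTE xo) hA ?phiB ?inE ?xB ?orbT //=; lra.
  move=> S eS; pose S' := (S `|` contracted_edges G [fset o])%fset.
  have eS' : of_edges S' by apply: of_edgesU => //; exact: of_edges_star.
  apply: le_trans (energy_form_mono _ (fsubsetUl S _) eS') _; rewrite -/S'.
  have oS' : (contracted_edges G [fset o] `<=` S')%fset by exact: fsubsetUr.
  have gE f : energy_form S' f g = - lap f o.
    rewrite -(energy_form_dirac _ eS' oS').
    rewrite (_ : g = fun x => 1 * (fun=> 1) x + (- 1) * dirac_at o x).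
      by rewrite energy_form_linr energy_form_sym energy_form_cst; lra.
    by apply/funext => x; rewrite /g; lra.
  rewrite /hs energy_form_sq gE gE lapE.
  have -> : - lap g o = P.
    rewrite /P /lap -sumrN; apply: eq_bigr => y _; rewrite /g; ring.
  have := ler_wpM2l (sqr_ge0 (1 + s)) (hM _ eS').
  by rewrite -/Q sqrrN; lra.
rewrite leNgt; apply/negP => MQ.
have M0 := energy_le_ge0 hM.
(* Chosen so that the second-order term [s * (M - 2 * Q + P)] is at most [Q - M], half of the
   first-order gain [2 * (Q - M)]. *)
pose s := (Q - M) / (Q - M + M + `|P| + 1).
have d0 : 0 < Q - M + M + `|P| + 1 by have := normr_ge0 P; lra.
have s0 : 0 < s by rewrite divr_gt0 // subr_gt0.
have sd : s * (Q - M + M + `|P| + 1) = Q - M by rewrite /s divfK // gt_eqF.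
have := key s s0.
have -> : (1 + s) ^+ 2 * M - 2 * s * (1 + s) * Q + s ^+ 2 * P =
    M + s * (2 * (M - Q) + s * (M - 2 * Q + P)) by ring.
rewrite -subr_ge0 addrAC subrr add0r pmulr_rge0 //.
have : s * (M - 2 * Q + P) <= s * (Q - M + M + `|P| + 1).
  by apply: ler_wpM2l; [exact: ltW|have := ler_norm P; lra].
by rewrite sd; lra.
Qed.

(** Cut at 1, the absolute value of [f] has the boundary values of [h], so [M] bounds the minimal
    energy; the latter dominates the flow out of [o] by [min_energy_flow]. *)
Lemma min_energy_hitting_bound (B : {fset V}) (phi h f : V -> R) o M :
  o \notin B -> (forall x, x \in B -> phi x = 1) -> phi o = 0 ->
  min_energy_ext G (o |` B)%fset phi h ->
  f o = 0 -> (forall x, x \in B -> 1 <= `|f x|) -> energy_le f M ->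
  \sum_(y <- nbr G o) cond G o y * h y <= M.
Proof.
move=> oB phiB phio hmin fo fB fM.
have hM : (energy G h <= M%:E)%E.
  apply: le_trans (iffRL (energy_leP G _ _) (clamp_energy_le fM)).
  apply: (proj2 hmin) => x; rewrite !inE => /orP[/eqP ->|xB].
    by rewrite fo normr0 phio /Order.min ltr01.
  by rewrite phiB //; apply/min_idPr; exact: fB.
have hfin : (energy G h)%E \is a fin_num.
  by rewrite ge0_fin_numE ?energy_ge0 //; apply: le_lt_trans hM _; rewrite ltry.
apply: (@le_trans _ _ (fine (energy G h))); last by rewrite -lee_fin fineK.
apply: (min_energy_flow oB phiB phio hmin).
- by apply/energy_leP; rewrite fineK.
- by move=> M' /energy_leP; rewrite -lee_fin fineK.
Qed.

End minimal_energy.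

(** * Dirichlet problems along an exhaustion and their limit *)

Section dirichlet_problems.
Context {R : realType} {V : pointedType}.
Variable G : network R V.
Local Notation energy_form := (energy_form G).
Local Notation energy_le := (energy_le G).
Local Notation of_edges := (of_edges G).
Local Notation lap := (lap G).
Variables (A : {fset V}) (psi : V -> R) (K : nat -> {fset V}) (g_ : nat -> V -> R) (g : V -> R).
Hypothesis Kmono : forall n k, (n <= k)%N -> (K n `<=` K k)%fset.
Hypothesis gA : forall n x, x \in A -> g_ n x = psi x.
Hypothesis g0 : forall n x, x \notin K n -> g_ n x = 0.
Hypothesis gharm : forall n x, x \in K n -> x \notin A -> lap (g_ n) x = 0.
Hypothesis gcvg : forall x, g_ n x @[n --> \oo] --> g x.

Let e_ n := energy_form (contracted_edges G (K n)) (g_ n) (g_ n).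

Let orth S n f : of_edges S -> (contracted_edges G (K n) `<=` S)%fset ->
  (forall x, x \notin K n -> f x = 0) -> (forall x, x \in A -> f x = 0) ->
  energy_form S (g_ n) f = 0.
Proof.
move=> eS KS' f0 fA; rewrite (energy_form_fin_supp _ eS KS' f0) big1_seq // => x /andP[_ xK].
by have [/fA ->|xA] := boolP (x \in A); [rewrite mul0r|rewrite gharm // mulr0].
Qed.

Let energy_stable S n : of_edges S -> (contracted_edges G (K n) `<=` S)%fset ->
  energy_form S (g_ n) (g_ n) = e_ n.
Proof.
move=> eS KS'; rewrite /e_ (energy_form_fin_supp _ eS KS' (@g0 n)).
by rewrite -(energy_form_fin_supp _ (@of_edges_star _ _ G _) (fsubset_refl _) (@g0 n)).
Qed.

(** Pythagoras: [g_ n - g_ m] vanishes on [A] and off [K m], hence is orthogonal to [g_ m]. In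
    particular the energies [e_ n] decrease. *)
Let diff_energy m n : (n <= m)%N ->
  energy_le (fun x => 1 * g_ n x + (- 1) * g_ m x) (e_ n - e_ m).
Proof.
move=> nm S eS; pose S' := (S `|` contracted_edges G (K m))%fset.
have eS' : of_edges S' by apply: of_edgesU => //; exact: of_edges_star.
apply: le_trans (energy_form_mono _ (fsubsetUl S _) eS') _; rewrite -/S'.
have mS : (contracted_edges G (K m) `<=` S')%fset by exact: fsubsetUr.
have nS : (contracted_edges G (K n) `<=` S')%fset.
  by apply: fsubset_trans mS; exact: contracted_edges_sub (Kmono nm).
have : energy_form S' (g_ m) (fun x => 1 * g_ n x + (- 1) * g_ m x) = 0.
  apply: orth => // [x xm|x xA]; last by rewrite !gA //; lra.
  rewrite !g0 //; first by lra.
  by apply: contra xm; apply/fsubsetP; exact: Kmono.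
rewrite energy_form_sq energy_form_sym energy_form_linear.
by rewrite !energy_stable // => h; lra.
Qed.

Let e_ge0 n : 0 <= e_ n. Proof. exact/energy_form_ge0/of_edges_star. Qed.

Lemma dirichlet_energy_fin : exists M, energy_le g M.
Proof.
exists (e_ 0); apply: (energy_le_lim gcvg); exists 0%N => n _ S eS.
have h1 : e_ n <= e_ 0 by have := energy_le_ge0 (diff_energy (leq0n n)); lra.
apply: le_trans h1; exact: (fin_supp_energy_le (@g0 n)).
Qed.

(** If [e_ n] is within [e] of the infimum of the energies, [g_ n] is within [e] of all later
    solutions, hence of [g] by lower semicontinuity. *)
Lemma dirichlet_energy_cvg e : 0 < e ->
  exists n, energy_le (fun x => 1 * g_ n x + (- 1) * g x) e.
Proof.
move=> e0; have hE : has_inf (range e_) by split; [exists (e_ 0), 0%N|exists 0 => _ [n _ <-]].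
have [_ [n _ <-] ne] := inf_adherent e0 hE; exists n.
apply: (energy_le_lim (f_ := fun m x => 1 * g_ n x + (- 1) * g_ m x)).
  move=> x; apply: cvgD; first exact: cvg_cst.
  by apply: cvgMr; exact: gcvg.
exists n => m nm S eS; apply: le_trans (diff_energy nm eS) _.
have : inf (range e_) <= e_ m by apply: ge_inf; [case: hE|exists m].
by lra.
Qed.

End dirichlet_problems.

(** * Complete probability spaces *)

Section complete_probability.
Context d (T : measurableType d) (R : realType) (P : probability T R).

Lemma prob_ae_eq (A B : set T) : measurable A -> measurable B ->
  {ae P, forall w, A w <-> B w} -> P A = P B.
Proof.
move=> mA mB [N [mN N0 AB]].
have sub A' B' : measurable A' -> measurable B' ->
    (forall w, ~ N w -> A' w -> B' w) -> (P A' <= P B')%E.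
  move=> mA' mB' h; apply: (@le_trans _ _ (P (B' `|` N))).
    apply: le_measure; rewrite ?inE //; first exact: measurableU.
    by move=> w Aw; have [Nw|Nw] := pselect (N w); [right|left; exact: h].
  by apply: le_trans (measureU2 _ mB' mN) _; rewrite [X in (_ + X)%E]N0 adde0.
apply/eqP; rewrite eq_le; apply/andP; split; apply: sub => // w Nw.
- by have := @AB w; rewrite /=; have [] := pselect (A w <-> B w); tauto.
- by have := @AB w; rewrite /=; have [] := pselect (A w <-> B w); tauto.
Qed.

Lemma prob_le_ae (A B : set T) : measurable A -> measurable B ->
  {ae P, forall w, A w -> B w} -> (P A <= P B)%E.
Proof.
move=> mA mB AB; rewrite (@prob_ae_eq A (A `&` B)) //.
- by apply: le_measure; rewrite ?inE //; exact: measurableI.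
- exact: measurableI.
- by apply: filterS AB => w AB /=; tauto.
Qed.

Lemma measure_bigcup_nat (F : nat -> set T) : (forall n, measurable (F n)) ->
  trivIset setT F -> P (\bigcup_n F n) = (\sum_(n <oo) P (F n))%E.
Proof.
move=> mF tF; rewrite measure_bigcup //; apply: eq_eseriesl => n.
by rewrite in_setT.
Qed.

Lemma prob_partition (E : set T) (idx : T -> nat) :
  (forall k, measurable (E `&` [set w | idx w = k])) ->
  P E = (\sum_(k <oo) P (E `&` [set w | idx w = k]))%E.
Proof.
move=> mE; rewrite -measure_bigcup_nat //.
- by congr (P _); apply/seteqP; split => w /=; [move=> Ew; exists (idx w)|move=> [k _ []]].
- move=> k l _ _ [w [[_ wk] [_ wl]]].
  by rewrite -wk -wl.
Qed.

Lemma prob_partition_mul (E D : set T) (idx : T -> nat) (c : \bar R) : c \is a fin_num ->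
  (forall k, measurable (E `&` [set w | idx w = k])) ->
  (forall k, measurable (D `&` [set w | idx w = k])) ->
  (forall k, P (E `&` [set w | idx w = k]) = P (D `&` [set w | idx w = k]) * c)%E ->
  P E = (P D * c)%E.
Proof.
move=> /fineK <- mE mD ED; rewrite (prob_partition mE) (prob_partition mD) muleC -nneseriesZl //.
by apply: eq_eseriesr => k _; rewrite ED muleC.
Qed.

Lemma measurable_ae_eq (A B : set T) : measure_is_complete P -> measurable B ->
  {ae P, forall w, A w <-> B w} -> measurable A.
Proof.
move=> cP mB [N [mN N0 sub]]; have nN w : ~ N w -> A w <-> B w.
  by move=> nN; apply: contrapT => AB; apply: nN; exact: sub.
have -> : A = (B `\` N) `|` (A `&` N).
  apply/seteqP; split=> w; last by move=> [[Bw /nN ->]//|[]].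
  by move=> Aw; have [Nw|Nw] := pselect (N w); [right|left; split => //; exact/nN].
apply: measurableU; first exact: measurableD.
by apply: cP; exists N; split => //; exact: subIsetr.
Qed.

(** [A] is not assumed measurable. [is_rwinf] prescribes the measure of events on infima without
    saying that they are measurable; completeness transfers measurability from optional times. *)
Lemma prob_complete_ae_eq (A B : set T) : measure_is_complete P -> measurable B ->
  {ae P, forall w, A w <-> B w} -> P A = P B.
Proof. by move=> cP mB AB; apply: prob_ae_eq => //; exact: measurable_ae_eq AB. Qed.

Lemma prob1_ae (E : set T) : measurable E -> P E = 1%E -> {ae P, forall w, E w}.
Proof.
move=> mE PE; exists (~` E); split => //; first exact: measurableC.
by rewrite probability_setC // PE subee.
Qed.

Lemma prob0_ae (E : set T) : measurable E -> P E = 0%E -> {ae P, forall w, ~ E w}.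
Proof. by move=> mE PE; exists E; split => // w /= /contrapT. Qed.

End complete_probability.

(** * Cylinder events with states in the vertex set *)

Section cylinders.
Context {R : realType} {V : pointedType}.
Hypothesis countV : countable [set: V].
Local Notation path := (R -> option V).

(** Only vertices are prescribed: their singletons are clopen, which makes these events stable under
    small shifts to the right. They still generate, infinity being the complement of countably many
    vertices. *)
Definition state_cylinders : set (set path) :=
  [set C | exists2 s : seq (R * V), (forall p, p \in s -> 0 <= p.1) &
     C = [set x | forall p, p \in s -> x p.1 = Some p.2]].

Lemma state_cylindersI : setI_closed state_cylinders.
Proof.
move=> _ _ [s s0 ->] [r r0 ->]; exists (s ++ r).
  by move=> p; rewrite mem_cat => /orP[/s0|/r0].
apply/seteqP; split => x /=.
  by move=> [h1 h2] p; rewrite mem_cat => /orP[/h1|/h2].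
by move=> h; split=> p pi; apply: h; rewrite mem_cat pi ?orbT.
Qed.

Lemma traj_events_cylinders : traj_events `<=` <<s state_cylinders >>.
Proof.
have sG : sigma_algebra setT <<s state_cylinders >> by exact: smallest_sigma_algebra.
apply: smallest_sub => // _ [t [a [t0 ->]]].
have H v : <<s state_cylinders >> [set x : path | x t = Some v].
  apply: sub_sigma_algebra; exists [:: (t, v)]; first by move=> p; rewrite inE => /eqP ->.
  apply/seteqP; split => x /=; first by move=> xt p; rewrite inE => /eqP ->.
  by move=> /(_ (t, v)); rewrite inE eqxx; apply.
case: a => [v|]; first exact: H.
apply: (sa_ext sG (P := fun x : path => ~ exists v, x t = Some v)).
  by apply: (sa_not sG); apply: (sa_exists sG countV).
move=> x; split => [|-> []//].
by case: (x t) => // v h; case: h; exists v.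
Qed.

Lemma cylinders_traj C : state_cylinders C -> traj_events C.
Proof.
have sG : sigma_algebra setT (@traj_events R V) by exact: smallest_sigma_algebra.
move=> [s s0 ->]; elim: s s0 => [|[t v] s IH] s0.
  by apply: (sa_ext sG (sa_const sG True)) => x; split.
apply: (sa_ext sG (P := fun x : path => x t = Some v /\ forall p, p \in s -> x p.1 = Some p.2)).
  apply: (sa_and sG); last by apply: IH => p ps; apply: s0; rewrite inE ps orbT.
  by apply: sub_sigma_algebra; exists t, (Some v); split => //; apply: (s0 (t, v)); rewrite inE eqxx.
move=> x; split; first by move=> [xt h] p; rewrite inE => /orP[/eqP ->|/h].
move=> h; split; first by apply: (h (t, v)); rewrite inE eqxx.
by move=> p ps; apply: h; rewrite inE ps orbT.
Qed.

Context d (T : measurableType d) (P : probability T R).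

(** Dynkin's pi-lambda theorem for independence of [D] together with the law of [f], in the form
    needed by both strong Markov properties. *)
Lemma law_mul_cylinders (D : set T) (f : T -> path) (Y : process R V) :
  measurable D ->
  (forall C, traj_events C -> measurable (D `&` (f @^-1` C))) ->
  (forall C, traj_events C -> measurable (traj Y @^-1` C)) ->
  (forall C, state_cylinders C -> P (D `&` (f @^-1` C)) = (P D * law Y C)%E) ->
  forall C, traj_events C -> P (D `&` (f @^-1` C)) = (P D * law Y C)%E.
Proof.
move=> mD mf mY H C tC.
have sT : sigma_algebra setT (@traj_events R V) by exact: smallest_sigma_algebra.
pose Dy : set (set path) := [set C | traj_events C /\ P (D `&` (f @^-1` C)) = (P D * law Y C)%E].
suff : Dy C by case.
move: tC => /traj_events_cylinders; rewrite -(setI_closed_g_dynkin_g_sigma_algebra state_cylindersI).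
move: C; apply: smallest_sub => [|C cC]; last by split; [exact: cylinders_traj|exact: H].
split.
- split; first by apply: (sa_ext sT (sa_const sT True)) => x; split.
  by rewrite preimage_setT setIT /law preimage_setT probability_setT mule1.
- move=> C [tC PC]; split; first exact: (sa_not sT tC).
  have -> : D `&` f @^-1` (~` C) = D `\` (D `&` f @^-1` C).
    by apply/seteqP; split => w /=; rewrite /setC /=; tauto.
  rewrite measureD //; [|exact: mf|by rewrite ltey_eq fin_num_measure].
  rewrite setIA setIid.
  rewrite [X in (_ - X)%E]PC /law preimage_setC probability_setC; last exact: mY.
  by rewrite muleBr ?mule1 ?fin_num_measure // fin_num_adde_defr // fin_num_measure.
- move=> F tF FD; split; first by apply: (sa_bigcup sT) => n; case: (FD n).
  rewrite preimage_bigcup setI_bigcupr measure_bigcup_nat //.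
  + rewrite /law preimage_bigcup measure_bigcup_nat //.
    * rewrite -(fineK (fin_num_measure P D mD)) -nneseriesZl //.
      by apply: eq_eseriesr => n _; rewrite fineK ?fin_num_measure //; case: (FD n).
    * by move=> n; apply: mY; case: (FD n).
    * by move=> i j _ _ [w [Fi Fj]]; apply: tF => //; exists (traj Y w).
  + by move=> n; apply: mf; case: (FD n).
  + by move=> i j _ _ [w [[_ Fi] [_ Fj]]]; apply: tF => //; exists (f w).
Qed.

End cylinders.

(** * The strong Markov property at a vertex *)

(** Finitely many coordinates are involved, and for each of them both the prescribed vertex and its
    complement are right-open. *)
Lemma right_shift_cylinder (R : realType) (V : pointedType) (C : set (R -> option V)) x t :
  state_cylinders C -> right_cont x -> 0 <= t -> exists2 e, 0 < e &
    forall s, t <= s <= t + e -> C (shift_traj x s) <-> C (shift_traj x t).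
Proof.
move=> [l l0 ->] rx t0; elim: l l0 => [|p l IH] l0; first by exists 1.
have [e e0 He] : exists2 e, 0 < e & forall s, t <= s <= t + e ->
    (forall p, p \in l -> shift_traj x s p.1 = Some p.2) <->
    (forall p, p \in l -> shift_traj x t p.1 = Some p.2).
  by apply: IH => q ql; apply: l0; rewrite inE ql orbT.
have p0 : 0 <= p.1 by apply: l0; rewrite inE eqxx.
have [d d0 Hd] : exists2 d, 0 < d & forall s, t <= s <= t + d ->
    x (s + p.1) = Some p.2 <-> x (t + p.1) = Some p.2.
  have [xp|xp] := pselect (x (t + p.1) = Some p.2).
    have [|d d0 Hd] := clopen_right_open (clopen1 p.2) rx (t := t + p.1) _ xp; first exact: addr_ge0.
    by exists d => // s /andP[s1 s2]; split=> // _; apply: Hd; apply/andP; split; lra.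
  have [|d d0 Hd] := clopen_right_open (clopenC (clopen1 p.2)) rx (t := t + p.1) _ xp; first exact:
      addr_ge0.
  exists d => // s /andP[s1 s2]; split=> // xs.
  by have := Hd (s + p.1); rewrite /= xs; case=> //; apply/andP; split; lra.
exists (Num.min e d); first by rewrite lt_min e0.
have me : Num.min e d <= e by rewrite ge_min lexx.
have md : Num.min e d <= d by rewrite ge_min lexx orbT.
move=> s /andP[s1 s2].
have /He hl : t <= s <= t + e by apply/andP; split; lra.
have /Hd hp : t <= s <= t + d by apply/andP; split; lra.
have E y : (forall q, q \in p :: l -> shift_traj x y q.1 = Some q.2) <->
    x (y + p.1) = Some p.2 /\ (forall q, q \in l -> shift_traj x y q.1 = Some q.2).
  split=> [h|[h1 h2] q].
    by split; [apply: h; rewrite inE eqxx|move=> q ql; apply: h; rewrite inE ql orbT].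
  by rewrite inE => /orP[/eqP ->|/h2].
by rewrite /= !E; tauto.
Qed.

(** * Completed histories and the filtration on trajectories *)

Section process_filtration.
Context {R : realType} {V : pointedType}.
Local Notation path := (R -> option V).
Variables (Y : process R V) (good : set path).
Hypothesis measY : forall (t : R) a, 0 <= t -> measurable [set w | traj Y w t = a].
Hypothesis aeY : {ae pr_prob Y, forall w, good (traj Y w)}.

Definition path_filtration (t : R) : set (set path) :=
  <<s [set C | (exists (s : R) a, [/\ 0 <= s, s <= t & C = [set x : path | x s = a]]) \/
               (forall x, C x -> ~ good x)] >>.

Lemma history_sa t : sigma_algebra setT (history Y t).
Proof. exact: smallest_sigma_algebra. Qed.

Lemma bad_negligible (E : set (pr_space Y)) : (forall w, E w -> ~ good (traj Y w)) ->
  (pr_prob Y).-negligible E.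
Proof.
move=> EN; apply: negligibleS aeY => w /EN; exact.
Qed.

Lemma adapted_process : adapted good (traj Y) (history Y) measurable.
Proof.
split.
- exact: history_sa.
- exact: sigma_algebra_measurable.
- move=> t; apply: smallest_sub; first exact: sigma_algebra_measurable.
  move=> E [[s [a [s0 _ ->]]]|NE]; first exact: measY.
  exact: pr_complete NE.
- move=> s t st; apply: smallest_sub; first exact: history_sa.
  move=> E [[r [a [r0 rs ->]]]|NE]; apply: sub_sigma_algebra; last by right.
  by left; exists r, a; split => //; exact: le_trans st.
- move=> s t a s0 st; apply: sub_sigma_algebra; left; by exists s, a.
- by move=> t E EN; apply: sub_sigma_algebra; right; exact: bad_negligible.
Qed.

Lemma adapted_paths : adapted good id path_filtration (path_events good).
Proof.
split.
- by move=> t; exact: smallest_sigma_algebra.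
- exact: path_events_sa.
- move=> t; apply: smallest_sub; first exact: path_events_sa.
  move=> E [[s [a [s0 _ ->]]]|NE]; apply: sub_sigma_algebra; [left; by exists s, a|by right].
- move=> s t st; apply: smallest_sub; first exact: smallest_sigma_algebra.
  move=> E [[r [a [r0 rs ->]]]|NE]; apply: sub_sigma_algebra; last by right.
  by left; exists r, a; split => //; exact: le_trans st.
- move=> s t a s0 st; apply: sub_sigma_algebra; left; by exists s, a.
- by move=> t E EN; apply: sub_sigma_algebra; right.
Qed.

Lemma history_preimage t C : path_filtration t C -> history Y t (traj Y @^-1` C).
Proof.
have sH := history_sa t; move: C; apply: smallest_sub.
- split.
  + exact: (sa_const sH False).
  + by move=> C HC; apply: (sa_ext sH (sa_not sH HC)) => w; rewrite /setD /preimage /=; tauto.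
  + move=> C HC; rewrite preimage_bigcup; exact: (sa_bigcup sH).
- move=> C [[s [a [s0 st ->]]]|NC]; apply: sub_sigma_algebra; [left; by exists s, a|right].
  by apply: bad_negligible => w /NC.
Qed.

Lemma optional_preimage (B : set path) T : optional path_filtration B T ->
  optional (history Y) (traj Y @^-1` B) (T \o traj Y).
Proof. by move=> [T0 FT]; split => [w /T0 //|t]; exact: (history_preimage (FT t)). Qed.

End process_filtration.

Section reflected_walks.
Context {R : realType} {V : pointedType} {G : network R V} {m : V -> R}.
Variables (X : V -> process R V).
Hypothesis hX : is_rwinf G m X.
Local Notation path := (R -> option V).
Local Notation P z := (pr_prob (X z)).
Local Notation tr z := (traj (X z)).

Let cV : countable [set: V] := countable_vertices G.

Lemma ae_right_cont z : {ae P z, forall w, right_cont (tr z w)}.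
Proof.
move: (rwinf_rc hX z) (rwinf_step hX z); apply: filterS2 => w rc st.
have rV v : right_open [set Some v] (tr z w) by move=> t t0 tv; exact: st.
split=> // A t t0; case E : (tr z w t) => [v|] /= nA.
  have [//|//|e e0 H] := rV v t; exists e => // s /H /= ->.
  exact: nA.
have [//|e e0 H] := rc t A t0; exists e => // s se.
by case Es : (tr z w s) => [a|] //= aA; exact: (H s a).
Qed.

Section modulo_bad.
Variable good : set path.
Hypothesis good_right : good `<=` right_cont.
Hypothesis good_shift : forall x s, 0 <= s -> good x -> good (shift_traj x s).
Hypothesis ae_good : forall z, {ae P z, forall w, good (tr z w)}.
Local Notation opt z := (optional (history (X z))).

(** [good] is kept abstract because these results are used twice: with [right_cont] in order to
    prove that trajectories are good paths, and with [good_path] afterwards. *)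
Lemma adapted_walk z : adapted good (tr z) (history (X z)) measurable.
Proof. by apply: adapted_process => // t a t0; exact: (rwinf_meas hX). Qed.

Lemma measurable_path_event z C : path_events good C -> measurable (tr z @^-1` C).
Proof.
move=> gC; have := optional_event cV good_right good_shift (adapted_walk z)
  (optional_const (adapted_walk z) (lexx 0)) gC.
congr (measurable _); apply/seteqP; split => w /=.
- by move=> [_]; congr C; apply/funext => t; rewrite /shift_traj add0r.
- by split => //; move: H; congr C; apply/funext => t; rewrite /shift_traj add0r.
Qed.

Lemma law_ext C C' x : path_events good C -> path_events good C' ->
  (forall y, good y -> C y <-> C' y) -> law (X x) C = law (X x) C'.
Proof.
move=> gC gC' CC; apply: prob_ae_eq; try exact: measurable_path_event.
by apply: filterS (ae_good x) => w /CC.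
Qed.

Lemma measurable_shift_event z T B C : opt z B T -> path_events good C ->
  measurable [set w | B w /\ C (shift_traj (tr z w) (T w))].
Proof. exact: (optional_event cV good_right good_shift (adapted_walk z)). Qed.

Lemma markov_event z t v B C : 0 <= t -> history (X z) t B -> path_events good C ->
  P z [set w | (B w /\ tr z w t = Some v) /\ C (shift_traj (tr z w) t)] =
  (P z [set w | B w /\ tr z w t = Some v] * law (X v) C)%E.
Proof.
move=> t0 hB gC; have [C' tC' CC'] := path_events_traj gC.
have gC' := traj_events_path (good := good) tC'.
rewrite (law_ext _ gC gC') // -(rwinf_markov hX v t0 hB tC').
have oB : opt z [set w | B w /\ tr z w t = Some v] (fun=> t).
  split=> // s; have [ts|st] := ltP t s; last first.
    by apply: (sa_ext (ad_sa (adapted_walk z) s) (sa_const (ad_sa (adapted_walk z) s) False)) => w;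
        split => // -[].
  apply: (sa_ext (ad_sa (adapted_walk z) s) (P := fun w => B w /\ tr z w t = Some v)).
    apply: (sa_and (ad_sa (adapted_walk z) s)).
      by apply: (ad_mono (adapted_walk z) (ltW ts)).
    by apply: (ad_state (adapted_walk z)) => //; exact: ltW.
  by move=> w; split => [|[]].
apply: prob_ae_eq.
- exact: (measurable_shift_event oB gC).
- by have := measurable_shift_event oB gC'.
- by apply: filterS (ae_good z) => w /good_shift - /(_ t t0)/CC' /=; tauto.
Qed.

Lemma ae_vertex z t : 0 <= t -> {ae P z, forall w, exists v, tr z w t = Some v}.
Proof.
by move=> t0; apply: filterS (rwinf_locally_constant hX z t0) => w [v]; exists v.
Qed.

Lemma ae_grid_vertex z : {ae P z, forall w, forall n k, exists v, tr z w (grid n k) = Some v}.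
Proof. by apply: ae_foralln => n; apply: ae_foralln => k; exact/ae_vertex/grid_ge0. Qed.

(* [grid_up n (T w)] takes countably many values, so that the simple Markov
   property applies. *)
Lemma markov_grid_up z n v B T C : opt z B T -> path_events good C ->
  P z [set w | (B w /\ tr z w (grid_up n (T w)) = Some v) /\
               C (shift_traj (tr z w) (grid_up n (T w)))] =
  (P z [set w | B w /\ tr z w (grid_up n (T w)) = Some v] * law (X v) C)%E.
Proof.
move=> oB gC; have mB k := optional_grid (adapted_walk z) n k oB.
have E1 k : [set w | (B w /\ tr z w (grid_up n (T w)) = Some v) /\
      C (shift_traj (tr z w) (grid_up n (T w)))] `&` [set w | grid_index n (T w) = k] =
    [set w | ((B w /\ grid_index n (T w) = k) /\ tr z w (grid n k.+1) = Some v) /\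
      C (shift_traj (tr z w) (grid n k.+1))].
  apply/seteqP; rewrite /grid_up; split => w /=.
  - by move=> [[[Bw +] +] ek]; rewrite ek.
  - by move=> [[[Bw ek] +] +]; rewrite ek.
have E2 k : [set w | B w /\ tr z w (grid_up n (T w)) = Some v] `&` [set w | grid_index n (T w) = k] =
    [set w | (B w /\ grid_index n (T w) = k) /\ tr z w (grid n k.+1) = Some v].
  apply/seteqP; rewrite /grid_up; split => w /=.
  - by move=> [[Bw +] ek]; rewrite ek.
  - by move=> [[Bw ek] +]; rewrite ek.
have oG k : opt z [set w | (B w /\ grid_index n (T w) = k) /\ tr z w (grid n k.+1) = Some v] (fun=>
    grid n k.+1).
  have sF s := ad_sa (adapted_walk z) s.
  split; first by move=> w _; exact: grid_ge0.
  move=> s; have [ts|st] := ltP (grid n k.+1) s; last first.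
    by apply: (sa_ext (sF s) (sa_const (sF s) False)) => w; split => // -[].
  apply: (sa_ext (sF s) (P := fun w => (B w /\ grid_index n (T w) = k) /\ tr z w (grid n k.+1) = Some v)).
    apply: (sa_and (sF s)); first exact: (ad_mono (adapted_walk z) (ltW ts) (mB k)).
    by apply: (ad_state (adapted_walk z)); [exact: grid_ge0|exact: ltW].
  by move=> w; split => [|[]].
apply: (@prob_partition_mul _ _ _ _ _ _ (fun w => grid_index n (T w))).
- by apply: fin_num_measure; exact: measurable_path_event.
- by move=> k; rewrite E1; exact: measurable_shift_event (oG k) gC.
- by move=> k; rewrite E2; exact: (optional_mem (adapted_walk z) (oG k)).
- by move=> k; rewrite E1 E2; apply: markov_event => //; exact: grid_ge0.
Qed.

Lemma eventually_grid_upE (S : set (option V)) (x : path) t : clopen S -> right_cont x -> 0 <= t ->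
  exists N, forall n, (N <= n)%N -> S (x (grid_up n t)) <-> S (x t).
Proof.
move=> cS rx t0; have [Sx|nSx] := pselect (S (x t)).
  by have [N HN] := iffLR (eventually_grid_up cS rx t0) Sx; exists N => n /HN.
have [N HN] := iffLR (eventually_grid_up (clopenC cS) rx t0) nSx.
by exists N => n /HN.
Qed.

Lemma eventually_shift_cylinder (C : set path) (x : path) t : state_cylinders C -> right_cont x -> 0 <= t ->
  exists N, forall n, (N <= n)%N -> C (shift_traj x (grid_up n t)) <-> C (shift_traj x t).
Proof.
move=> cC rx t0; have [e e0 He] := right_shift_cylinder cC rx t0.
by have [N HN] := grid_up_near t0 e0; exists N => n /HN /He.
Qed.

(** Cylinders suffice. For them the event after a grid time close to [T] agrees with the event after
    [T], and the Markov property at grid times passes to the limit. *)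
Lemma strong_markov_vertex z v B T C : opt z B T -> path_events good C ->
  P z [set w | (B w /\ tr z w (T w) = Some v) /\ C (shift_traj (tr z w) (T w))] =
  (P z [set w | B w /\ tr z w (T w) = Some v] * law (X v) C)%E.
Proof.
move=> oB gC; have [C' tC' CC'] := path_events_traj gC.
have gC' := traj_events_path (good := good) tC'.
have oBv := optional_state0 cV good_right (adapted_walk z) (Some v) oB.
set D := B `&` _ in oBv; have mD := optional_mem (adapted_walk z) oBv.
have [T0 _] := oBv.
have key C1 : traj_events C1 -> P z (D `&` ((fun w => shift_traj (tr z w) (T w)) @^-1` C1)) =
    (P z D * law (X v) C1)%E.
  apply: law_mul_cylinders => // [{}C1 tC1|{}C1 tC1|{}C1 cC1].
  - exact: (measurable_shift_event oBv (traj_events_path (good := good) tC1)).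
  - exact: (measurable_path_event v (traj_events_path (good := good) tC1)).
  - have gC1 := traj_events_path (good := good) (cylinders_traj cC1).
    (* The state at the grid time is required to be [v] as well; eventually this is automatic, and
       it makes the law of the future that of [X v]. *)
    pose En n := [set w | (D w /\ tr z w (grid_up n (T w)) = Some v) /\
       C1 (shift_traj (tr z w) (grid_up n (T w)))].
    pose Dn n := [set w | D w /\ tr z w (grid_up n (T w)) = Some v].
    have oG n : opt z (Dn n) (fun w => grid_up n (T w)).
      have [_ FD] := oBv.
      split; first by move=> w [/T0 Tw _]; rewrite (le_trans Tw) // ltW // grid_up_gt.
      move=> s; apply: (sa_ext (ad_sa (adapted_walk z) s)).
        apply: (@optional_grid_up _ _ _ _ _ _ _ (adapted_walk z) D T n s (fun s w => tr z w s =
            Some v)) => //.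
        by move=> r r0 rs; apply: (ad_state (adapted_walk z)) => //; exact: ltW.
      by move=> w; rewrite /Dn /=; tauto.
    have c1 : P z (En n) @[n --> \oo] --> P z (D `&` ((fun w => shift_traj (tr z w) (T w)) @^-1` C1)).
      apply: cvg_prob_eventually.
      + by move=> n; exact: (measurable_shift_event (oG n) gC1).
      + exact: (measurable_shift_event oBv gC1).
      + apply: filterS (ae_good z) => w /good_right rx.
        have [Dw|nD] := pselect (D w); last by exists 0%N => n _; split=> [[[]]|[]].
        have [N HN] := eventually_shift_cylinder cC1 rx (T0 w Dw).
        have [M HM] := eventually_grid_upE (clopen1 v) rx (T0 w Dw).
        exists (maxn N M) => n; rewrite geq_max => /andP[/HN Nn /HM /= Mn].
        by rewrite /En /=; case: (Dw) => _ /=; tauto.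
    have c2 : P z (Dn n) @[n --> \oo] --> P z D.
      apply: cvg_prob_eventually => //.
      + by move=> n; exact: (optional_mem (adapted_walk z) (oG n)).
      + apply: filterS (ae_good z) => w /good_right rx.
        have [Dw|nD] := pselect (D w); last by exists 0%N => n _; split=> [[]|].
        have [M HM] := eventually_grid_upE (clopen1 v) rx (T0 w Dw).
        by exists M => n /HM /= Mn; rewrite /Dn /=; case: (Dw) => _ /=; tauto.
    have mC1 := measurable_path_event v gC1.
    have finL : law (X v) C1 \is a fin_num by exact: fin_num_measure.
    have c3 : (P z (Dn n) * law (X v) C1)%E @[n --> \oo] --> (P z D * law (X v) C1)%E.
      by apply: cvgeMr => //.
    apply: (cvg_unique _ c1); first exact: ereal_hausdorff.
    rewrite (_ : (fun n => P z (En n)) = (fun n => (P z (Dn n) * law (X v) C1)%E)) //.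
    by apply/funext => n; exact: markov_grid_up.
rewrite (law_ext _ gC gC') // -(key _ tC').
apply: prob_ae_eq.
- exact: (measurable_shift_event oBv gC).
- exact: (measurable_shift_event oBv gC').
- apply: filterS (ae_good z) => w gw.
  have [Dw|nD] := pselect (D w); last by split=> -[Dw _]; case: nD.
  have [h1 h2] := CC' _ (good_shift (T0 w Dw) gw).
  by split=> -[_ Cx]; split => //; [exact: h1|exact: h2].
Qed.

End modulo_bad.
End reflected_walks.

(** * Left limits *)

Section probability_bounds.
Context d (T : measurableType d) (R : realType) (P : probability T R).

Lemma prob_fset_partition (V : pointedType) (A : {fset V}) (f : T -> option V) (E : set T) :
  measurable E -> (forall v, measurable (E `&` [set w | f w = Some v])) ->
  {ae P, forall w, E w -> in_fset A (f w)} ->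
  P E = (\sum_(v <- A) P (E `&` [set w | f w = Some v]))%E.
Proof.
move=> mE mEv EA; rewrite -measure_fbigsetU //; last first.
  by move=> v v' _ _ [w [[_ /= fv] [_ /=]]]; rewrite fv => -[].
rewrite -bigcup_fset; apply: prob_ae_eq => //.
  by apply: fin_bigcup_measurable => // *; exact: finite_fset.
apply: filterS EA => w EA; split; last by move=> [v _ []].
by move=> Ew; have := EA Ew; case fw : (f w) => [v|] //= vA; exists v.
Qed.

Lemma measurable_eventually (E : nat -> set T) : (forall n, measurable (E n)) ->
  measurable [set w | exists N, forall n, (N <= n)%N -> E n w].
Proof.
have sT := @sigma_algebra_measurable _ T; move=> mE.
apply: (sa_exists sT); first exact: countableP.
move=> N; apply: (sa_forall sT); first exact: countableP.
by move=> n; apply: (sa_imply sT); [exact: (sa_const sT)|exact: mE].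
Qed.

(** Fatou's lemma for the lower limit of a sequence of events. *)
Lemma prob_eventually_le (E : nat -> set T) (c : \bar R) :
  (forall n, measurable (E n)) -> (forall n, P (E n) <= c)%E ->
  (P [set w | exists N, forall n, (N <= n)%N -> E n w] <= c)%E.
Proof.
have sT := @sigma_algebra_measurable _ T; move=> mE Ec.
pose F N := [set w | forall n, (N <= n)%N -> E n w].
have mF N : measurable (F N).
  apply: (sa_forall sT); first exact: countableP.
  by move=> n; apply: (sa_imply sT); [exact: (sa_const sT)|exact: mE].
have EF : [set w | exists N, forall n, (N <= n)%N -> E n w] = \bigcup_N F N.
  by apply/seteqP; split => w /=; [move=> [N HN]; exists N|move=> [N _ HN]; exists N].
have : P \o F @ \oo --> P (\bigcup_N F N).
  apply: nondecreasing_cvg_mu => //; first by rewrite -EF; exact: measurable_eventually.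
  move=> n k nk; apply/subsetPset => w Fw i ki; apply: Fw.
  exact: leq_trans ki.
rewrite EF => /cvge_to_le; apply; exists 0%N => // n _ /=.
by apply: le_trans (Ec n); apply: le_measure; rewrite ?inE // => w; apply.
Qed.

(** Markov's inequality for the number of the events [c k] that occur. *)
Lemma prob_count_le (c : nat -> set T) (K M : nat) (S : \bar R) :
  (forall k, measurable (c k)) -> (\sum_(k <- iota 0 K) P (c k) <= S)%E ->
  measurable [set w | (M <= count (fun k => `[< c k w >]) (iota 0 K))%N] /\
  (M%:R%:E * P [set w | (M <= count (fun k => `[< c k w >]) (iota 0 K))%N] <= S)%E.
Proof.
move=> mc cS; pose f w : R := \sum_(k <- iota 0 K) \1_(c k) w.
have fE w : f w = (count (fun k => `[< c k w >]) (iota 0 K))%:R.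
  rewrite /f; elim: (iota 0 K) => [|k s IH]; first by rewrite big_nil.
  by rewrite big_cons IH /= natrD; congr (_ + _).
have mf : measurable_fun setT f.
  by apply: measurable_sum => k; exact: measurable_indic.
set E := [set w | _].
have EE : E = f @^-1` [set` `[M%:R, +oo[].
  by apply/seteqP; split => w; rewrite /E /= in_itv /= andbT fE ler_nat.
have mE : measurable E by rewrite EE -[X in measurable X]setTI; exact: mf.
split => //; apply: le_trans cS.
have -> : (M%:R%:E * P E = \int[P]_(x in setT) (M%:R * \1_E x)%:E)%E.
  under eq_integral do rewrite EFinM.
  rewrite ge0_integralZl_EFin //; first by rewrite integral_indic // setIT.
  - by apply/measurable_EFinP; exact: measurable_indic.
have -> : (\sum_(k <- iota 0 K) P (c k) = \int[P]_(x in setT) (f x)%:E)%E.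
  rewrite /f; under [RHS]eq_integral do rewrite -sumEFin.
  rewrite ge0_integral_sum //.
  - by apply: eq_bigr => k _; rewrite integral_indic // setIT.
  - by move=> k; apply/measurable_EFinP; exact: measurable_indic.
apply: ge0_le_integral => //.
- by apply/measurable_EFinP; apply: measurable_funM => //; exact: measurable_indic.
- exact/measurable_EFinP.
- move=> w _; rewrite lee_fin indicE; have [Ew|nE] := boolP (w \in E).
    by move: Ew; rewrite inE mulr1 fE ler_nat.
  by rewrite mulr0 fE.
Qed.

End probability_bounds.

(** * Left limits from counting grid crossings *)

Section crossings.
Context {R : realType} {V : pointedType}.
Local Notation path := (R -> option V).
Implicit Types (x : path) (y : V).

(** The indicator of being at [y] has a left limit at every positive time, unrelated to the value at
    that time. *)
Definition left_limit y x := forall t, 0 < t -> exists2 eps, 0 < eps &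
  (forall s, 0 <= s -> t - eps < s < t -> x s = Some y) \/
  (forall s, 0 <= s -> t - eps < s < t -> x s <> Some y).

Lemma discrete_crossing (p : nat -> Prop) i j : (i <= j)%N -> p i -> ~ p j ->
  exists2 k, (i <= k < j)%N & p k /\ ~ p k.+1.
Proof.
move=> /subnKC <-; elim: (j - i)%N => [|d IH]; first by rewrite addn0.
move=> pi npd; have [pd|nd] := pselect (p (i + d)%N).
  by exists (i + d)%N; rewrite ?leq_addr -?addnS //; rewrite addnS ltnSn.
have [k /andP[ik kd] pk] := IH pi nd; exists k => //.
by rewrite ik /= addnS (ltn_trans kd).
Qed.

(* Without a left limit at [t], the number of exits from [y] seen on the grid is
   unbounded, while its expectation is not. *)
Lemma crossing_count y x t : right_cont x -> 0 < t ->
  ~ (exists2 eps, 0 < eps &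
     (forall s, 0 <= s -> t - eps < s < t -> x s = Some y) \/
     (forall s, 0 <= s -> t - eps < s < t -> x s <> Some y)) ->
  forall M s, 0 <= s < t -> exists N, forall n, (N <= n)%N -> exists D : seq nat,
    [/\ uniq D, size D = M & forall k, k \in D ->
      [/\ s < grid n k, grid n k.+1 < t, x (grid n k) = Some y & x (grid n k.+1) <> Some y]].
Proof.
move=> rx t0 nlim; elim=> [|M IH] s /andP[s0 st].
  by exists 0%N => n _; exists [::].
have d0 : 0 < t - s by rewrite subr_gt0.
have [s1 /andP[ss1 s1t] xs1] : exists2 s1, s < s1 < t & x s1 = Some y.
  apply: contrapT => H; apply: nlim; exists (t - s) => //; right=> r r0 /andP[r1 r2] xr.
  by apply: H; exists r; rewrite ?r2 ?andbT //; lra.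
have s10 : 0 <= s1 by exact: le_trans s0 (ltW ss1).
have [s2 /andP[s12 s2t] xs2] : exists2 s2, s1 < s2 < t & x s2 <> Some y.
  apply: contrapT => H; apply: nlim; exists (t - s1); first by rewrite subr_gt0.
  left=> r r0 /andP[r1 r2]; apply: contrapT => xr.
  by apply: H; exists r; rewrite ?r2 ?andbT //; lra.
have s20 : 0 <= s2 by exact: le_trans s10 (ltW s12).
have [//|//|e1 e10 He1] := clopen_right_open (clopen1 y) rx (t := s1).
have [//|//|e2 e20 He2] := clopen_right_open (clopenC (clopen1 y)) rx (t := s2).
(* One crossing is found before [s'], and the induction hypothesis supplies the others between [s']
   and [t], so that they are distinct. *)
pose s' := Num.min (s2 + e2) ((s2 + t) / 2).
have s2s' : s2 < s' by rewrite /s' lt_min; apply/andP; split; lra.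
have s't : s' < t by rewrite /s' gt_min; apply/orP; right; lra.
have s'e : s' <= s2 + e2 by rewrite /s' ge_min lexx.
have [|N1 HN1] := IH s'; first by rewrite s't andbT; lra.
(* A mesh finer than [e] has a point after [s1] where the path is still at [y], and later a point
   between [s2] and [s'] where it is not. *)
pose e := Num.min (Num.min e1 (s' - s2)) ((s2 - s1) / 2).
have e0 : 0 < e by rewrite /e !lt_min e10 /=; apply/andP; split; lra.
have e_e1 : e <= e1 by rewrite /e !ge_min lexx.
have e_s' : e <= s' - s2 by rewrite /e !ge_min lexx orbT.
have e_12 : e <= (s2 - s1) / 2 by rewrite /e !ge_min lexx orbT.
have [N2 HN2] := grid_up_near s10 e0; have [N3 HN3] := grid_up_near s20 e0.
exists (maxn N1 (maxn N2 N3)) => n; rewrite !geq_max => /and3P[/HN1[D [uD sD HD]] /HN2 g1 /HN3 g2].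
set i := (grid_index n s1).+1; set j := (grid_index n s2).+1.
have gmono a b : (a <= b)%N -> grid n a <= grid n b :> R.
  by move=> ab; rewrite /grid ler_wpM2r ?invr_ge0 // ler_nat.
have ij : (i <= j)%N.
  rewrite leqNgt; apply/negP => /ltnW/gmono; rewrite -/(grid_up n s1) -/(grid_up n s2).
  by case/andP: g1 => _ ?; case/andP: g2 => ? _; lra.
have [||k /andP[ik kj] [xk xk1]] := @discrete_crossing (fun k => x (grid n k) = Some y) i j ij.
- by apply: He1; case/andP: g1 => -> /=; rewrite /grid_up -/i; lra.
- by apply: He2; case/andP: g2 => -> /=; rewrite /grid_up -/j; lra.
- have gk1 : grid n k.+1 <= s'.
    by apply: le_trans (gmono _ _ kj) _; rewrite -/(grid_up n s2); case/andP: g2; lra.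
  have gk : s < grid n k.
    by apply: lt_le_trans (gmono _ _ ik); rewrite -/(grid_up n s1); case/andP: g1; lra.
  exists (k :: D); split.
  + rewrite /= uD andbT; apply/negP => /HD[kD _ _ _].
    by have := gmono _ _ (leqnSn k); lra.
  + by rewrite /= sD.
  + move=> l; rewrite inE => /orP[/eqP ->|/HD[l1 l2 l3 l4]]; first by split => //; lra.
    by split => //; lra.
Qed.

(** Unless the path stays at one point of the finite set [N v] just before [t], the left limits make
    it avoid [N v] there. From a rational time just before [t], it would then first enter [N v] at
    [v], which is excluded. *)
Lemma left_finite_of_left_limits x (N : V -> {fset V}) : right_cont x ->
  (forall y, left_limit y x) -> (forall v, v \in N v) ->
  (forall (q : rat) v, 0 <= ratr q :> R -> x (ratr q) <> Some v ->
     ~ exists2 t, first_hit (in_fset (N v)) x (ratr q) t & x t = Some v) ->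
  left_finite x.
Proof.
move=> rx lim NN noh t v t0 xt.
have [[y yN [e e0 H]]|none] := pselect (exists2 y, y \in N v & exists2 e, 0 < e &
    forall s, 0 <= s -> t - e < s < t -> x s = Some y).
  by exists [fset y]%fset, e => // s s0 /H -> //=; rewrite inE.
suff [e e0 He] : exists2 e, 0 < e & forall s, 0 <= s -> t - e < s < t -> ~ in_fset (N v) (x s).
  exfalso; have [|q /andP[q1 q2]] := @rat_between R (Num.max 0 (t - e)) t.
    by rewrite gt_max t0 /=; lra.
  move: q1; rewrite gt_max => /andP[q0 qe].
  apply: (noh q v (ltW q0)).
    by move=> xq; apply: (He (ratr q)); rewrite ?(ltW q0) ?qe ?q2 // xq /= NN.
  exists t => //; split; [exact: ltW|by rewrite xt /= NN|].
  by move=> r /andP[qr rt]; apply: He; [lra|rewrite rt andbT; lra].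
suff [e e0 He] : exists2 e, 0 < e & forall s, 0 <= s -> t - e < s < t ->
    forall y, y \in enum_fset (N v) -> x s <> Some y.
  by exists e => // s s0 /He - /(_ s0); case: (x s) => // y H /= yN; exact: (H y).
have : {subset enum_fset (N v) <= N v} by [].
elim: (enum_fset (N v)) => [|y r IH] sub; first by exists 1.
have [|e1 e10 He1] := IH; first by move=> u ur; apply: sub; rewrite inE ur orbT.
have [e2 e20 [He2|He2]] := lim y t t0.
  by case: none; exists y; [apply: sub; rewrite inE eqxx|exists e2].
exists (Num.min e1 e2); first by rewrite lt_min e10.
move=> s s0 /andP[s1 s2] u; rewrite inE => /orP[/eqP ->|ur].
  by apply: He2 => //; rewrite s2 andbT; move: s1; rewrite ltrBlDr -ltrBlDl lt_min; lra.
by apply: He1 => //; rewrite s2 andbT; move: s1; rewrite ltrBlDr -ltrBlDl lt_min; lra.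
Qed.

End crossings.

(** * First hitting distributions *)

Section hits.
Context {R : realType} {V : pointedType}.
Local Notation path := (R -> option V).
Implicit Types (x : path) (S a : set (option V)).

Definition hits S a : set path := [set x | exists2 t, first_hit S x 0 t & a (x t)].

Lemma first_hit_uniq S x s t u : first_hit S x s t -> first_hit S x s u -> t = u.
Proof. by move=> /first_hit_time <- /first_hit_time <-. Qed.

Lemma first_hit_cat S x s t u : s <= t -> (forall r, s <= r < t -> ~ S (x r)) ->
  first_hit S x s u <-> first_hit S x t u.
Proof.
move=> st nS; split=> -[su Su H]; split=> //.
- by rewrite leNgt; apply/negP => ut; apply: (nS u) => //; rewrite su.
- by move=> r /andP[tr ru]; apply: H; rewrite ru (le_trans st).
- exact: le_trans su.
- move=> r /andP[sr ru]; have [rt|tr] := ltP r t; first by apply: nS; rewrite sr.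
  by apply: H; rewrite tr.
Qed.

Lemma hits_shift S a x t : 0 <= t -> (forall r, 0 <= r < t -> ~ S (x r)) ->
  hits S a x <-> hits S a (shift_traj x t).
Proof.
move=> t0 nS; split=> -[u].
- move=> /(first_hit_cat u t0 nS) fu au; exists (u - t).
    by apply/first_hit_shift; rewrite addr0 subrKC.
  by rewrite /shift_traj subrKC.
- move=> /first_hit_shift; rewrite addr0 => fu au; exists (t + u) => //.
  exact/(first_hit_cat _ t0 nS).
Qed.

Lemma first_hit0 S x : S (x 0) -> first_hit S x 0 0.
Proof. by move=> S0; split => // r /andP[r0]; rewrite ltNge r0. Qed.

Lemma hits_start S a x : S (x 0) -> hits S a x <-> a (x 0).
Proof.
move=> S0; have f0 : first_hit S x 0 0 by exact: first_hit0.
split=> [[t ft]|a0]; last by exists 0.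
by rewrite (first_hit_uniq ft f0).
Qed.

Lemma path_event_hits (countV : countable [set: V]) (good : set path) S a :
  good `<=` right_cont -> clopen S -> path_events good (hits S a).
Proof.
move=> gr cS; have aP := @adapted_paths R V good.
have sG := ad_saG aP.
have oH := optional_hit countV gr aP cS (optional_const aP (lexx 0)).
have mb b := optional_mem aP (optional_state0 countV gr aP b oH).
apply: (@sa_mod _ _ sG (fun x => ~ good x) (fun x => 
   (a None /\ ([set w | [set: path] w /\ exists2 r, 0 <= r & S (w r)] `&` [set w | w (hit_time S w
       0) = None]) x) \/
   exists v, a (Some v) /\ ([set w | [set: path] w /\ exists2 r, 0 <= r & S (w r)] `&` [set w | w
       (hit_time S w 0) = Some v]) x)).
- by move=> E EN; apply: sub_sigma_algebra; right.
- apply: (sa_or sG).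
    by apply: (sa_and sG); [exact: (sa_const sG)|exact: mb].
  apply: (sa_exists sG countV) => v.
  by apply: (sa_and sG); [exact: (sa_const sG)|exact: mb].
- move=> x /contrapT/gr rx.
  have rS : right_open (~` S) x by apply: clopen_right_open rx; exact: clopenC.
  split.
  + move=> [[aN [[_ [r r0 Sr]] /= xN]]|[v [av [[_ [r r0 Sr]] /= xv]]]].
      by have [fh _] := first_hit_exists rS (lexx 0) r0 Sr; exists (hit_time S x 0); rewrite ?xN.
    by have [fh _] := first_hit_exists rS (lexx 0) r0 Sr; exists (hit_time S x 0); rewrite ?xv.
  + move=> [t ft]; have [t0 St _] := ft; rewrite -(first_hit_time ft).
    case E : (x (hit_time S x 0)) => [v|] av; [right; exists v|left].
      by split => //; split => //; split => //; exists t.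
    by split => //; split => //; split => //; exists t.
Qed.

End hits.

(** * First-step analysis for the reflected walk *)

Section walk_laws.
Context {R : realType} {V : pointedType} {G : network R V} {m : V -> R}.
Variables (X : V -> process R V).
Hypothesis m_gt0 : forall x, 0 < m x.
Hypothesis weight_gt0 : forall x, 0 < vweight G x.
Hypothesis hX : is_rwinf G m X.
Local Notation path := (R -> option V).
Local Notation P z := (pr_prob (X z)).
Local Notation tr z := (traj (X z)).
Local Notation nbr := (nbr G).

Let cV : countable [set: V] := countable_vertices G.

Lemma trans_prob_sum1 y : \sum_(v <- nbr y) trans_prob G y v = 1.
Proof. by rewrite /trans_prob -mulr_suml -vweightE divff // gt_eqF. Qed.

Lemma trans_probE_lap (f : V -> R) y :
  f y = \sum_(v <- nbr y) trans_prob G y v * f v <-> lap G f y = 0.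
Proof.
have w0 : vweight G y != 0 by rewrite gt_eqF.
have E : lap G f y = vweight G y * (f y - \sum_(v <- nbr y) trans_prob G y v * f v).
  rewrite mulrBr mulr_sumr {1}vweightE mulr_suml -sumrB; apply: eq_bigr => v _.
  by rewrite /trans_prob mulrA mulrCA divff // mulr1 mulrBr.
rewrite E; split=> [->|]; first by rewrite subrr mulr0.
by move=> /eqP; rewrite mulf_eq0 (negbTE w0) /= subr_eq0 => /eqP.
Qed.

Section modulo_bad.
Variable good : set path.
Hypothesis good_right : good `<=` right_cont.
Hypothesis good_shift : forall x s, 0 <= s -> good x -> good (shift_traj x s).
Hypothesis ae_good : forall z, {ae P z, forall w, good (tr z w)}.
Local Notation opt z := (optional (history (X z))).
Let aW := adapted_walk hX ae_good.
Let mE := measurable_path_event hX good_right good_shift ae_good.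
Let mS := measurable_shift_event hX good_right good_shift ae_good.

Definition plaw z (C : set path) : R := fine (law (X z) C).

Lemma plawE z C : path_events good C -> law (X z) C = (plaw z C)%:E.
Proof. by move=> gC; rewrite /plaw fineK //; exact/fin_num_measure/mE. Qed.

Lemma plaw_ge0 z C : 0 <= plaw z C. Proof. exact: fine_ge0. Qed.

Lemma plaw_ext z C C' : path_events good C -> path_events good C' ->
  (forall y, good y -> y 0 = Some z -> C y <-> C' y) -> plaw z C = plaw z C'.
Proof.
move=> gC gC' CC; rewrite /plaw /law; congr fine; apply: prob_ae_eq; [exact: mE|exact: mE|].
by apply: filterS2 (ae_good z) (rwinf_start hX z) => w gw w0; exact: CC.
Qed.

Lemma plaw_le z C C' : path_events good C -> path_events good C' ->
  (forall y, good y -> y 0 = Some z -> C y -> C' y) -> plaw z C <= plaw z C'.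
Proof.
move=> gC gC' CC; rewrite -lee_fin -!plawE // /law; apply: prob_le_ae; [exact: mE|exact: mE|].
by apply: filterS2 (ae_good z) (rwinf_start hX z) => w gw w0; exact: CC.
Qed.

Lemma path_event_const (Q : Prop) : path_events good [set _ | Q].
Proof. exact: (sa_const (path_events_sa good)). Qed.

Lemma plaw_const z (Q : Prop) : plaw z [set _ | Q] = (`[< Q >])%:R.
Proof.
rewrite /plaw /law; have [q|nq] := pselect Q.
  rewrite asboolT // (_ : _ @^-1` _ = setT) ?probability_setT //.
  by apply/seteqP; split.
rewrite asboolF // (_ : _ @^-1` _ = set0) ?measure0 //.
by apply/seteqP; split.
Qed.

(** Unlike [exit_set], the infimum admits time 0. The two agree almost surely for the walk from [z],
    and this form is covered by [optional_hit]. *)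
Definition exit_time z (x : path) : R := hit_time (~` [set Some z]) x 0.

Lemma ae_exit z : {ae P z, forall w, good (tr z w) /\ tr z w 0 = Some z /\
  (exists2 r, 0 <= r & (~` [set Some z]) (tr z w r)) /\
  inf (exit_set z (tr z w)) = exit_time z (tr z w) /\
  first_hit (~` [set Some z]) (tr z w) 0 (exit_time z (tr z w)) /\
  0 < exit_time z (tr z w)}.
Proof.
have [ex _ _ _] := rwinf_exit hX z.
have H : {ae P z, forall w, good (tr z w) /\ tr z w 0 = Some z}.
  by move: (ae_good z) (rwinf_start hX z); apply: filterS2 => w; split.
move: H ex; apply: filterS2 => w [gw w0] [e0 ez].
have rS : right_open (~` (~` [set Some z])) (tr z w).
  by rewrite setCK; case: (good_right gw).
have [fh _] := first_hit_exists rS (lexx 0) (ltW e0) ez.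
split=> //; split=> //; split; first by exists (inf (exit_set z (tr z w))); [exact: ltW|].
have [t0 nt lt] := fh; have tp : 0 < exit_time z (tr z w).
  rewrite lt_neqAle t0 andbT; apply/eqP => E; apply: nt.
  by rewrite -/(exit_time z _) -E.
split=> //; apply: inf_min; first by split.
move=> r [r0 nr]; rewrite leNgt; apply/negP => rt.
by apply: (lt r) => //; rewrite rt (ltW r0).
Qed.

Lemma exit_nbr z v : v \in nbr z ->
  P z ((fun w => tr z w (inf (exit_set z (tr z w)))) @^-1` [set Some v]) = (trans_prob G z v)%:E.
Proof. by have [_ _ _] := rwinf_exit hX z => H /mem_nbr; exact: H. Qed.

Let exB z : set (pr_space (X z)) :=
  [set w | [set: pr_space (X z)] w /\ exists2 r, 0 <= r & (~` [set Some z]) (tr z w r)].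

Let oexit z : opt z (@exB z) (fun w => exit_time z (tr z w)).
Proof.
apply: (optional_hit cV good_right (aW z)); first exact/clopenC/clopen1.
exact: (optional_const (aW z)).
Qed.

(** The prescribed probabilities of an exit to each neighbour add up to 1, which leaves none for an
    exit elsewhere, infinity included. *)
Lemma ae_exit_nbr z : {ae P z, forall w, in_fset (nbr z) (tr z w (exit_time z (tr z w)))}.
Proof.
have oS v := optional_state0 cV good_right (aW z) (Some v) (oexit z).
have mv v := optional_mem (aW z) (oS v).
have PE v : P z (@exB z `&` [set w | tr z w (exit_time z (tr z w)) = Some v]) =
    P z ((fun w => tr z w (inf (exit_set z (tr z w)))) @^-1` [set Some v]).
  have ae : {ae P z, forall w, (@exB z `&` [set w | tr z w (exit_time z (tr z w)) = Some v]) w <->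
      ((fun w => tr z w (inf (exit_set z (tr z w)))) @^-1` [set Some v]) w}.
    apply: filterS (ae_exit z) => w [_ [_ [ex [eT _]]]]; rewrite /= eT.
    by split=> [[]|].
  apply/esym/prob_complete_ae_eq; [exact: pr_complete|exact: mv|].
  by apply: filterS ae => w; tauto.
set E := [set w | exists2 v, v \in nbr z & (@exB z `&` [set w | tr z w (exit_time z (tr z w)) = Some v]) w].
have mEE : measurable E.
  rewrite (_ : E = \bigcup_(v in [set` nbr z]) (@exB z `&` [set w | tr z w (exit_time z (tr z w)) =
      Some v])).
    by apply: fin_bigcup_measurable => [|v _]; [exact: finite_fset|exact: mv].
  by apply/seteqP; split => w /= [v]; exists v.
suff PE1 : P z E = 1%E.
  apply: filterS (prob1_ae mEE PE1) => w [v vn [_ /= ->]] //.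
rewrite (@prob_fset_partition _ _ _ _ V (nbr z) (fun w => tr z w (exit_time z (tr z w)))) //.
- rewrite -[RHS](_ : (\sum_(v <- nbr z) (trans_prob G z v)%:E = 1)%E); last first.
    by rewrite sumEFin trans_prob_sum1.
  rewrite big_seq [RHS]big_seq; apply: eq_bigr => v vn; rewrite -exit_nbr // -PE.
  congr (P z _); apply/seteqP; split=> w /=.
    by move=> [[u un [ex eu]] ev].
  by move=> [ex ev]; split => //; exists v.
- move=> v; have [vn|vn] := boolP (v \in nbr z).
    rewrite (_ : _ `&` _ = @exB z `&` [set w | tr z w (exit_time z (tr z w)) = Some v]); first exact: mv.
    apply/seteqP; split=> w /=.
      by move=> [[u un [ex eu]] ev].
    by move=> [ex ev]; split => //; exists v.
  rewrite (_ : _ `&` _ = set0) //; apply/seteqP; split => // w /= [[u un [ex /= eu]]].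
  by rewrite eu => -[uv]; rewrite -uv un in vn.
- by apply: aeW => w [v vn [_ /= ->]].
Qed.

(* At the exit time from [z], the walk restarts from a neighbour chosen
   independently of the exit time. *)
Lemma exit_step z (U : set R) C : measurable U ->
  opt z (@exB z `&` [set w | U (exit_time z (tr z w))]) (fun w => exit_time z (tr z w)) ->
  path_events good C ->
  P z [set w | (@exB z `&` [set w | U (exit_time z (tr z w))]) w /\
               C (shift_traj (tr z w) (exit_time z (tr z w)))] =
  (exponential_prob (m z) U * (\sum_(v <- nbr z) trans_prob G z v * plaw v C)%:E)%E.
Proof.
move=> mU oU gC; set D := _ `&` _ in oU *.
have mD := optional_mem (aW z) oU.
have oS v := optional_state0 cV good_right (aW z) (Some v) oU.
have mDv v := optional_mem (aW z) (oS v).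
have PDv v : v \in nbr z -> P z (D `&` [set w | tr z w (exit_time z (tr z w)) = Some v]) =
    (exponential_prob (m z) U * (trans_prob G z v)%:E)%E.
  move=> vn; have [_ ind dist _] := rwinf_exit hX z.
  rewrite -exit_nbr // -dist // -ind //.
  have ae : {ae P z, forall w, (D `&` [set w | tr z w (exit_time z (tr z w)) = Some v]) w <->
      ((fun w => inf (exit_set z (tr z w))) @^-1` U `&`
       (fun w => tr z w (inf (exit_set z (tr z w)))) @^-1` [set Some v]) w}.
    apply: filterS (ae_exit z) => w [_ [_ [ex [e _]]]]; rewrite /D /exB /= e.
    by split=> [[[_ ?] ?]|[? ?]].
  apply/esym/prob_complete_ae_eq; [exact: pr_complete|exact: mDv|].
  by apply: filterS ae => w; tauto.
have mEv v : [set w | D w /\ C (shift_traj (tr z w) (exit_time z (tr z w)))] `&`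
     [set w | tr z w (exit_time z (tr z w)) = Some v] =
  [set w | (D w /\ tr z w (exit_time z (tr z w)) = Some v) /\ C (shift_traj (tr z w) (exit_time z
      (tr z w)))].
  by apply/seteqP; split=> w /=; tauto.
rewrite (@prob_fset_partition _ _ _ _ V (nbr z) (fun w => tr z w (exit_time z (tr z w)))).
- rewrite -sumEFin ge0_sume_distrr; last first.
    by move=> v _; rewrite lee_fin mulr_ge0 ?trans_prob_ge0 ?plaw_ge0.
  rewrite big_seq [RHS]big_seq; apply: eq_bigr => v vn.
  rewrite mEv (strong_markov_vertex hX good_right good_shift ae_good v oU gC).
  by rewrite [X in (X * _)%E]PDv // plawE // -muleA EFinM.
- exact: (mS oU gC).
- by move=> v; rewrite mEv; exact: (mS (oS v) gC).
- by apply: filterS (ae_exit_nbr z).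
Qed.

Lemma exponential_probT z : exponential_prob (m z) setT = 1%E.
Proof.
have [_ _ dist _] := rwinf_exit hX z; rewrite -dist //.
by rewrite preimage_setT probability_setT.
Qed.

(** The case [U = setT] of [exit_step]; it makes probabilities of events insensitive to the first
    holding time harmonic. *)
Lemma plaw_step z C C' : path_events good C -> path_events good C' ->
  (forall x t, good x -> x 0 = Some z -> 0 < t -> first_hit (~` [set Some z]) x 0 t ->
     C x <-> C' (shift_traj x t)) ->
  plaw z C = \sum_(v <- nbr z) trans_prob G z v * plaw v C'.
Proof.
move=> gC gC' CC; apply: EFin_inj; rewrite -plawE // -[RHS]mul1e -(exponential_probT z).
have oT : opt z (@exB z `&` [set w | setT (exit_time z (tr z w))]) (fun w => exit_time z (tr z w)).
  apply: (optional_ext (aW z) (oexit z)); first by move=> w [/(proj1 (oexit z))].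
  by move=> w _; split => //; split => [|[]].
rewrite -exit_step //; apply: prob_ae_eq; [exact: mE|exact: (mS oT gC')|].
apply: filterS (ae_exit z) => w [gw [w0 [ex [_ [fh tp]]]]].
have := CC _ _ gw w0 tp fh; rewrite /exB /preimage /=; tauto.
Qed.

Lemma plaw_markov z v (B : set path) T C : optional (path_filtration good) B T ->
  path_events good C ->
  plaw z [set x | (B x /\ x (T x) = Some v) /\ C (shift_traj x (T x))] =
  plaw z [set x | B x /\ x (T x) = Some v] * plaw v C.
Proof.
move=> oB gC; have oP := optional_preimage (ae_good z) oB.
rewrite /plaw -fineM ?fin_num_measure //; last first.
- exact: mE.
- exact: (optional_mem (aW z) (optional_state0 cV good_right (aW z) (Some v) oP)).
congr fine; exact: (strong_markov_vertex hX good_right good_shift ae_good v oP gC).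
Qed.

Lemma plaw_hits_start S a z : S (Some z) -> clopen S -> plaw z (hits S a) = (`[< a (Some z) >])%:R.
Proof.
move=> Sz cS; rewrite -(plaw_const z); apply: plaw_ext.
- exact: path_event_hits.
- exact: path_event_const.
- by move=> x gx x0; rewrite hits_start x0.
Qed.

Lemma plaw_hits_step S a z : ~ S (Some z) -> clopen S ->
  plaw z (hits S a) = \sum_(v <- nbr z) trans_prob G z v * plaw v (hits S a).
Proof.
move=> nS cS; apply: plaw_step; try exact: path_event_hits.
move=> x t gx x0 t0 [_ _ H]; apply: hits_shift; first exact: ltW.
move=> r /H /= xr Sr; apply: nS; move: xr => /contrapT xr.
by rewrite -xr.
Qed.

(** For an indicator [phi], the expectation in [rwinf_hitting] is a hitting probability. *)
Lemma plaw_hits_min_energy (A A' : {fset V}) (h : V -> R) z : A != fset0 ->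
  min_energy_ext G A (fun v => (v \in A')%:R) h ->
  plaw z (hits (in_fset A) (in_fset A')) = h z.
Proof.
move=> A0 hmin; have [ae expE] := rwinf_hitting hX z A0 hmin.
have cA : clopen (in_fset A) by exists A; left.
have hitE (x : path) : inf (hit_set A x) = hit_time (in_fset A) x 0.
  congr inf; apply/seteqP; split=> t /= [t0].
    by move=> [a aA ->].
  by case E : (x t) => [a|] // aA; split=> //; exists a.
pose E := [set w | in_fset A' (tr z w (inf (hit_set A (tr z w))))].
have EE : (fun w => extend0 (fun v => (v \in A')%:R) (tr z w (inf (hit_set A (tr z w))))) = \1_E :>
    (_ -> R).
  apply/funext => w; rewrite indicE /E; case xw : (tr z w _) => [v|] /=.
    by congr (nat_of_bool _)%:R; apply/idP/idP; rewrite inE /= xw.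
  by rewrite memNset //= xw.
have aeE : {ae P z, forall w, E w <-> (tr z @^-1` hits (in_fset A) (in_fset A')) w}.
  apply: filterS2 ae (ae_good z) => w [t0 [b bA xb]] gw.
  have rS : right_open (~` in_fset A) (tr z w) by case: (good_right gw).
  have Ab : in_fset A (tr z w (inf (hit_set A (tr z w)))) by rewrite xb.
  have [fh _] := first_hit_exists rS (lexx 0) t0 Ab.
  split; first by rewrite /E /= hitE => ?; exists (hit_time (in_fset A) (tr z w) 0).
  by move=> [t ft]; rewrite -(first_hit_time ft) /E /= hitE.
have gH := path_event_hits cV (in_fset A') good_right cA.
have mEE : measurable E by apply: measurable_ae_eq aeE; [exact: pr_complete|exact: mE].
apply: EFin_inj; rewrite -expE EE expectation_indic // -plawE // /law.
by apply: prob_ae_eq; [exact: mE| |apply: filterS aeE => w; tauto].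
Qed.

Lemma exponential_prob_co_le z s : 0 < s -> (exponential_prob (m z) `[0%R, s[ <= (m z * s)%:E)%E.
Proof.
move=> s0; apply: (@le_trans _ _ (exponential_prob (m z) `[0%R, s])).
  apply: le_measure; rewrite ?inE //; try exact: measurable_itv.
  by move=> r /=; rewrite !in_itv /= => /andP[-> /ltW].
rewrite exponential_prob_itv0c // lee_fin.
by have := expR_ge1Dx (- m z * s); lra.
Qed.

Let oexit_lt z s : opt z (@exB z `&` [set w | `[0, s[%classic (exit_time z (tr z w))]) (fun w =>
    exit_time z (tr z w)).
Proof.
have [T0 FT] := oexit z; apply: (optional_and (aW z) (oexit z)) => t.
have sF := ad_sa (aW z) t.
have [st|ts] := leP s t.
  apply: (sa_ext sF (P := fun w => @exB z w /\ exit_time z (tr z w) < s)).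
    exact: (ad_mono (aW z) st (FT s)).
  move=> w; rewrite /= in_itv /=; split=> [[Bw Ts]|[/andP[_ Ts] [Bw _]]]; last by split.
  by rewrite (T0 w Bw) Ts; split => //; split => //; exact: lt_le_trans st.
apply: (sa_ext sF (FT t)) => w; rewrite /= in_itv /=; split=> [[Bw Tt]|[_ //]].
by rewrite (T0 w Bw) (lt_trans Tt ts).
Qed.

Lemma prob_exit_lt z s : 0 < s ->
  measurable (@exB z `&` [set w | `[0, s[%classic (exit_time z (tr z w))]) /\
  P z (@exB z `&` [set w | `[0, s[%classic (exit_time z (tr z w))]) = exponential_prob (m z) `[0%R, s[.
Proof.
move=> s0; have mD := optional_mem (aW z) (oexit_lt z s); split => //.
have [_ _ dist _] := rwinf_exit hX z; rewrite -dist; last exact: measurable_itv.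
apply/esym/prob_complete_ae_eq; [exact: pr_complete|exact: mD|].
apply: filterS (ae_exit z) => w [_ [_ [ex [eT _]]]]; rewrite /= eT.
by rewrite /exB /=; tauto.
Qed.

Lemma plaw_leave_le z s : 0 < s -> plaw z [set x | x s <> Some z] <= m z * (2 * s).
Proof.
move=> s0; have gs : path_events good [set x | x s <> Some z].
  apply: (sa_not (path_events_sa good)); apply: sub_sigma_algebra; left; exists s, (Some z).
  by split => //; exact: ltW.
(* The exit takes place at a time at most [s], whereas the available bound is for a half-open
   interval, whence the doubling. *)
have s20 : 0 < 2 * s by rewrite mulr_gt0.
have [mD PD] := prob_exit_lt z s20.
rewrite -lee_fin -plawE //; apply: le_trans (exponential_prob_co_le z s20).
rewrite -PD; apply: prob_le_ae => //; first exact: mE.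
apply: filterS (ae_exit z) => w [gw [w0 [ex [_ [[t0 _ H] _]]]]] /= xs.
split; first by split.
rewrite in_itv /= t0 ltNge; apply/negP => st.
by apply: (H s) => //; rewrite (ltW s0) /= (lt_le_trans _ st) //; lra.
Qed.

(** The factor [m z * s] bounds the probability of an exit before [s]; it multiplies the sum because
    the exit time and the exit position are independent. *)
Lemma plaw_exit_lt z s C C' : 0 < s -> path_events good C -> path_events good C' ->
  (forall x, good x -> x 0 = Some z -> C x -> exists2 t, 0 < t < s &
     first_hit (~` [set Some z]) x 0 t /\ C' (shift_traj x t)) ->
  plaw z C <= m z * s * \sum_(v <- nbr z) trans_prob G z v * plaw v C'.
Proof.
move=> s0 gC gC' CC; rewrite -lee_fin -plawE // EFinM.
apply: (@le_trans _ _ (P z [set w | (@exB z `&` [set w | `[0, s[%classic (exit_time z (tr z w))]) w /\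
               C' (shift_traj (tr z w) (exit_time z (tr z w)))])).
  apply: prob_le_ae; [exact: mE|exact: (mS (oexit_lt z s) gC')|].
  apply: filterS (ae_exit z) => w [gw [w0 [ex [_ [fh t0]]]]] /= Cw.
  have [t /andP[t1 t2] [ft C't]] := CC _ gw w0 Cw.
  have te : exit_time z (tr z w) = t by exact: first_hit_time.
  split; last by rewrite te.
  by split; [split|rewrite in_itv /= te (ltW t1)].
rewrite (exit_step (measurable_itv _) (oexit_lt z s) gC').
apply: lee_wpmul2r; last exact: exponential_prob_co_le.
by rewrite lee_fin; apply: sumr_ge0 => v _; rewrite mulr_ge0 ?trans_prob_ge0 ?plaw_ge0.
Qed.

End modulo_bad.
End walk_laws.

Lemma ae_forall_countable d (T : measurableType d) (R : realType) (P : probability T R)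
  (J : choiceType) (Q : J -> T -> Prop) : countable [set: J] ->
  (forall j, {ae P, forall w, Q j w}) -> {ae P, forall w, forall j, Q j w}.
Proof.
move=> /pfcard_geP[J0|[f]] H.
  by apply: aeW => w j; have : [set: J] j by []; rewrite J0.
have {}H : {ae P, forall w, forall n, Q (f n) w} by apply: ae_foralln => n; exact: H.
apply: filterS H => w Hw j; have [n _ fn] := 'surj_f (Logic.I : [set: J] j).
by rewrite -fn; exact: Hw.
Qed.

Lemma negligible_small d (T : measurableType d) (R : realType) (P : probability T R)
  (A : set T) (c : R) :
  (forall M : nat, exists2 E, measurable E & A `<=` E /\ (P E <= (c / M.+1%:R)%:E)%E) ->
  P.-negligible A.
Proof.
move=> H; have /choice[E HE] : forall M : nat, exists E, measurable E /\ (A `<=` E /\ (P E <= (c /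
    M.+1%:R)%:E)%E).
  by move=> M; have [E ? ?] := H M; exists E.
have mI : measurable (\bigcap_M E M).
  by apply: bigcapT_measurable => M; case: (HE M).
exists (\bigcap_M E M); split => //; last by move=> w Aw M _; case: (HE M) => _ [/(_ w Aw)].
apply/eqP; rewrite eq_le measure_ge0 andbT; apply/lee_addgt0Pr => e e0; rewrite add0e.
have [c0|c0] := leP c 0.
  apply: (@le_trans _ _ (P (E 0%N))).
    by apply: le_measure; rewrite ?inE //; [case: (HE 0%N)|exact: bigcap_inf].
  case: (HE 0%N) => _ [_ /le_trans]; apply; rewrite lee_fin divr1; exact: le_trans (ltW e0).
have ec : 0 < e / c by rewrite divr_gt0.
have [N /(_ N (leqnn N)) HN] := invn_lt ec.
apply: (@le_trans _ _ (P (E N))).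
  by apply: le_measure; rewrite ?inE //; [case: (HE N)|exact: bigcap_inf].
case: (HE N) => _ [_ /le_trans]; apply; rewrite lee_fin.
by rewrite mulrC -ler_pdivlMr // ltW.
Qed.

(** The prescribed values fix the gradient along the edges at [v], and the Dirac function has no
    gradient elsewhere. Hence a walk from another vertex almost surely does not enter [v] before a
    neighbour of [v]. *)
Lemma min_energy_ext_dirac (R : realType) (V : pointedType) (G : network R V) v :
  min_energy_ext G (v |` nbr G v)%fset (fun u => (u \in [fset v]%fset)%:R) (@dirac_at R V v).
Proof.
split=> [x _|g gA]; first by rewrite /dirac_at inE.
have g1 u : u \in (v |` nbr G v)%fset -> g u = (u == v)%:R by move=> /gA ->; rewrite inE.
rewrite !energyE; apply: le_esum => e ee; rewrite lee_fin.
have [ve|ve] := boolP (v \in e); last first.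
  rewrite {1}/edge_form big1_seq ?mul0r ?mulr0; first exact: edge_form_ge0.
  move=> a /andP[_ ae]; rewrite big1_seq // => b /andP[_ be]; rewrite /dirac_at.
  have nv c : c \in e -> (c == v) = false by move=> ce; apply: contraNF ve => /eqP <-.
  by rewrite !nv // subrr mulr0.
have eA u : u \in e -> u \in (v |` nbr G v)%fset.
  move=> ue; rewrite !inE; case: (eqVneq u v) => //= uv.
  apply/mem_nbr; have [x [y [xy eE]]] := edge_pair ee; rewrite /adj.
  suff <- : e = [fset v; u]%fset by [].
  rewrite eE in ve ue *; move: ve ue; rewrite !inE.
  move=> /orP[/eqP vE|/eqP vE] /orP[/eqP uE|/eqP uE]; rewrite ?vE ?uE ?eqxx // in uv *.
  by rewrite fsetUC.
rewrite le_eqVlt; apply/orP; left; apply/eqP; rewrite /edge_form; congr (_ * (_ / _)).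
apply: eq_big_seq => a ae; apply: eq_big_seq => b be.
by rewrite /dirac_at -!g1 ?eA.
Qed.

(** * Almost every trajectory is a good path *)

Section good_paths_ae.
Context {R : realType} {V : pointedType} {G : network R V} {m : V -> R}.
Variables (X : V -> process R V).
Hypothesis m_gt0 : forall x, 0 < m x.
Hypothesis hX : is_rwinf G m X.
Local Notation path := (R -> option V).
Local Notation P z := (pr_prob (X z)).
Local Notation tr z := (traj (X z)).
Local Notation nbr := (nbr G).
Let cV : countable [set: V] := countable_vertices G.
Let gr : right_cont `<=` (@right_cont R V). Proof. by []. Qed.
Let gs := @right_cont_shift R V.
Let ag := ae_right_cont hX.
Let aW := adapted_walk hX ag.

Lemma prob_grid_crossing z y n k :
  measurable [set w | tr z w (grid n k) = Some y /\ tr z w (grid n k.+1) <> Some y] /\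
  (P z [set w | tr z w (grid n k) = Some y /\ tr z w (grid n k.+1) <> Some y] <=
   (m y * (2 * n.+1%:R^-1))%:E)%E.
Proof.
have n0 : (0 : R) < n.+1%:R^-1 by rewrite invr_gt0.
have gC : path_events (@right_cont R V) [set x | x n.+1%:R^-1 <> Some y].
  apply: (sa_not (path_events_sa _)); apply: sub_sigma_algebra; left.
  by exists n.+1%:R^-1, (Some y); split => //; exact: ltW.
have sM := @sigma_algebra_measurable _ (pr_space (X z)).
split.
  apply: (sa_and sM); first exact/(rwinf_meas hX)/grid_ge0.
  by apply: (sa_not sM); exact/(rwinf_meas hX)/grid_ge0.
have := markov_event hX gr gs ag y (grid_ge0 n k)
  (sa_const (history_sa (X z) (grid n k)) True) gC.
rewrite (_ : [set w | (True /\ _) /\ _] = [set w | tr z w (grid n k) = Some y /\ tr z w (grid n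
    k.+1) <> Some y]); last first.
  by apply/seteqP; split=> w; rewrite /shift_traj /= -gridS; tauto.
move=> ->; rewrite (plawE hX gr gs ag) //.
rewrite -[leRHS]mul1e; apply: lee_pmul => //.
- by rewrite lee_fin plaw_ge0.
- apply: probability_le1; apply: (sa_and sM); first exact: (sa_const sM).
  exact/(rwinf_meas hX)/grid_ge0.
- by rewrite lee_fin; exact: (plaw_leave_le m_gt0 hX gr gs ag).
Qed.

(** Up to time [T] the expected number of exits from [y] seen on a grid is at most [2 * T * m y],
    whatever the mesh. A missing left limit forces [M.+1] of them on all fine grids, and Markov's
    inequality applies for every [M]. *)
Lemma ae_left_limit z y : {ae P z, forall w, left_limit y (tr z w)}.
Proof.
pose lim (x : path) t := exists2 eps, 0 < eps &
  (forall s, 0 <= s -> t - eps < s < t -> x s = Some y) \/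
  (forall s, 0 <= s -> t - eps < s < t -> x s <> Some y).
suff H (T : nat) : {ae P z, forall w, forall t, 0 < t <= T%:R -> lim (tr z w) t}.
  have : {ae P z, forall w, forall T : nat, forall t, 0 < t <= T%:R -> lim (tr z w) t}.
    exact: ae_foralln.
  apply: filterS => w Hw t t0; apply: (Hw (Num.truncn t).+1).
  by rewrite t0 /= ltW //; have /andP[] := truncn_itv (ltW t0).
suff : {ae P z, forall w, right_cont (tr z w) -> forall t, 0 < t <= T%:R -> lim (tr z w) t}.
  by move: (ag z); apply: filterS2 => w rx; apply.
pose c n k := [set w | tr z w (grid n k) = Some y /\ tr z w (grid n k.+1) <> Some y].
have mc n k : measurable (c n k) by case: (prob_grid_crossing z y n k).
have sum_c n : ((\sum_(k <- iota 0 (T * n.+1)) P z (c n k))%R <= (2 * T%:R * m y)%:E)%E.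
  apply: (@le_trans _ _ (\sum_(k <- iota 0 (T * n.+1)) (m y * (2 * n.+1%:R^-1))%:E)%R).
    by apply: lee_sum => k _; case: (prob_grid_crossing z y n k).
  rewrite sumEFin lee_fin big_const_seq count_predT size_iota iter_addr_0 -[leLHS]mulr_natl natrM.
  have n0 : n.+1%:R != 0 :> R by [].
  by rewrite le_eqVlt; apply/orP; left; apply/eqP; field.
pose Ev M n := [set w | (M <= count (fun k => `[< c n k w >]) (iota 0 (T * n.+1)))%N].
have mEv M n : measurable (Ev M n) by case: (prob_count_le M (mc n) (sum_c n)).
apply: (@negligible_small _ _ _ _ _ (2 * T%:R * m y)) => M.
exists [set w | exists N, forall n, (N <= n)%N -> Ev M.+1 n w]; first exact: measurable_eventually.
split; last first.
  apply: prob_eventually_le => // n; case: (prob_count_le M.+1 (mc n) (sum_c n)) => _.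
  rewrite -/(Ev M.+1 n); have fE := fin_num_measure (P z) _ (mEv M.+1 n).
  by rewrite -(fineK fE) -EFinM !lee_fin ler_pdivlMr // mulrC.
move=> w /= /not_implyP[rx /existsNP[t /not_implyP[/andP[t0 tT] nl]]].
have [|N HN] := crossing_count rx t0 nl M.+1 (s := 0); first by rewrite lexx.
exists N => n /HN[D [uD sD HD]].
rewrite /Ev /= -sD -size_filter; apply: uniq_leq_size => // k kD.
have [k1 k2 k3 k4] := HD k kD; rewrite mem_filter; apply/andP; split; first exact/asboolP.
rewrite mem_iota /= add0n -(ltr_nat R) natrM.
have : k%:R < T%:R * n.+1%:R :> R; last by [].
rewrite -ltr_pdivrMr //; apply: lt_le_trans tT.
by apply: le_lt_trans k2; rewrite gridS -/(grid n k) lerDl invr_ge0.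
Qed.

(** By the Markov property at rational times, entering [v] before its neighbours from another vertex
    has probability 0; this is the exclusion that [left_finite_of_left_limits] asks for. *)
Lemma ae_good_path z : {ae P z, forall w, good_path (tr z w)}.
Proof.
pose N v := (v |` nbr v)%fset.
have cN v : clopen (in_fset (N v)) by exists (N v); left.
have gH v := path_event_hits cV (in_fset [fset v]%fset) gr (cN v).
have h0 u v : u != v -> plaw X u (hits (in_fset (N v)) (in_fset [fset v]%fset)) = 0.
  move=> uv; rewrite (plaw_hits_min_energy hX gr gs ag u _ (min_energy_ext_dirac G v)).
    by rewrite /dirac_at (negbTE uv).
  by apply/fset0Pn; exists v; rewrite !inE eqxx.
have H1 : {ae P z, forall w, forall (q : rat) v u, ~ [/\ 0 <= ratr q :> R, u != v, tr z w (ratr q)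
    = Some u &
    hits (in_fset (N v)) (in_fset [fset v]%fset) (shift_traj (tr z w) (ratr q))]}.
  apply: ae_forall_countable => [|q]; first exact: countableP.
  apply: ae_forall_countable => // v; apply: ae_forall_countable => // u.
  have [q0|q0] := boolP (0 <= ratr q :> R); last first.
    by apply: aeW => w [].
  have [uv|uv] := boolP (u != v); last by apply: aeW => w [].
  have E := markov_event hX gr gs ag u q0 (sa_const (history_sa (X z) (ratr q)) True) (gH v).
  rewrite (plawE hX gr gs ag) // h0 // mule0 in E.
  have mF : measurable [set w | (True /\ tr z w (ratr q) = Some u) /\
      hits (in_fset (N v)) (in_fset [fset v]%fset) (shift_traj (tr z w) (ratr q))].
    have oC := optional_state0 cV gr (aW z) (Some u) (optional_const (aW z) q0).
    by have := measurable_shift_event hX gr gs ag oC (gH v).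
  have := prob0_ae mF E; apply: filterS => w nH [_ _ H2 H3].
  by apply: nH; split.
have H2 : {ae P z, forall w, forall q : rat, 0 <= ratr q :> R -> exists u, tr z w (ratr q) = Some u}.
  apply: ae_forall_countable => [|q]; first exact: countableP.
  have [q0|q0] := boolP (0 <= ratr q :> R); last by apply: aeW => w.
  by have := ae_vertex hX z q0; apply: filterS => w.
have H3 : {ae P z, forall w, forall y, left_limit y (tr z w)}.
  by apply: ae_forall_countable => // y; exact: ae_left_limit.
have H4 : {ae P z, forall w, right_cont (tr z w) /\ forall y, left_limit y (tr z w)}.
  by move: (ag z) H3; apply: filterS2.
move: H4 H1 H2; apply: filterS3 => w [rx ll] n1 n2.
split => //; apply: (left_finite_of_left_limits rx ll (N := N)) => [v|q v q0 qv [t ft xt]].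
  by rewrite !inE eqxx.
have [u xu] := n2 q q0; apply: (n1 q v u); split => //.
  by apply/negP => /eqP uv; apply: qv; rewrite xu uv.
exists (t - ratr q); last by rewrite /shift_traj subrKC xt /= inE.
by apply/first_hit_shift; rewrite addr0 subrKC.
Qed.

End good_paths_ae.

(** * Reaching a finite set before or after infinity *)

Section optional_lt.
Context {R : realType} {V : pointedType} (good : set (R -> option V)) (Om : Type).
Variables (X : Om -> R -> option V) (F : R -> set (set Om)) (G : set (set Om)).
Hypothesis adF : adapted good X F G.

Lemma optional_lt (B : set Om) (T : Om -> R) s : optional F B T ->
  optional F (B `&` [set w | T w < s]) T.
Proof.
move=> oB; have [_ FT] := oB; apply: (optional_and adF oB) => t.
have sF := ad_sa adF t; have [st|/ltW ts] := leP s t.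
  apply: (sa_ext sF (ad_mono adF st (FT s))) => w /=; split=> [[Bw Ts]|[Ts [Bw _]]] //.
  by split => //; split => //; exact: lt_le_trans st.
apply: (sa_ext sF (FT t)) => w /=; split=> [[Bw Tt]|[_ //]].
by split => //; exact: lt_le_trans ts.
Qed.

End optional_lt.

Section reaching.
Context {R : realType} {V : pointedType}.
Local Notation path := (R -> option V).
Implicit Types (x : path) (A K : {fset V}).

Definition reach A A' : set path :=
  [set x | exists t, [/\ first_hit (in_fset A) x 0 t, in_fset A' (x t) &
     forall s, 0 <= s <= t -> x s <> None]].

(** Stopping on leaving the finite set [K \ A] gives a clopen target; hitting it in a subset of [A]
    means reaching that subset without leaving [K] before, hence before infinity. *)
Definition leave A K : set (option V) := ~` in_fset (K `\` A)%fset.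

Lemma clopen_leave A K : clopen (leave A K).
Proof. by exists (K `\` A)%fset; right. Qed.

Lemma leaveE A K v : leave A K (Some v) <-> v \notin K \/ v \in A.
Proof.
rewrite /leave /= inE; split=> [/negP|[vK|vA]].
- by rewrite negb_and negbK => /orP[]; [right|left].
- by rewrite (negbTE vK) andbF.
- by rewrite vA.
Qed.

Lemma hits_leave_reach A A' K x : (A' `<=` A)%fset ->
  hits (leave A K) (in_fset A') x -> reach A A' x.
Proof.
move=> /fsubsetP AA [t [t0 St H] xt]; exists t; split=> //.
- split=> //; first by case: (x t) xt => //= v /AA.
  move=> r /H; rewrite /leave /= => /contrapT.
  by case: (x r) => //= v; rewrite inE => /andP[/negP].
- move=> s /andP[s0 st] xs; have [se|ne] := eqVneq s t.
    by rewrite -se xs in xt.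
  apply: (H s); first by rewrite s0 lt_neqAle ne st.
  by rewrite xs.
Qed.

Lemma hits_leaveS A A' K K' x : (A' `<=` A)%fset -> (K `<=` K')%fset ->
  hits (leave A K) (in_fset A') x -> hits (leave A K') (in_fset A') x.
Proof.
move=> /fsubsetP AA /fsubsetP KK [t [t0 St H] xt]; exists t => //; split=> //.
  by case: (x t) xt => //= v /AA vA; apply/leaveE; right.
move=> r /H; rewrite /leave /= => /contrapT rK; apply.
by case: (x r) rK => //= v; rewrite !inE => /andP[-> /KK].
Qed.

(** Up to the hitting time the path avoids infinity, so by [finite_range] it stays in some [K n]. *)
Lemma reach_hits_leave A A' (K : nat -> {fset V}) x : good_path x ->
  (forall n k, (n <= k)%N -> (K n `<=` K k)%fset) -> (forall B, exists n, (B `<=` K n)%fset) ->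
  (A' `<=` A)%fset -> reach A A' x ->
  exists N, forall n, (N <= n)%N -> hits (leave A (K n)) (in_fset A') x.
Proof.
move=> gx KS KA AA [t [[t0 At H] xt xV]].
have [B HB] := finite_range gx t0 xV; have [N /fsubsetP BN] := KA B.
exists N => n /KS Nn; apply: (hits_leaveS AA Nn); exists t => //; split=> //.
  by case: (x t) xt => //= v /(fsubsetP AA) vA; apply/leaveE; right.
move=> r /andP[r0 rt]; have nA := H r; rewrite r0 rt in nA; have {}nA := nA isT.
have := HB r; rewrite r0 (ltW rt) => /(_ isT); rewrite /leave /=.
case: (x r) nA => //= v vA /BN vK; apply; rewrite inE vK andbT.
exact/negP.
Qed.

(* The walk visits [B] after an excursion from [o] that starts at a grid time
   preceding the exit from [o] by less than [2 / n.+1]. *)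
Lemma hits_before_visit (o : V) (B : {fset V}) x t : right_cont x -> x 0 = Some o ->
  left_limit o x -> o \notin B -> 0 <= t -> in_fset B (x t) ->
  exists N, forall n, (N <= n)%N -> exists k, [/\ grid n k < t, x (grid n k) = Some o &
    exists2 u, 0 < u < 2 * n.+1%:R^-1 & first_hit (~` [set Some o]) (shift_traj x (grid n k)) 0 u /\
      hits (in_fset (o |` B)%fset) (in_fset B) (shift_traj (shift_traj x (grid n k)) u)].
Proof.
move=> rx x0 ll oB t0 xt.
have xto : x t <> Some o by move=> E; rewrite E /= (negbTE oB) in xt.
(* The supremum of [E] is the end of the last stay at [o] before [t]: by right-continuity the path
   is no longer at [o] then, and by the left limit it is at [o] just before. *)
pose E := [set s | 0 <= s <= t /\ x s = Some o].
have E0 : E 0 by split=> //; rewrite lexx.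
have hE : has_sup E by split; [exists 0|exists t => s [/andP[]]].
set S := sup E.
have S0 : 0 <= S by apply: ub_le_sup => //; case: hE.
have St : S <= t by apply: ge_sup; [exists 0|move=> s [/andP[]]].
have afterS r : S < r -> r <= t -> x r <> Some o.
  move=> Sr rt xr; suff : r <= S by lra.
  by apply: ub_le_sup; [case: hE|split=> //; rewrite rt andbT; lra].
have xS : x S <> Some o.
  move=> xS; have St' : S < t.
    by rewrite lt_neqAle St andbT; apply/eqP => SE; apply: xto; rewrite -SE.
  have [//|e e0 He] := rx.1 o S S0.
  have d0 : 0 < Num.min e (t - S) by rewrite lt_min e0 subr_gt0.
  have me : Num.min e (t - S) <= e by rewrite ge_min lexx.
  have mt : Num.min e (t - S) <= t - S by rewrite ge_min lexx orbT.
  apply: (afterS (S + Num.min e (t - S))); [by rewrite ltrDl|by lra|].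
  by apply: He; apply/andP; split; lra.
have Sp : 0 < S.
  by rewrite lt_neqAle S0 andbT; apply/eqP => SE; apply: xS; rewrite -SE.
have [e e0 [He|He]] := ll S Sp; last first.
  have [s [/andP[s0 st] xs] se] := sup_adherent e0 hE.
  exfalso; apply: (He s s0 _ xs); rewrite -/S in se; rewrite se /= lt_neqAle.
  apply/andP; split; first by apply/eqP => sS; apply: xS; rewrite -sS.
  by apply: ub_le_sup; [case: hE|split=> //; rewrite s0].
have rA : right_open (~` in_fset (o |` B)%fset) x by case: rx.
have xtA : in_fset (o |` B)%fset (x t) by case: (x t) xt => //= v vB; rewrite inE vB orbT.
have [[Sh Ah Hh] ht] := first_hit_exists rA S0 St xtA.
set h := hit_time _ x S in Sh Ah Hh ht.
have xho : x h <> Some o.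
  have [hS|hS] := eqVneq h S; first by rewrite hS.
  by apply: afterS => //; rewrite lt_neqAle eq_sym hS.
have xhB : in_fset B (x h).
  by case: (x h) Ah xho => //= v; rewrite !inE => /orP[/eqP ->|].
have [N HN] := invn_lt e0; exists N => n /HN ne.
have n0 : (0 : R) < n.+1%:R^-1 by rewrite invr_gt0.
(* The grid point has to be strictly before [S], where the path is still at [o]; if [S] is on the
   grid, the preceding point is taken. *)
have [k [gk1 gk2]] : exists k, grid n k < S /\ S <= grid n k.+1 :> R.
  have /(grid_indexP _ _ S0)/andP[g1 g2] := erefl (grid_index n S).
  have [gS|gS] := ltP (grid n (grid_index n S)) S; first by exists (grid_index n S); rewrite (ltW g2).
  have := g1; case: (grid_index n S) gS g1 => [|j] gS g1 _.
    by move: gS; rewrite /grid mul0r; lra.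
  by exists j; split=> //; apply: lt_le_trans g1; rewrite gridS ltrDl.
have gk3 := @gridS R n k; rewrite gk3 in gk2.
have g0 := @grid_ge0 R n k.
exists k; split.
- exact: lt_le_trans St.
- apply: He => //; rewrite gk1 andbT ltrBlDr; apply: le_lt_trans gk2 _; rewrite ltrD2l; exact: ne.
exists (S - grid n k).
  have n1 : n.+1%:R^-1 < 2 / n.+1%:R :> R by rewrite -[ltLHS]mul1r ltr_pM2r // ltr1n.
  apply/andP; split; first by rewrite subr_gt0.
  by apply: le_lt_trans n1; rewrite lerBlDl.
split.
- apply/first_hit_shift; rewrite addr0 subrKC; split=> //; first exact: ltW.
  move=> r /andP[r1 r2]; apply; apply: He; [lra|rewrite r2 andbT ltrBlDr].
  by apply: le_lt_trans gk2 _; apply: ler_ltD.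
- have -> : shift_traj (shift_traj x (grid n k)) (S - grid n k) = shift_traj x S.
    by apply/funext => r; rewrite /shift_traj addrA subrKC.
  exists (h - S); last by rewrite /shift_traj subrKC.
  by apply/first_hit_shift; rewrite addr0 subrKC.
Qed.

End reaching.

Section reach_optional.
Context {R : realType} {V : pointedType}.
Hypothesis countV : countable [set: V].
Local Notation path := (R -> option V).

Lemma first_hit_leave (A A' K : {fset V}) (x : path) t : (A' `<=` A)%fset ->
  first_hit (leave A K) x 0 t -> in_fset A' (x t) -> first_hit (in_fset A) x 0 t.
Proof.
move=> /fsubsetP AA [t0 _ H] xt; split=> //; first by case: (x t) xt => //= v /AA.
move=> r /H; rewrite /leave /= => /contrapT rK.
by case: (x r) rK => //= v; rewrite !inE => /andP[/negPf ->].
Qed.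

Context (Om : Type) (X : Om -> path) (F : R -> set (set Om)) (G : set (set Om)).
Hypothesis adF : adapted (@good_path R V) X F G.

(** On good paths the event is the union over an exhaustion of first hits of the clopen sets
    [leave A (K n)], which occur at the hitting time of [A]. *)
Lemma optional_reach (A A' : {fset V}) : (A' `<=` A)%fset ->
  optional F [set w | reach A A' (X w)] (fun w => hit_time (in_fset A) (X w) 0).
Proof.
move=> AA; split=> [w [t [[t0 xt H] _ _]]|t].
  by rewrite (first_hit_time (And3 t0 xt H)).
have [K [_ KS KA]] := fset_exhaustion fset0 countV.
have o0 := optional_const adF (lexx (0 : R)).
have oL n := optional_hit countV (@good_path_right R V) adF (@clopen_leave V A (K n)) o0.
have oS n v := optional_state0 countV (@good_path_right R V) adF (Some v) (oL n).
have sF := ad_sa adF t.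
apply: (sa_mod sF (N := fun w => ~ good_path (X w)) (P := fun w => exists n v, v \in A' /\
    ([set w | [set: Om] w /\ exists2 r, 0 <= r & leave A (K n) (X w r)] w /\
      X w (hit_time (leave A (K n)) (X w) 0) = Some v) /\ hit_time (leave A (K n)) (X w) 0 < t)).
- exact: (ad_bad adF).
- apply: (sa_exists sF); first exact: countableP.
  move=> n; apply: (sa_exists sF) => // v; apply: (sa_and sF); first exact: (sa_const sF).
  by case: (oS n v) => _; apply.
move=> w /contrapT gw; have rw := good_path_right gw; split.
- move=> [n [v [vA [[[_ [r r0 Lr]] xv] Tt]]]].
  have oC : right_open (~` leave A (K n)) (X w).
    by apply: clopen_right_open rw; apply: clopenC; exact: clopen_leave.
  have [fh _] := first_hit_exists oC (lexx 0) r0 Lr.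
  have xA : in_fset A' (X w (hit_time (leave A (K n)) (X w) 0)) by rewrite xv.
  rewrite (first_hit_time (first_hit_leave AA fh xA)); split=> //.
  by apply: (hits_leave_reach AA (K := K n)); exists (hit_time (leave A (K n)) (X w) 0).
- move=> [rx Tt]; have [N HN] := reach_hits_leave gw KS KA AA rx.
  have [u fu xu] := HN N (leqnn _).
  have uT := first_hit_time fu; exists N.
  case xE : (X w u) xu => [v|] //= vA; exists v; split=> //.
  rewrite uT xE; split; last by rewrite -(first_hit_time (first_hit_leave AA fu _)) ?xE.
  by split=> //; split=> //; case: fu => u0 Lu _; exists u.
Qed.

End reach_optional.

(** * The trajectory after its first visit to infinity *)

Section after_infinity.
Context {R : realType} {V : pointedType}.
Local Notation path := (R -> option V).
Implicit Types (x : path) (C : set path).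

Definition hits_infinity : set path := [set x | exists2 r, 0 <= r & x r = None].

Definition after_infinity C : set path :=
  [set x | hits_infinity x /\ C (shift_traj x (hit_infinity x))].

Lemma hit_infinity_first x : right_cont x -> hits_infinity x ->
  first_hit [set None] x 0 (hit_infinity x).
Proof.
move=> rx [r r0 xr].
by have [] := first_hit_exists (right_open_None rx) (lexx 0) r0 xr.
Qed.

Lemma hit_infinity_shift x t : right_cont x -> 0 <= t ->
  (forall r, 0 <= r < t -> x r <> None) -> hits_infinity x ->
  [/\ t <= hit_infinity x, hits_infinity (shift_traj x t) &
      hit_infinity x = t + hit_infinity (shift_traj x t)].
Proof.
move=> rx t0 xt ix; have fx := hit_infinity_first rx ix.
have th : t <= hit_infinity x.
  by rewrite leNgt; apply/negP => h; case: fx => h0 xN _; apply: (xt _ _ xN); rewrite h0.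
split=> //.
  by exists (hit_infinity x - t); rewrite ?subr_ge0 // /shift_traj subrKC; case: fx.
suff -> : hit_infinity (shift_traj x t) = hit_infinity x - t by rewrite subrKC.
apply: (@first_hit_time _ _ [set None]); apply/first_hit_shift; rewrite addr0 subrKC.
by apply/(first_hit_cat _ t0) => //; apply/negP.
Qed.

Lemma after_infinity_shift C x t : right_cont x -> 0 <= t ->
  (forall r, 0 <= r < t -> x r <> None) ->
  after_infinity C x <-> after_infinity C (shift_traj x t).
Proof.
move=> rx t0 xt.
have E : t + hit_infinity (shift_traj x t) = hit_infinity x ->
    shift_traj x (hit_infinity x) = shift_traj (shift_traj x t) (hit_infinity (shift_traj x t)).
  by move=> <-; apply/funext => s; rewrite /shift_traj addrA.
split=> -[ix Cx].
  by have [th it hE] := hit_infinity_shift rx t0 xt ix; split=> //; rewrite -E.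
have {}ix : hits_infinity x.
  by case: ix => r r0 xr; exists (t + r) => //; exact: addr_ge0.
by have [th it hE] := hit_infinity_shift rx t0 xt ix; split=> //; rewrite E.
Qed.

Lemma hits_after_infinity A A' x : good_path x -> hits_infinity x -> ~ reach A A x ->
  hits (in_fset A) (in_fset A') x <-> after_infinity (hits (in_fset A) (in_fset A')) x.
Proof.
move=> gx ix nr; have rx := good_path_right gx.
have [h0 xh hN] := hit_infinity_first rx ix.
have nA r : 0 <= r < hit_infinity x -> ~ in_fset A (x r).
  move=> /andP[r0 rh] xr.
  have oC : right_open (~` in_fset A) x by case: rx.
  have [fh hr] := first_hit_exists oC (lexx 0) r0 xr.
  apply: nr; exists (hit_time (in_fset A) x 0); split=> //; first by case: fh.
  by move=> s /andP[s0 sh]; apply: hN; rewrite s0 /= (le_lt_trans (le_trans sh hr)).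
rewrite (hits_shift _ h0 nA); by split=> [|[]].
Qed.

End after_infinity.

(** * Return probabilities of the random walk *)

Section return_probability.
Context {R : realType} {V : pointedType}.
Variables (G : network R V) (PRW : V -> probability (wpath V) R).
Hypothesis hRW : forall x, rw_law G x (PRW x).
Hypothesis htransient : transient PRW.
Local Notation nbr := (nbr G).

(** A vertex of weight 0 has no neighbour, so by connectedness it is the only vertex, and every path
    is back at time 1. *)
Lemma transient_weight_gt0 x : 0 < vweight G x.
Proof.
have w0 : 0 <= vweight G x by rewrite vweightE; apply: sumr_ge0 => y _; exact: cond_ge0.
rewrite lt_neqAle w0 andbT eq_sym; apply/eqP => vx.
have Vx y : y = x.
  apply: (@connected_ind _ _ G (fun y => y = x) x) => // a b ab ax; subst a.
  have bx : b \in nbr x by apply/mem_nbr.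
  move: vx; rewrite vweightE => /eqP; rewrite psumr_eq0 => [|v _]; last exact: cond_ge0.
  by move=> /allP/(_ b bx); rewrite gt_eqF ?cond_gt0.
have := htransient x; rewrite (_ : no_return _ = set0) ?measure0 ?ltxx //.
rewrite -subset0 => w /= /(_ 1%N isT).
by rewrite (Vx (w 1%N)) inE eqxx.
Qed.

Let sM := @sigma_algebra_measurable _ (wpath V).
Let w_gt0 := transient_weight_gt0.

Lemma measurable_coordinate i x : measurable [set w : wpath V | w i = x].
Proof. by apply: sub_sigma_algebra; exists i, x. Qed.

(** Probability that the random walk from [y] visits [z] within [k] steps, time 0 included. The
    recursion avoids a Markov property for [PRW], of which only the probabilities of finite paths
    are prescribed. *)
Fixpoint return_within z k y : R :=
  if y == z then 1 else
  if k is j.+1 then \sum_(v <- nbr y) trans_prob G y v * return_within z j v else 0.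

Lemma return_within_le z k y : 0 <= return_within z k y <= return_within z k.+1 y.
Proof.
elim: k y => [|k IH] y /=; case: eqP => _ //; first by rewrite ler01 lexx.
- rewrite lexx /=; apply: sumr_ge0 => v _; apply: mulr_ge0; first exact: trans_prob_ge0.
  by case: ifP.
- by rewrite ler01 lexx.
apply/andP; split.
  by apply: sumr_ge0 => v _; apply: mulr_ge0; [exact: trans_prob_ge0|case/andP: (IH v)].
by apply: ler_sum => v _; apply: ler_wpM2l; [exact: trans_prob_ge0|case/andP: (IH v)].
Qed.

Lemma return_within_le1 z k y : return_within z k y <= 1.
Proof.
elim: k y => [|k IH] y /=; case: eqP => _ //.
rewrite -(trans_prob_sum1 w_gt0 y); apply: ler_sum => v _.
by rewrite -[leRHS]mulr1; apply: ler_wpM2l => //; exact: trans_prob_ge0.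
Qed.

(** Induction on [k], extending the prescribed initial path by a neighbour of its last point. The
    inequality is all that the bound on returns requires. *)
Lemma return_within_prob z x k n (s : nat -> V) :
  ((((s 0%N == x)%:R * \prod_(i < n) trans_prob G (s i) (s i.+1)) *
    return_within z k (s n))%:E <=
  PRW x [set w | (forall i, (i <= n)%N -> w i = s i) /\
                 exists j, (n <= j <= n + k)%N /\ w j = z])%E.
Proof.
have mP l (t : nat -> V) : measurable [set w : wpath V | forall i, (i <= l)%N -> w i = t i].
  apply: (sa_forall sM); first exact: countableP.
  by move=> i; apply: (sa_imply sM); [exact: (sa_const sM)|exact: measurable_coordinate].
have mR l (t : nat -> V) j : measurable [set w : wpath V | (forall i, (i <= l)%N -> w i = t i) /\
                 exists i, (l <= i <= l + j)%N /\ w i = z].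
  apply: (sa_and sM); first exact: mP.
  apply: (sa_exists sM); first exact: countableP.
  by move=> i; apply: (sa_and sM); [exact: (sa_const sM)|exact: measurable_coordinate].
have here l (t : nat -> V) j : t l = z -> ((((t 0%N == x)%:R * \prod_(i < l) trans_prob G (t i) (t i.+1)) *
    1)%:E <= PRW x [set w | (forall i, (i <= l)%N -> w i = t i) /\
                 exists i, (l <= i <= l + j)%N /\ w i = z])%E.
  move=> tl; rewrite mulr1 -hRW; apply: le_measure; rewrite ?inE //.
  by move=> w H; split=> //; exists l; rewrite leqnn leq_addr H.
elim: k n s => [|k IH] n s /=; case: (s n =P z) => [sn|_]; [exact: here|by rewrite mulr0|exact: here|].
pose t v i := if (i <= n)%N then s i else v.
pose E v := [set w : wpath V | (forall i, (i <= n.+1)%N -> w i = t v i) /\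
                 exists i, (n.+1 <= i <= n.+1 + k)%N /\ w i = z].
apply: (@le_trans _ _ (PRW x (\bigcup_(v in [set` nbr (s n)]) E v))); last first.
  apply: le_measure; rewrite ?inE //.
    by apply: fin_bigcup_measurable => // v _; exact: mR.
  move=> w [v _ [H [j [jn wj]]]]; split.
    by move=> i ni; rewrite H ?leqW // /t ni.
  by exists j; move: jn; rewrite addSnnS => /andP[/ltnW -> ->].
rewrite bigcup_fset measure_fbigsetU; last 2 first.
- by move=> v _; exact: mR.
- move=> u v _ _ [w [[Hu _] [Hv _]]].
  by have := Hu n.+1 (leqnn _); rewrite (Hv n.+1 (leqnn _)) /t ltnn.
rewrite mulr_sumr -sumEFin; apply: lee_sum => v _.
apply: le_trans (IH n.+1 (t v)); rewrite big_ord_recr /= /t leqnn ltnn leq0n !mulrA.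
rewrite [in leRHS](eq_bigr (fun i : 'I_n => trans_prob G (s i) (s i.+1))) => [|i _]; first exact: lexx.
by rewrite ltn_ord ltnW.
Qed.

Lemma measurable_no_return z : measurable (no_return [fset z]%fset : set (wpath V)).
Proof.
apply: (sa_forall sM); first exact: countableP.
move=> n; apply: (sa_imply sM); first exact: (sa_const sM).
apply: (sa_ext sM (P := fun w => ~ (w n = z))).
  by apply: (sa_not sM); exact: measurable_coordinate.
by move=> w; split => [/eqP|/negP H wz]; [rewrite inE|apply: H; rewrite wz inE].
Qed.

Lemma return_within_lt1 z k :
  \sum_(v <- nbr z) trans_prob G z v * return_within z k v <=
  1 - fine (PRW z (no_return [fset z]%fset)).
Proof.
have mR v : measurable [set w : wpath V | (forall i, (i <= 1)%N -> w i = if i is 0%N then z else v) /\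
                 exists i, (1 <= i <= 1 + k)%N /\ w i = z].
  apply: (sa_and sM).
    apply: (sa_forall sM); first exact: countableP.
    by move=> i; apply: (sa_imply sM); [exact: (sa_const sM)|exact: measurable_coordinate].
  apply: (sa_exists sM); first exact: countableP.
  by move=> i; apply: (sa_and sM); [exact: (sa_const sM)|exact: measurable_coordinate].
have mN := @measurable_no_return z.
rewrite lerBrDr -lee_fin EFinD fineK ?fin_num_measure //.
pose E v := [set w : wpath V | (forall i, (i <= 1)%N -> w i = if i is 0%N then z else v) /\
                 exists i, (1 <= i <= 1 + k)%N /\ w i = z].
have mE : measurable (\bigcup_(v in [set` nbr z]) E v).
  by apply: fin_bigcup_measurable => // v _; exact: mR.
apply: (@le_trans _ _ (PRW z (\bigcup_(v in [set` nbr z]) E v) + PRW z (no_return [fset z]%fset))%E).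
  apply: leeD2r; rewrite bigcup_fset measure_fbigsetU; last 2 first.
  - by move=> v _; exact: mR.
  - by move=> u v _ _ [w [[Hu _] [Hv _]]]; have := Hu 1%N isT; rewrite (Hv 1%N isT).
  rewrite -sumEFin; apply: lee_sum => v _.
  apply: le_trans (@return_within_prob z z k 1 (fun i => if i is 0%N then z else v)).
  by rewrite big_ord_recr big_ord0 /= eqxx !mul1r.
rewrite -measureU //; first by apply: probability_le1; exact: measurableU.
rewrite -subset0 => w [[v _ [_ [i [/andP[i1 _] wi]]]] /(_ i i1)].
by rewrite wi inE eqxx.
Qed.

Definition return_prob z y : R := limn (return_within z ^~ y).

Lemma return_within_cvg z y : return_within z k y @[k --> \oo] --> return_prob z y.
Proof.
apply: nondecreasing_is_cvgn.
  by apply/nondecreasing_seqP => k; case/andP: (return_within_le z k y).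
by exists 1 => _ [k _ <-]; exact: return_within_le1.
Qed.

Lemma return_prob_step z y : y != z ->
  return_prob z y = \sum_(v <- nbr y) trans_prob G y v * return_prob z v.
Proof.
move=> /negPf yz; have H : return_within z k.+1 y @[k --> \oo] --> return_prob z y.
  by have := @return_within_cvg z y; rewrite -(cvg_shiftS (return_within z ^~ y)).
apply: (cvg_unique _ H); rewrite //= yz; apply: cvg_sum_seq => v; apply: cvgMr.
exact: return_within_cvg.
Qed.

Lemma return_prob_start z : return_prob z z = 1.
Proof.
apply: (cvg_unique _ (@return_within_cvg z z)) => //.
by rewrite (_ : return_within z ^~ z = cst 1); [exact: cvg_cst|apply: funext => -[|k] /=; rewrite eqxx].
Qed.

Lemma return_prob_ge0 z y : 0 <= return_prob z y.
Proof.
apply: limr_ge; first exact: return_within_cvg.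
by near=> k; case/andP: (return_within_le z k y).
Unshelve. all: by end_near.
Qed.

Lemma return_prob_lt1 z :
  \sum_(v <- nbr z) trans_prob G z v * return_prob z v <=
  1 - fine (PRW z (no_return [fset z]%fset)).
Proof.
have H : \sum_(v <- nbr z) trans_prob G z v * return_within z k v @[k --> \oo] -->
    \sum_(v <- nbr z) trans_prob G z v * return_prob z v.
  by apply: cvg_sum_seq => v; apply: cvgMr; exact: return_within_cvg.
rewrite -(cvg_lim _ H) //; apply: limr_le; first exact: (cvgP _ H).
by near=> k; exact: return_within_lt1.
Unshelve. all: by end_near.
Qed.

(** A positive maximum would be attained in [K] and would spread from neighbour to neighbour, up to
    [z]. *)
Lemma max_principle (K : {fset V}) z (f : V -> R) : (forall x, x \notin K -> f x <= 0) -> f z <= 0 ->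
  (forall x, x \in K -> x != z -> f x <= \sum_(v <- nbr x) trans_prob G x v * f v) ->
  forall x, f x <= 0.
Proof.
move=> fK fz fs x; rewrite leNgt; apply/negP => fx.
have xK : x \in K by apply/negPn/negP => /fK; rewrite leNgt fx.
have [y _ ymax] := @arg_maxP _ _ K [` xK]%fset xpredT (fun y => f (val y)) isT.
set M := f (val y) in ymax.
have M0 : 0 < M by apply: lt_le_trans fx _; exact: (ymax [` xK]%fset isT).
have fM v : f v <= M.
  have [vK|/fK /le_trans] := boolP (v \in K); last by apply; exact: ltW.
  exact: (ymax [` vK]%fset isT).
suff /(_ z) zM : forall v, f v = M by move: fz; rewrite zM leNgt M0.
apply: (@connected_ind _ _ G (fun v => f v = M) (val y)) => // a b ab fa.
have aK : a \in K by apply/negPn/negP => /fK; rewrite fa leNgt M0.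
have az : a != z by apply/eqP => az; move: fz; rewrite -az fa leNgt M0.
have := fs a aK az; rewrite fa => le.
have /eqP : \sum_(v <- nbr a) trans_prob G a v * (M - f v) = 0.
  apply/eqP; rewrite eq_le; apply/andP; split.
    under eq_bigr do rewrite mulrBr.
    by rewrite sumrB -mulr_suml (trans_prob_sum1 w_gt0) mul1r subr_le0.
  by apply: sumr_ge0 => v _; rewrite mulr_ge0 ?trans_prob_ge0 ?subr_ge0.
rewrite psumr_eq0; last by move=> v _; rewrite mulr_ge0 ?trans_prob_ge0 ?subr_ge0.
have bn : b \in nbr a by apply/mem_nbr.
move=> /allP/(_ b bn) /=; rewrite mulf_eq0 gt_eqF ?divr_gt0 ?cond_gt0 //= subr_eq0.
by move=> /eqP.
Qed.

End return_probability.

Lemma energy_le_sum (R : realType) (V : pointedType) (G : network R V) (I : eqType) (r : seq I)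
  (c : I -> R) (f : I -> V -> R) : (forall i, i \in r -> exists M, energy_le G (f i) M) ->
  exists M, energy_le G (fun x => \sum_(i <- r) f i x * c i) M.
Proof.
elim: r => [|i r IH] fM.
  by eexists; apply: (@fin_supp_energy_le _ _ G _ fset0) => x _; rewrite big_nil.
have [M HM] := IH (fun j jr => fM j (mem_behead (s := i :: r) jr)).
have [N HN] := fM i (mem_head _ _).
exists (2 * c i ^+ 2 * N + 2 * 1 ^+ 2 * M).
have := energy_le_lin (c i) 1 HN HM; congr energy_le; apply/funext => x.
by rewrite big_cons mul1r mulrC.
Qed.

(** * The reflected walk at infinity *)

Section reflected_walk_at_infinity.
Context {R : realType} {V : pointedType} {G : network R V} {m : V -> R}.
Variables (X : V -> process R V).
Hypothesis m_gt0 : forall x, 0 < m x.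
Hypothesis weight_gt0 : forall x, 0 < vweight G x.
Hypothesis hX : is_rwinf G m X.
Variable PRW : V -> probability (wpath V) R.
Hypothesis hRW : forall x, rw_law G x (PRW x).
Hypothesis htransient : transient PRW.
Local Notation path := (R -> option V).
Local Notation P z := (pr_prob (X z)).
Local Notation tr z := (traj (X z)).
Local Notation nbr := (nbr G).
Let cV : countable [set: V] := countable_vertices G.

Let gr := @good_path_right R V.
Let gs := @good_path_shift R V.
Let ag := ae_good_path m_gt0 hX.
Let aW := adapted_walk hX ag.
Let aP := @adapted_paths R V good_path.
Local Notation pev := (path_events (@good_path R V)).
Local Notation plaw := (plaw X).
Local Notation opt z := (optional (history (X z))).
Let sP := path_events_sa (@good_path R V).
Let mP := measurable_path_event hX gr gs ag.
Let mS := measurable_shift_event hX gr gs ag.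
Let oI := optional_infinity cV gr aP (@subset_refl _ good_path).

Lemma path_event_reach (A A' : {fset V}) : (A' `<=` A)%fset -> pev (reach A A').
Proof. by move=> AA; exact: (optional_mem aP (optional_reach cV aP AA)). Qed.

Lemma plaw_reach_cvg (A A' : {fset V}) (K : nat -> {fset V}) y : (A' `<=` A)%fset ->
  (forall n k, (n <= k)%N -> (K n `<=` K k)%fset) -> (forall B, exists n, (B `<=` K n)%fset) ->
  plaw y (hits (leave A (K n)) (in_fset A')) @[n --> \oo] --> plaw y (reach A A').
Proof.
move=> AA KS KA; apply: fine_cvg.
have gR := path_event_reach AA.
have gH n : pev (hits (leave A (K n)) (in_fset A')).
  by apply: path_event_hits => //; exact: clopen_leave.
rewrite -/(plaw y _) -(plawE hX gr gs ag) //.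
apply: cvg_prob_eventually.
- by move=> n; exact: (measurable_path_event hX gr gs ag).
- exact: (measurable_path_event hX gr gs ag).
- apply: filterS (ag y) => w gw.
  have [r|nr] := pselect (reach A A' (tr y w)).
    by have [N HN] := reach_hits_leave gw KS KA AA r; exists N => n /HN.
  by exists 0%N => n _; split => // /(hits_leave_reach AA).
Qed.

Section reach_dirichlet.
Variables (A A' : {fset V}).
Hypothesis AA : (A' `<=` A)%fset.
Variable K : nat -> {fset V}.
Hypothesis AK : forall n, (A `<=` K n)%fset.
Hypothesis KS : forall n k, (n <= k)%N -> (K n `<=` K k)%fset.
Hypothesis KA : forall B, exists n, (B `<=` K n)%fset.

Let g_ n y := plaw y (hits (leave A (K n)) (in_fset A')).

Let gA n x : x \in A -> g_ n x = (x \in A')%:R.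
Proof.
move=> xA; rewrite /g_ (plaw_hits_start hX gr gs ag); [|by apply: (iffRL (leaveE _ _ _));
    right|exact: clopen_leave].
by congr (nat_of_bool _)%:R; apply/idP/idP => [/asboolP|h]; [|exact/asboolP].
Qed.

Lemma reach_out n x : x \notin K n -> g_ n x = 0.
Proof.
move=> xK; rewrite /g_ (plaw_hits_start hX gr gs ag); [|by apply: (iffRL (leaveE _ _ _));
    left|exact: clopen_leave].
rewrite asboolF // => /= xA'; move/negP : xK; apply.
by apply: (fsubsetP (AK n)); exact: (fsubsetP AA).
Qed.

Let gharm n x : x \in K n -> x \notin A -> lap G (g_ n) x = 0.
Proof.
move=> xK xA; apply/trans_probE_lap => //.
apply: (plaw_hits_step weight_gt0 hX gr gs ag); last exact: clopen_leave.
by move=> /(iffLR (leaveE _ _ _))[xK'|xA']; [rewrite xK in xK'|rewrite xA' in xA].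
Qed.

Let gcvg x : g_ n x @[n --> \oo] --> plaw x (reach A A').
Proof. exact: plaw_reach_cvg. Qed.

Lemma reach_energy_fin_aux : exists M, energy_le G (fun x => plaw x (reach A A')) M.
Proof. exact: (@dirichlet_energy_fin _ _ G A (fun x => (x \in A')%:R) K g_ _ KS gA reach_out gharm
    gcvg). Qed.

Lemma reach_energy_cvg e : 0 < e -> exists n,
  energy_le G (fun x => 1 * plaw x (hits (leave A (K n)) (in_fset A')) + (- 1) * plaw x (reach A A')) e.
Proof. exact: (@dirichlet_energy_cvg _ _ G A (fun x => (x \in A')%:R) K g_ _ KS gA reach_out gharm
    gcvg). Qed.

End reach_dirichlet.

Lemma reach_energy_fin A A' : (A' `<=` A)%fset ->
  exists M, energy_le G (fun x => plaw x (reach A A')) M.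
Proof.
move=> AA; have [K [AK KS KA]] := fset_exhaustion A cV.
exact: (reach_energy_fin_aux AA AK KS KA).
Qed.

Lemma plaw_reach_start A A' x : (A' `<=` A)%fset -> x \in A -> plaw x (reach A A') = (x \in A')%:R.
Proof.
move=> AA xA; rewrite (_ : _%:R = (`[< x \in A' >])%:R); last first.
  by congr (nat_of_bool _)%:R; apply/idP/idP => [?|/asboolP //]; exact/asboolP.
rewrite -(plaw_const X x); apply: (plaw_ext hX gr gs ag); [exact: path_event_reach|exact:
    path_event_const|].
move=> y gy y0; split=> /=.
  move=> [t [ft yt _]]; have f0 : first_hit (in_fset A) y 0 0 by apply: first_hit0; rewrite y0.
  by move: yt; rewrite (first_hit_uniq ft f0) y0.
move=> xA'; exists 0; split; first by apply: first_hit0; rewrite y0.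
  by rewrite y0.
by move=> s /le_anti <-; rewrite y0.
Qed.

(* The bound on the probability to hit [B] between two visits to [o] is the
   effective conductance between [o] and [B]. *)
Lemma excursion_bound o (B : {fset V}) (f : V -> R) M : o \notin B -> f o = 0 ->
  (forall x, x \in B -> 1 <= `|f x|) -> energy_le G f M ->
  \sum_(y <- nbr o) trans_prob G o y * plaw y (hits (in_fset (o |` B)%fset) (in_fset B)) <=
  M / vweight G o.
Proof.
move=> oB fo fB fM; have A0 : (o |` B)%fset != fset0.
  by apply/fset0Pn; exists o; rewrite !inE eqxx.
have [h hmin _] := min_energy_ext_exists G (fun v => (v \in B)%:R) A0.
rewrite ler_pdivlMr // mulr_suml.
rewrite (eq_bigr (fun y => cond G o y * h y)); last first.
  move=> y _; rewrite (plaw_hits_min_energy hX gr gs ag y A0 hmin) /trans_prob mulrAC.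
  by rewrite divfK ?gt_eqF.
apply: (min_energy_hitting_bound oB _ _ hmin fo fB fM).
  by move=> x ->.
by rewrite (negbTE oB).
Qed.

(** By [hits_before_visit], a visit to [B] is seen, on all fine grids, as a quick exit from [o]
    followed by a hit of [B] before [o]. Each of the [T * n.+1] grid times contributes at most
    [2 * m o / n.+1] times the excursion bound, so the mesh cancels. *)
Lemma visits_bound_fset o (B : {fset V}) (f : V -> R) M (T : nat) : o \notin B -> f o = 0 ->
  (forall x, x \in B -> 1 <= `|f x|) -> energy_le G f M ->
  exists2 E, measurable E & (forall w, good_path (tr o w) -> tr o w 0 = Some o ->
      left_limit o (tr o w) -> (exists2 t, 0 <= t < T%:R & in_fset B (tr o w t)) -> E w) /\
    (P o E <= (2 * T%:R * m o * (M / vweight G o))%:E)%E.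
Proof.
move=> oB fo fB fM.
have cA : clopen (in_fset (o |` B)%fset) by exists (o |` B)%fset; left.
have gH : pev (hits (in_fset (o |` B)%fset) (in_fset B)) by apply: path_event_hits.
have oH := optional_hit cV gr aP (clopenC (clopen1 o)) (optional_const aP (lexx 0)).
pose Cn n : set path := [set x | (([set w | [set: path] w /\ exists2 r, 0 <= r & (~` [set Some o])
    (w r)] `&`
   [set x | exit_time o x < 2 * n.+1%:R^-1]) x) /\
   hits (in_fset (o |` B)%fset) (in_fset B) (shift_traj x (exit_time o x))].
have gC n : pev (Cn n).
  exact: (optional_event cV gr gs aP (optional_lt aP (2 * n.+1%:R^-1) oH) gH).
have pC n : plaw o (Cn n) <= m o * (2 * n.+1%:R^-1) * (M / vweight G o).
  have n0 : (0 : R) < 2 * n.+1%:R^-1 by rewrite mulr_gt0 ?invr_gt0.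
  have h := excursion_bound oB fo fB fM.
  apply: (@le_trans _ _ (m o * (2 * n.+1%:R^-1) * \sum_(y <- nbr o) trans_prob G o y * plaw y (hits
      (in_fset (o |` B)%fset) (in_fset B)))).
    apply: (plaw_exit_lt m_gt0 weight_gt0 hX gr gs ag n0 (gC n) gH) => x gx x0 [[[_ [r r0 xr]] /= Ts] Hx].
    have rS : right_open (~` (~` [set Some o])) x by rewrite setCK; case: (gr gx).
    have [fh _] := first_hit_exists rS (lexx 0) r0 xr.
    exists (exit_time o x) => //; rewrite Ts andbT; have [t0 nt _] := fh.
    rewrite lt_neqAle t0 andbT; apply/eqP => E; apply: nt.
    by rewrite -/(exit_time o x) -E.
  by apply: ler_wpM2l => //; rewrite mulr_ge0 ?(ltW n0) // ltW.
pose c n k := [set w | (True /\ tr o w (grid n k) = Some o) /\ Cn n (shift_traj (tr o w) (grid n k))].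
have mc n k : measurable (c n k).
  have oC := optional_state0 cV gr (aW o) (Some o) (optional_const (aW o) (grid_ge0 n k)).
  by have := measurable_shift_event hX gr gs ag oC (gC n).
have c_le n k : (P o (c n k) <= (m o * (2 * n.+1%:R^-1) * (M / vweight G o))%:E)%E.
  have := markov_event hX gr gs ag o (grid_ge0 n k)
    (sa_const (history_sa (X o) (grid n k)) True) (gC n).
  rewrite -/(c n k) => ->; rewrite (plawE hX gr gs ag) //.
  rewrite -[leRHS]mul1e; apply: lee_pmul => //.
  - by rewrite lee_fin plaw_ge0.
  - have sM := @sigma_algebra_measurable _ (pr_space (X o)).
    apply: probability_le1; apply: (sa_and sM); first exact: (sa_const sM).
    exact/(rwinf_meas hX)/grid_ge0.
  - by rewrite lee_fin.
have sum_c n : ((\sum_(k <- iota 0 (T * n.+1)) P o (c n k))%R <= (2 * T%:R * m o * (M / vweight G o))%:E)%E.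
  apply: (@le_trans _ _ (\sum_(k <- iota 0 (T * n.+1)) (m o * (2 * n.+1%:R^-1) * (M / vweight G o))%:E)%R).
    by apply: lee_sum => k _; exact: c_le.
  rewrite sumEFin lee_fin big_const_seq count_predT size_iota iter_addr_0 -[leLHS]mulr_natl natrM.
  have n0 : n.+1%:R != 0 :> R by [].
  have v0 : vweight G o != 0 by rewrite gt_eqF.
  rewrite le_eqVlt; apply/orP; left; apply/eqP; move: (n.+1%:R) (vweight G o) n0 v0 => p q n0 v0.
  by field; rewrite n0 v0.
pose Ev n := [set w | (1 <= count (fun k => `[< c n k w >]) (iota 0 (T * n.+1)))%N].
exists [set w | exists N, forall n, (N <= n)%N -> Ev n w].
  by apply: measurable_eventually => n; case: (prob_count_le 1 (mc n) (sum_c n)).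
split; last first.
  apply: prob_eventually_le => n; case: (prob_count_le 1 (mc n) (sum_c n)) => // _.
  by rewrite mul1e.
move=> w gw w0 ll [t /andP[t0 tT] xt].
have [N HN] := hits_before_visit (gr gw) w0 ll oB t0 xt.
exists N => n /HN[k [gk xk [u /andP[u0 un] [fu Hu]]]].
rewrite /Ev /= -has_count; apply/hasP; exists k.
  rewrite mem_iota /= add0n -(ltr_nat R) natrM.
  by rewrite -ltr_pdivrMr //; exact: lt_trans tT.
apply/asboolP; split => //; split; last by rewrite /exit_time (first_hit_time fu).
split; last by rewrite /= /exit_time (first_hit_time fu).
by split => //; exists u; [exact: ltW|case: fu].
Qed.

(** The bound for finite sets depends on [B] only through [f], so it passes to the possibly infinite
    set where [f] is at least 1 in absolute value. *)
Lemma visits_bound o (f : V -> R) M (T : nat) : f o = 0 -> energy_le G f M ->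
  exists2 E, measurable E & (forall w, good_path (tr o w) -> tr o w 0 = Some o ->
      left_limit o (tr o w) ->
      (exists t v, [/\ 0 <= t < T%:R, tr o w t = Some v & 1 <= `|f v|]) -> E w) /\
    (P o E <= (2 * T%:R * m o * (M / vweight G o))%:E)%E.
Proof.
move=> fo fM; have [K [_ KS KA]] := fset_exhaustion fset0 cV.
pose B j := [fset v in K j | 1 <= `|f v|]%fset.
have oB j : o \notin B j by rewrite !inE /= fo normr0 ler10 andbF.
have fB j x : x \in B j -> 1 <= `|f x| by rewrite !inE /= => /andP[].
have /choice[E HE] : forall j, exists E, measurable E /\ ((forall w, good_path (tr o w) -> tr o w 0
    = Some o ->
      left_limit o (tr o w) -> (exists2 t, 0 <= t < T%:R & in_fset (B j) (tr o w t)) -> E w) /\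
    (P o E <= (2 * T%:R * m o * (M / vweight G o))%:E)%E).
  by move=> j; have [E ? ?] := visits_bound_fset T (oB j) fo (fB j) fM; exists E.
exists [set w | exists N, forall n, (N <= n)%N -> E n w].
  by apply: measurable_eventually => n; case: (HE n).
split; last by apply: prob_eventually_le => n; case: (HE n) => // _ [].
move=> w gw w0 ll [t [v [tT xt fv]]].
have [N /fsubsetP HN] := KA [fset v]%fset.
exists N => n Nn; case: (HE n) => _ [+ _]; apply => //; exists t => //.
rewrite xt /= !inE /= fv andbT; apply: (fsubsetP (KS _ _ Nn)).
by apply: HN; rewrite inE.
Qed.

(* [D] below is the error of a Dirichlet solution on a finite set: its energy is
   small and it coincides with [- plaw v (reach A A)] far away. *)
Lemma ae_reach_small o (A : {fset V}) e : o \in A -> 0 < e ->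
  {ae P o, forall w, forall T : nat, exists K : {fset V}, forall t v, 0 <= t < T%:R ->
     tr o w t = Some v -> v \notin K -> plaw v (reach A A) < e}.
Proof.
move=> oA e0; apply: ae_foralln => T.
have [K [AK KS KA]] := fset_exhaustion A cV.
suff H : {ae P o, forall w, good_path (tr o w) -> tr o w 0 = Some o -> left_limit o (tr o w) ->
    exists K : {fset V}, forall t v, 0 <= t < T%:R -> tr o w t = Some v -> v \notin K -> plaw v
        (reach A A) < e}.
  have H1 : {ae P o, forall w, tr o w 0 = Some o /\ left_limit o (tr o w)}.
    by move: (rwinf_start hX o) (ae_left_limit m_gt0 hX o o); apply: filterS2.
  by move: H (ag o) H1; apply: filterS3 => w H gw [w0 ll]; exact: H.
apply: (@negligible_small _ _ _ _ _ (4 * T%:R * m o / vweight G o)) => M.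
(* Then [e^-1 * D] has energy at most [2 / M.+1], and the probability below is at most a constant
   over [M.+1]. The term [0 * D x] in [f] only serves to apply [energy_le_lin]. *)
have d0 : 0 < e ^+ 2 / M.+1%:R by rewrite divr_gt0 // exprn_gt0.
have [n En] := reach_energy_cvg (fsubset_refl A) AK KS KA d0.
set D := (fun x => _) in En.
pose f x := e^-1 * D x + 0 * D x.
have DA : D o = 0.
  rewrite /D plaw_reach_start // (plaw_hits_start hX gr gs ag); [|by apply: (iffRL (leaveE _ _ _));
      right|exact: clopen_leave].
  by rewrite (asboolT oA) oA mul1r mulN1r subrr.
have fM := energy_le_lin e^-1 0 En En.
have fo : f o = 0 by rewrite /f DA; lra.
have [E mE [HE PE]] := visits_bound T fo fM.
exists E => //; split; last first.
  apply: le_trans PE _; rewrite lee_fin le_eqVlt; apply/orP; left; apply/eqP.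
  have e1 : e != 0 by rewrite gt_eqF.
  have v0 : vweight G o != 0 by rewrite gt_eqF.
  have M0 : M.+1%:R != 0 :> R by [].
  move: (M.+1%:R) (vweight G o) M0 v0 => p q M0 v0.
  by field; rewrite M0 v0 e1.
move=> w /= /not_implyP[gw /not_implyP[w0 /not_implyP[ll nK]]]; apply: HE => //.
apply: contrapT => nv; apply: nK; exists (K n) => t v tT xt vK.
rewrite ltNge; apply/negP => ge; apply: nv; exists t, v; split => //.
have DE : D v = - plaw v (reach A A).
  by rewrite /D (reach_out (fsubset_refl A) AK vK); lra.
rewrite /f DE mul0r addr0 normrM normrN ger0_norm ?invr_ge0 ?(ltW e0) //.
by rewrite ger0_norm ?plaw_ge0 // mulrC ler_pdivlMr // mul1r.
Qed.

(** The finite approximations of the left-hand side vanish off [K n] and are harmonic in [K n]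
    except at [z]; the maximum principle compares them with the nonnegative return probability. *)
Lemma plaw_reach_le z y : plaw y (reach [fset z]%fset [fset z]%fset) <= return_prob G z y.
Proof.
have [K [AK KS KA]] := fset_exhaustion [fset z]%fset cV.
have zz : ([fset z] `<=` [fset z])%fset := fsubset_refl _.
have H := plaw_reach_cvg (y := y) zz KS KA.
rewrite -(cvg_lim _ H) //; apply: limr_le; first exact: (cvgP _ H).
near=> n; rewrite -subr_le0.
apply: (@max_principle _ _ G PRW htransient (K n) z (fun y => plaw y (hits (leave [fset z]%fset (K
    n)) (in_fset [fset z]%fset)) - return_prob G z y)).
- move=> x xK; rewrite (reach_out zz AK xK) sub0r oppr_le0.
  exact: return_prob_ge0.
- rewrite (plaw_hits_start hX gr gs ag) //; last exact: clopen_leave.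
    by rewrite (return_prob_start G htransient) lerBlDr add0r; case: asboolP.
  by apply: (iffRL (leaveE _ _ _)); right; rewrite inE.
- move=> x xK xz; rewrite {1}(return_prob_step G htransient xz).
  rewrite (plaw_hits_step weight_gt0 hX gr gs ag); last exact: clopen_leave.
    by under [leRHS]eq_bigr do rewrite mulrBr; rewrite sumrB.
  by move=> /leaveE[|]; [rewrite xK|rewrite inE (negPf xz)].
Unshelve. all: by end_near.
Qed.

(** * Infinity is visited almost surely *)

Definition never_infinite : set path := [set x | forall t, 0 <= t -> x t <> None].

Lemma path_event_never : pev never_infinite.
Proof.
apply: (sa_ext sP (P := fun x => ~ hits_infinity x)).
  by apply: (sa_not sP); exact: (optional_mem aP oI).
by move=> x; split => [H t t0 xt|H [t t0]]; [apply: H; exists t|exact: H].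
Qed.

Let visits_path z : set path := [set x | setT x /\ exists2 r, 0 <= r & in_fset [fset z]%fset (x r)].

Let path_event_visits z : pev (visits_path z).
Proof.
apply: (optional_mem aP (T := fun x => hit_time (in_fset [fset z]%fset) x 0)).
apply: (optional_hit cV gr aP _ (optional_const aP (lexx 0))).
by exists [fset z]%fset; left.
Qed.

(** Strong Markov property at the first visit to [z], which precedes infinity on trajectories that
    never visit it. *)
Lemma plaw_never_visits z v :
  plaw v (never_infinite `&` visits_path z) <=
  plaw v (reach [fset z]%fset [fset z]%fset) * plaw z never_infinite.
Proof.
have oR := optional_reach cV aP (fsubset_refl [fset z]%fset).
apply: (@le_trans _ _ (plaw v [set x | (reach [fset z]%fset [fset z]%fset x /\
    x (hit_time (in_fset [fset z]%fset) x 0) = Some z) /\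
    never_infinite (shift_traj x (hit_time (in_fset [fset z]%fset) x 0))])).
  apply: (plaw_le hX gr gs ag).
  - by apply: (sa_and sP); [exact: path_event_never|exact: path_event_visits].
  - apply: (optional_event cV gr gs aP); last exact: path_event_never.
    exact: (optional_state0 cV gr aP (Some z) oR).
  move=> x gx _ [nx [_ [r r0 xr]]].
  have oC : right_open (~` in_fset [fset z]%fset) x.
    by case: (gr gx) => _; apply.
  have [fh _] := first_hit_exists oC (lexx 0) r0 xr.
  have t0 : 0 <= hit_time (in_fset [fset z]%fset) x 0 by case: fh.
  split; last by move=> s s0; apply: nx; apply: addr_ge0.
  split; last by case: fh => _ + _; case: (x _) => //= u; rewrite inE => /eqP ->.
  exists (hit_time (in_fset [fset z]%fset) x 0); split=> //; first by case: fh.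
  by move=> s /andP[s0 _]; exact: nx.
rewrite (plaw_markov hX gr gs ag _ _ oR path_event_never).
apply: ler_wpM2r; first exact: plaw_ge0.
apply: (plaw_le hX gr gs ag) => [| |x _ _ []//]; last exact: path_event_reach.
exact: (optional_mem aP (optional_state0 cV gr aP (Some z) oR)).
Qed.

(* A walk that never visits infinity returns to [z] before infinity, which has
   probability at most [1 - g], and starts afresh there. *)
Lemma plaw_never z : plaw z never_infinite = 0.
Proof.
set a := plaw z never_infinite; set g := fine (PRW z (no_return [fset z]%fset)).
have g0 : 0 < g by rewrite fine_gt0 // htransient ltey_eq fin_num_measure //; exact: measurable_no_return.
pose S : set (option V) := ~` [set Some z].
have cS : clopen S by apply: clopenC; exact: clopen1.
pose C' := never_infinite `&` visits_path z.
have C'p : pev C' by apply: (sa_and sP); [exact: path_event_never|exact: path_event_visits].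
pose C := [set x : path | (setT x /\ exists2 r, 0 <= r & S (x r)) /\
   C' (shift_traj x (hit_time S x 0))].
have Cp : pev C.
  apply: (optional_event cV gr gs aP) C'p.
  exact: (optional_hit cV gr aP cS (optional_const aP (lexx 0))).
have aC : a <= plaw z C.
  rewrite -lee_fin -!(plawE hX gr gs ag) //; last exact: path_event_never.
  apply: prob_le_ae; try exact: (measurable_path_event hX gr gs ag).
    by apply: (measurable_path_event hX gr gs ag); exact: path_event_never.
  move: (ae_exit hX gr ag z) (rwinf_recurrent hX z); apply: filterS2 => w.
  move=> [gw [w0 [[r r0 Sr] [_ [fh e0]]]]] rec nw.
  split; first by split=> //; exists r.
  split; first by move=> s s0; apply: nw; rewrite addr_ge0 // ltW.
  split=> //; have [t tT [t0 xt]] := rec (exit_time z (tr z w)).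
  exists (t - exit_time z (tr z w)); first by rewrite subr_ge0.
  by rewrite /shift_traj subrKC xt /= inE.
have : a <= (1 - g) * a.
  apply: le_trans aC _.
  rewrite (plaw_step weight_gt0 hX gr gs ag Cp C'p); last first.
    move=> x t gx x0 t0 fh; rewrite -(first_hit_time fh); split=> [[]//|].
    by split=> //; split=> //; case: fh => t0' St _; exists t.
  apply: (@le_trans _ _ (\sum_(v <- nbr z) trans_prob G z v * (return_prob G z v * a))).
    apply: ler_sum => v _; apply: ler_wpM2l; first exact: trans_prob_ge0.
    apply: le_trans (plaw_never_visits z v) _; apply: ler_wpM2r; first exact: plaw_ge0.
    exact: plaw_reach_le.
  under eq_bigr do rewrite mulrA.
  rewrite -mulr_suml; apply: ler_wpM2r; first exact: plaw_ge0.
  exact: (return_prob_lt1 hRW htransient).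
rewrite mulrBl mul1r => le; have {le} : g * a <= 0 by lra.
rewrite (pmulr_rle0 _ g0) => a0.
by apply/eqP; rewrite eq_le a0 plaw_ge0.
Qed.

Lemma ae_infinite z : {ae P z, forall w, hits_infinity (tr z w)}.
Proof.
have mN : measurable (tr z @^-1` never_infinite).
  by apply: (measurable_path_event hX gr gs ag); exact: path_event_never.
have : P z (tr z @^-1` never_infinite) = 0%E.
  by rewrite -/(law (X z) never_infinite) (plawE hX gr gs ag _ path_event_never) plaw_never.
move/(prob0_ae mN); apply: filterS => w nw.
by apply: contrapT => ni; apply: nw => t t0 xt; apply: ni; exists t.
Qed.

Lemma path_event_after C : pev C -> pev (after_infinity C).
Proof. by move=> pC; exact: (optional_event cV gr gs aP oI pC). Qed.

Lemma plaw_after_step C z : pev C ->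
  plaw z (after_infinity C) = \sum_(v <- nbr z) trans_prob G z v * plaw v (after_infinity C).
Proof.
move=> /path_event_after pC; apply: (plaw_step weight_gt0 hX gr gs ag pC pC).
move=> x t gx x0 t0 [_ _ H]; apply: after_infinity_shift; [exact: gr|exact: ltW|].
by move=> r /H /contrapT ->.
Qed.

Lemma plaw_split z C D : pev C -> pev D ->
  plaw z C = plaw z (C `&` D) + plaw z (C `&` ~` D).
Proof.
move=> pC pD; apply/eqP; rewrite -eqe EFinD -!(plawE hX gr gs ag) //.
- rewrite /law -measureU.
  + by rewrite -preimage_setU -setIUr setUv setIT.
  + by apply: mP; exact: (sa_and sP).
  + by apply: mP; apply: (sa_and sP) => //; exact: (sa_not sP).
  + by rewrite -subset0 => w [[_ h] [_ /(_ h)]].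
- by apply: (sa_and sP) => //; exact: (sa_not sP).
- exact: (sa_and sP).
Qed.

Lemma path_event_hitsA (A A' : {fset V}) : pev (hits (in_fset A) (in_fset A')).
Proof. by apply: path_event_hits => //; exists A; left. Qed.

(** If [A] is reached before infinity, the trajectory after infinity is unchanged by the shift to
    the hitting time of [A], where the strong Markov property applies. *)
Lemma plaw_after_reach (A : {fset V}) C z : pev C ->
  plaw z (after_infinity C `&` reach A A) =
  \sum_(b <- A) plaw z (reach A [fset b]%fset) * plaw b (after_infinity C).
Proof.
move=> pC; have pU := path_event_after pC.
have oR := optional_reach cV aP (fsubset_refl A).
have pR : pev (reach A A) := optional_mem aP oR.
pose T x := hit_time (in_fset A) x (0 : R).
have oS b := optional_state0 cV gr aP (Some b) oR.
have pE b : pev [set x | (reach A A x /\ x (T x) = Some b) /\ after_infinity C (shift_traj x (T x))].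
  exact: (optional_event cV gr gs aP (oS b) pU).
have RT x : reach A A x -> first_hit (in_fset A) x 0 (T x) /\ forall s, 0 <= s <= T x -> x s <> None.
  by move=> [t [fh _ H]]; rewrite /T (first_hit_time fh).
have EE b x : good_path x -> (after_infinity C `&` reach A A) x /\ x (T x) = Some b <->
    (reach A A x /\ x (T x) = Some b) /\ after_infinity C (shift_traj x (T x)).
  move=> gx; have [rx|nr] := pselect (reach A A x); last by split=> -[[]].
  have [[T0 _ _] HN] := RT x rx.
  rewrite -(after_infinity_shift C (gr gx) T0) /=; first by tauto.
  by move=> r /andP[r0 rT]; apply: HN; rewrite r0 ltW.
have mEb b : measurable ((tr z @^-1` (after_infinity C `&` reach A A)) `&` [set w | tr z w (T (tr z
    w)) = Some b]).
  apply: (measurable_ae_eq (pr_complete (X z)) (mP z (pE b))).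
  by apply: filterS (ag z) => w gw; exact: EE.
apply/eqP; rewrite -eqe -sumEFin -(plawE hX gr gs ag); last exact: (sa_and sP).
rewrite /law (@prob_fset_partition _ _ _ _ _ A (fun w => tr z w (T (tr z w)))) //; last 2 first.
- by apply: mP; exact: (sa_and sP).
- by apply: aeW => w [_ /RT[[]]].
apply/eqP; rewrite big_seq [RHS]big_seq; apply: eq_bigr => b bA.
rewrite (prob_complete_ae_eq (pr_complete (X z)) (mP z (pE b))); last first.
  by apply: filterS (ag z) => w gw; exact: EE.
rewrite -/(law (X z) _) (plawE hX gr gs ag _ (pE b)) (plaw_markov hX gr gs ag _ _ oR pU).
congr (_ * _)%:E; apply: (plaw_ext hX gr gs ag).
- exact: (optional_mem aP (oS b)).
- by apply: path_event_reach; apply/fsubsetP => v; rewrite inE => /eqP ->.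
move=> x gx _; split.
- move=> [/RT[fh HN] xb]; exists (T x); split=> //.
  by rewrite xb /= inE.
- move=> [t [fh xb HN]]; rewrite /= (first_hit_time fh); split.
    by exists t; split=> //; case: fh.
  by case: (x t) xb => //= v; rewrite inE => /eqP ->.
Qed.

(* The first three terms have finite energy, as functions of [z], and so has the
   left-hand side, which is harmonic. *)
Lemma plaw_after_hits (A A' : {fset V}) z : (A' `<=` A)%fset ->
  plaw z (after_infinity (hits (in_fset A) (in_fset A'))) =
  plaw z (hits (in_fset A) (in_fset A')) - plaw z (reach A A') +
  \sum_(b <- A) plaw z (reach A [fset b]%fset) *
     plaw b (after_infinity (hits (in_fset A) (in_fset A'))).
Proof.
move=> AA; have pH := path_event_hitsA A A'; have pU := path_event_after pH.
have pR : pev (reach A A) := path_event_reach (fsubset_refl A).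
have pnR : pev (~` reach A A) := sa_not sP pR.
rewrite (plaw_split z pU pR) (plaw_split z pH pR) (plaw_after_reach A z pH).
have -> : plaw z (hits (in_fset A) (in_fset A') `&` reach A A) = plaw z (reach A A').
  apply: (plaw_ext hX gr gs ag); [exact: (sa_and sP)|exact: path_event_reach|].
  move=> x _ _; split.
  - move=> [[t fh xt] [u [fu _ HN]]].
    by exists u; split=> //; rewrite -(first_hit_uniq fh fu).
  - move=> [t [fh xt HN]]; split; first by exists t.
    by exists t; split=> //; case: fh.
have -> : plaw z (hits (in_fset A) (in_fset A') `&` ~` reach A A) =
    plaw z (after_infinity (hits (in_fset A) (in_fset A')) `&` ~` reach A A).
  congr fine; apply: prob_ae_eq; try by apply: mP; exact: (sa_and sP).
  move: (ag z) (ae_infinite z); apply: filterS2 => w gw iw.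
  by split=> -[h nr]; split=> //; apply/(hits_after_infinity _ gw iw nr).
by lra.
Qed.

Lemma from_infinity_event z C : pev C ->
  measurable (traj (from_infinity (X z)) @^-1` C) /\
  law (from_infinity (X z)) C = law (X z) (after_infinity C).
Proof.
move=> /path_event_after pC.
have E : {ae P z, forall w, (traj (from_infinity (X z)) @^-1` C) w <-> (tr z @^-1` after_infinity C) w}.
  by apply: filterS (ae_infinite z) => w iw; split=> [//|[]].
split; first exact: (measurable_ae_eq (pr_complete (X z)) (mP z pC) E).
exact: (prob_complete_ae_eq (pr_complete (X z)) (mP z pC) E).
Qed.

(** * The law after infinity under the Liouville property *)

Section liouville.
Hypothesis liouville : finite_energy_harmonic_constant G.

Lemma plaw_after_hits_const (A A' : {fset V}) y z : (A' `<=` A)%fset ->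
  plaw y (after_infinity (hits (in_fset A) (in_fset A'))) =
  plaw z (after_infinity (hits (in_fset A) (in_fset A'))).
Proof.
(* Energy minimisers are available for non-empty [A] only; for empty [A] both probabilities
   vanish. *)
move=> AA; have [A0|A0] := eqVneq A fset0.
  suff E u : plaw u (after_infinity (hits (in_fset A) (in_fset A'))) = 0 by rewrite !E.
  have <- : plaw u [set _ | False] = 0 by rewrite plaw_const asboolF.
  apply: (plaw_ext hX gr gs ag); [|exact: path_event_const|].
    by apply: path_event_after; exact: path_event_hitsA.
  move=> x _ _; split=> // -[_ [t [_ + _] _]]; rewrite A0.
  by case: (shift_traj _ _ _).
apply: (liouville (f := fun x => plaw x (after_infinity (hits (in_fset A) (in_fset A'))))).
  by move=> x; rewrite sum_nbr; apply: plaw_after_step; exact: path_event_hitsA.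
apply/energy_ltP.
have [h hmin /energy_ltP[M hM]] := @min_energy_ext_exists _ _ G A (fun v => (v \in A')%:R) A0.
have [N gN] := reach_energy_fin AA.
have rf b : b \in A -> exists M, energy_le G (fun x => plaw x (reach A [fset b]%fset)) M.
  by move=> bA; apply: reach_energy_fin; rewrite fsub1set.
have [L sL] := energy_le_sum (fun b => plaw b (after_infinity (hits (in_fset A) (in_fset A')))) rf.
have := energy_le_lin 1 1 (energy_le_lin 1 (- 1) hM gN) sL.
set N' := (X in energy_le _ _ X) => H; exists N'.
rewrite (_ : (fun x => _) = (fun x => 1 * (1 * h x + -1 * plaw x (reach A A')) + 1 * \sum_(b <- A)
   plaw x (reach A [fset b]%fset) * plaw b (after_infinity (hits (in_fset A) (in_fset A'))))) //.
apply: funext => x; rewrite {1}(plaw_after_hits _ AA) (plaw_hits_min_energy hX gr gs ag x A0 hmin).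
by rewrite !mul1r mulN1r.
Qed.

(* The walk is observed from its first visit, after infinity, to a finite set
   that exhausts [V]. *)
Lemma after_infinity_cylinder C y z : state_cylinders C ->
  law (X y) (after_infinity C) = law (X z) (after_infinity C).
Proof.
move=> cC; have pC := traj_events_path (good := @good_path R V) (cylinders_traj cC).
have [K [_ KS KA]] := fset_exhaustion fset0 cV.
have cK n : clopen (in_fset (K n)) by exists (K n); left.
have oK n := optional_hit cV gr aP (cK n) oI.
pose T n (x : path) := hit_time (in_fset (K n)) x (hit_infinity x).
pose B n : set path := [set x | hits_infinity x /\ exists2 r, hit_infinity x <= r & in_fset (K n) (x r)].
pose E n : set path := [set x | B n x /\ C (shift_traj x (T n x))].
have pE n : pev (E n) by exact: (optional_event cV gr gs aP (oK n) pC).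
have BT n x : good_path x -> B n x -> first_hit (in_fset (K n)) x (hit_infinity x) (T n x).
  move=> gx [ix [r hr xr]]; have [h0 _ _] := hit_infinity_first (gr gx) ix.
  have oC : right_open (~` in_fset (K n)) x by case: (gr gx) => _; apply.
  by have [] := first_hit_exists oC h0 hr xr.
have Econst n u v : plaw u (E n) = plaw v (E n).
  suff key x : plaw x (E n) =
      \sum_(a <- K n) plaw x (after_infinity (hits (in_fset (K n)) (in_fset [fset a]%fset))) * plaw a C.
    rewrite !key; rewrite big_seq [RHS]big_seq; apply: eq_bigr => a aK; congr (_ * _).
    by apply: plaw_after_hits_const; rewrite fsub1set.
  apply/eqP; rewrite -eqe -sumEFin -(plawE hX gr gs ag) //.
  have oS a := optional_state0 cV gr aP (Some a) (oK n).
  have pS a : pev [set x | (B n x /\ x (T n x) = Some a) /\ C (shift_traj x (T n x))].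
    exact: (optional_event cV gr gs aP (oS a) pC).
  have EE a : (tr x @^-1` E n) `&` [set w | tr x w (T n (tr x w)) = Some a] =
      tr x @^-1` [set x | (B n x /\ x (T n x) = Some a) /\ C (shift_traj x (T n x))].
    by apply/seteqP; split=> w; rewrite /E /=; tauto.
  rewrite /law (@prob_fset_partition _ _ _ _ _ (K n) (fun w => tr x w (T n (tr x w)))); first last.
  - by apply: filterS (ag x) => w gw [/(BT n _ gw)[]].
  - by move=> a; rewrite EE; exact: mP.
  - exact: mP.
  apply/eqP; apply: eq_bigr => a _.
  rewrite EE -/(law (X x) _) (plawE hX gr gs ag _ (pS a)) (plaw_markov hX gr gs ag _ _ (oK n) pC).
  congr (_ * _)%:E; apply: (plaw_ext hX gr gs ag).
  - exact: (optional_mem aP (oS a)).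
  - by apply: path_event_after; exact: path_event_hitsA.
  move=> x0 gx _; split.
  - move=> [Bu ua]; split; first by case: Bu.
    have fh := BT n x0 gx Bu; exists (T n x0 - hit_infinity x0); last by rewrite /shift_traj subrKC
        /= ua /= inE.
    by apply/first_hit_shift; rewrite addr0 subrKC.
  - move=> [iu [t fh ut]]; have := iffRL (first_hit_shift _ _ _ _ _) fh; rewrite addr0 => {}fh.
    rewrite /= (first_hit_time fh).
    split; first by split=> //; case: fh => h1 h2 _; exists (hit_infinity x0 + t).
    by move: ut; rewrite /shift_traj; case: (x0 _) => //= b; rewrite inE => /eqP ->.
have lim u : law (X u) (E n) @[n --> \oo] --> law (X u) (after_infinity C).
  apply: cvg_prob_eventually.
  - by move=> n; exact: mP.
  - by apply: mP; exact: path_event_after.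
  move: (ag u) (ae_infinite u) (ae_grid_vertex hX u); apply: filterS3 => w gw iw vw.
  have [h0 _ _] := hit_infinity_first (gr gw) iw.
  have [e e0 He] := right_shift_cylinder cC (gr gw) h0.
  (* At a grid time within [e] after infinity the walk is at a vertex. Once [K n] contains this
     vertex, its first visit after infinity comes no later, where [C] still has the same truth
     value. *)
  have [N HN] := grid_up_near h0 e0; have /andP[g1 g2] := HN N (leqnn _).
  have [v xv] := vw N (grid_index N (hit_infinity (tr u w))).+1.
  have [M /fsubsetP vM] := KA [fset v]%fset.
  exists M => n Mn.
  have xK : in_fset (K n) (tr u w (grid_up N (hit_infinity (tr u w)))).
    by rewrite /grid_up xv /=; apply: (fsubsetP (KS _ _ Mn)); apply: vM; rewrite inE.
  have Bw : B n (tr u w) by split=> //; exists (grid_up N (hit_infinity (tr u w))).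
  have oC : right_open (~` in_fset (K n)) (tr u w) by case: (gr gw) => _; apply.
  have [[t1 _ _] t2] := first_hit_exists oC h0 g1 xK.
  have := He (T n (tr u w)); rewrite /E /T /= t1 (le_trans t2 g2) => /(_ isT).
  by rewrite /after_infinity /=; tauto.
have := lim y; rewrite (_ : (fun n => law (X y) (E n)) = (fun n => law (X z) (E n))); last first.
  by apply/funext => n; rewrite !(plawE hX gr gs ag _ (pE n)) (Econst n y z).
by move=> /(cvg_unique (@ereal_hausdorff R)) -/(_ _ (lim z)).
Qed.

Lemma from_infinity_law y z : same_law (from_infinity (X y)) (from_infinity (X z)).
Proof.
move=> C tC.
have H := @law_mul_cylinders _ _ cV _ _ (P y) setT (traj (from_infinity (X y))) (from_infinity (X z)).
have sT D : traj_events D -> measurable (traj (from_infinity (X y)) @^-1` D).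
  by move=> tD; have [] := from_infinity_event y (traj_events_path (good := @good_path R V) tD).
have := H measurableT _ _ _ C tC; rewrite setTI probability_setT mul1e; apply.
- by move=> D tD; rewrite setTI; exact: sT.
- by move=> D tD; have [] := from_infinity_event z (traj_events_path (good := @good_path R V) tD).
- move=> D cD; rewrite setTI.
  have pD := traj_events_path (good := @good_path R V) (cylinders_traj cD).
  have [_ Ey] := from_infinity_event y pD; have [_ Ez] := from_infinity_event z pD.
  by rewrite mul1e Ez -(after_infinity_cylinder y z cD) -Ey.
Qed.

End liouville.

(** * The Markov property at grid times with unspecified state, and at infinity *)

Lemma optional_grid_time z n B T : opt z B T -> opt z B (fun w => grid_up n (T w)).
Proof.
move=> oB; have [T0 _] := oB; split.
  by move=> w /T0 Tw; rewrite (le_trans Tw) // ltW // grid_up_gt.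
move=> s; apply: (sa_ext (ad_sa (aW z) s)).
  apply: (@optional_grid_up _ _ _ _ _ _ _ (aW z) B T n s (fun _ _ => True)) => //.
  by move=> r r0 rs; exact: (sa_const (ad_sa (aW z) s)).
by move=> w; rewrite /=; tauto.
Qed.

Lemma measurable_grid_up_fset z n (K : {fset V}) B T C : opt z B T -> pev C ->
  measurable [set w | (B w /\ in_fset K (tr z w (grid_up n (T w)))) /\
               C (shift_traj (tr z w) (grid_up n (T w)))].
Proof.
move=> oB pC; have oG := optional_grid_time n oB.
have sM := @sigma_algebra_measurable _ (pr_space (X z)).
apply: (sa_ext sM (P := fun w => exists v, v \in K /\ (B w /\ tr z w (grid_up n (T w)) = Some v) /\
    C (shift_traj (tr z w) (grid_up n (T w))))).
  apply: (sa_exists sM cV) => v; apply: (sa_and sM); first exact: (sa_const sM).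
  exact: (mS (optional_state0 cV gr (aW z) (Some v) oG) pC).
move=> w; split=> [[v [vK [[Bw wv] Cw]]]|[[Bw wK] Cw]]; first by rewrite wv.
by case wv : (tr z w _) wK => [v|] //= vK; exists v.
Qed.

Lemma markov_grid_up_fset z n (K : {fset V}) B T C : opt z B T -> pev C ->
  P z [set w | (B w /\ in_fset K (tr z w (grid_up n (T w)))) /\
               C (shift_traj (tr z w) (grid_up n (T w)))] =
  (\sum_(v <- K) P z [set w | B w /\ tr z w (grid_up n (T w)) = Some v] * law (X v) C)%E.
Proof.
move=> oB pC; have oG := optional_grid_time n oB.
have oS v := optional_state0 cV gr (aW z) (Some v) oG.
have EE v : v \in K -> [set w | (B w /\ in_fset K (tr z w (grid_up n (T w)))) /\
               C (shift_traj (tr z w) (grid_up n (T w)))] `&` [set w | tr z w (grid_up n (T w)) = Some v] =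
    [set w | (B w /\ tr z w (grid_up n (T w)) = Some v) /\ C (shift_traj (tr z w) (grid_up n (T w)))].
  move=> vK; apply/seteqP; split=> w /=; first by tauto.
  by move=> [[Bw wv] Cw]; rewrite wv /=.
rewrite (@prob_fset_partition _ _ _ _ _ K (fun w => tr z w (grid_up n (T w)))) //; last 3 first.
- exact: measurable_grid_up_fset.
- move=> v; have [vK|vK] := boolP (v \in K); first by rewrite EE //; exact: (mS (oS v) pC).
  rewrite (_ : _ `&` _ = set0) // -subset0 => w [[[_ +] _] /= wv].
  by rewrite wv /= (negPf vK).
- by apply: filterS (ag z) => w _ [[]].
rewrite big_seq [RHS]big_seq; apply: eq_bigr => v vK.
by rewrite EE // (markov_grid_up hX gr gs ag).
Qed.

Let pT : pev setT. Proof. exact: path_event_const True. Qed.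

Let lawT v : law (X v) setT = 1%E.
Proof. exact: probability_setT. Qed.

Lemma grid_up_exhaust z n B T C (K : nat -> {fset V}) : opt z B T -> pev C ->
  (forall n k, (n <= k)%N -> (K n `<=` K k)%fset) -> (forall A, exists n, (A `<=` K n)%fset) ->
  P z [set w | (B w /\ in_fset (K k) (tr z w (grid_up n (T w)))) /\
               C (shift_traj (tr z w) (grid_up n (T w)))] @[k --> \oo] -->
  P z [set w | B w /\ C (shift_traj (tr z w) (grid_up n (T w)))].
Proof.
move=> oB pC KS KA; have oG := optional_grid_time n oB.
apply: cvg_prob_eventually.
- by move=> k; exact: measurable_grid_up_fset.
- exact: (mS oG pC).
- apply: filterS (ae_grid_vertex hX z) => w vw.
  have [v xv] := vw n (grid_index n (T w)).+1.
  have [N /fsubsetP vN] := KA [fset v]%fset; exists N => k Nk.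
  have vK : v \in K k by apply: (fsubsetP (KS _ _ Nk)); apply: vN; rewrite inE.
  by rewrite /grid_up /= xv /=; tauto.
Qed.

(** The sum over the states at the grid time factors as [c] times the same sum for [setT], whose
    limit along the exhaustion is the probability of [B]. *)
Lemma markov_grid_up_const z n B T C c : opt z B T -> pev C -> c \is a fin_num ->
  (forall v, law (X v) C = c) ->
  P z [set w | B w /\ C (shift_traj (tr z w) (grid_up n (T w)))] = (P z B * c)%E.
Proof.
move=> oB pC cf Cc.
have [K [_ KS KA]] := fset_exhaustion fset0 cV.
have c1 := grid_up_exhaust (n := n) oB pC KS KA.
have c2 := grid_up_exhaust (n := n) oB pT KS KA.
have BE : [set w | B w /\ [set: path] (shift_traj (tr z w) (grid_up n (T w)))] = B.
  by apply/seteqP; split=> w //= [].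
rewrite BE in c2; apply: (cvg_unique (@ereal_hausdorff R) c1).
have c3 := cvgeMr cf c2.
rewrite (_ : (fun k => P z [set w | (B w /\ in_fset (K k) (tr z w (grid_up n (T w)))) /\ C _]) =
  (fun k => (P z [set w | (B w /\ in_fset (K k) (tr z w (grid_up n (T w)))) /\
    [set: path] (shift_traj (tr z w) (grid_up n (T w)))] * c)%E)) //.
apply/funext => k; rewrite (markov_grid_up_fset n (K k) oB pC) (markov_grid_up_fset n (K k) oB pT).
rewrite ge0_sume_distrl => [|v _]; last by rewrite lawT mule1.
by apply: eq_bigr => v _; rewrite lawT mule1 Cc.
Qed.

Lemma markov_grid_up_le z n B T C c : opt z B T -> pev C -> 0 <= c ->
  (forall v, plaw v C <= c) ->
  (P z [set w | B w /\ C (shift_traj (tr z w) (grid_up n (T w)))] <= c%:E)%E.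
Proof.
move=> oB pC c0 Bc.
have [K [_ KS KA]] := fset_exhaustion fset0 cV.
have c1 := grid_up_exhaust (n := n) oB pC KS KA.
rewrite -(cvg_lim (@ereal_hausdorff R) c1); apply: lime_le; first exact: (cvgP _ c1).
near=> k; rewrite (markov_grid_up_fset n (K k) oB pC).
apply: (@le_trans _ _ (c%:E * \sum_(v <- K k) P z [set w | B w /\ tr z w (grid_up n (T w)) = Some
    v] * law (X v) setT)%E).
  rewrite ge0_sume_distrr => [|v _]; last by rewrite lawT mule1.
  apply: lee_sum => v _; rewrite lawT mule1 muleC.
  by apply: lee_wpmul2r => //; rewrite (plawE hX gr gs ag) // lee_fin.
rewrite -markov_grid_up_fset // -[leRHS]mule1; apply: lee_pmul => //.
by apply: probability_le1; exact: measurable_grid_up_fset.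
Unshelve. all: by end_near.
Qed.

(* Otherwise the walk would come back from infinity at time [T] to some [v], without
   visiting infinity in between; at grid times close to [T] it is far away, and
   reaching [v] or [z] before infinity is unlikely. *)
Lemma ae_regular z B T : opt z B T -> {ae P z, forall w, B w -> tr z w (T w) = None ->
  forall q, 0 < q -> exists2 s, T w < s < T w + q & tr z w s = None}.
Proof.
move=> oB; have oD := optional_state0 cV gr (aW z) None oB.
set D := B `&` _ in oD; have [T0 _] := oD.
(* The starting vertex is included because [ae_reach_small] requires it. *)
pose A v : {fset V} := [fset z; v]%fset.
have AA v := fsubset_refl (A v).
have pR v : pev (reach (A v) (A v)) := path_event_reach (AA v).
pose E v n := [set w | D w /\ reach (A v) (A v) (shift_traj (tr z w) (grid_up n (T w)))].
have mEn v n : measurable (E v n) by exact: (mS (optional_grid_time n oD) (pR v)).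
have N0 v : {ae P z, forall w, ~ exists N, forall n, (N <= n)%N -> E v n w}.
  have mN := measurable_eventually (mEn v); apply: (prob0_ae mN).
  apply/eqP; rewrite eq_le measure_ge0 andbT; apply/lee_addgt0Pr => e e0; rewrite add0e.
  (* Intersecting with [S] gives a probability at most [e] from every vertex, as [markov_grid_up_le]
     requires. The shifted trajectory lies in [S] for grid times close to [T], the walk being far
     away by right-continuity at infinity. *)
  pose S : set path := [set x | forall u, x 0 = Some u -> plaw u (reach (A v) (A v)) < e].
  have pS : pev S.
    apply: (sa_forall sP) => // u; apply: (sa_imply sP); last exact: (sa_const sP).
    by apply: sub_sigma_algebra; left; exists 0, (Some u).
  have pRS : pev (reach (A v) (A v) `&` S) by apply: (sa_and sP) => //; exact: pR.
  have RSle u : plaw u (reach (A v) (A v) `&` S) <= e.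
    have [ue|ue] := ltP (plaw u (reach (A v) (A v))) e.
      by apply: le_trans (ltW ue); apply: (plaw_le hX gr gs ag) => // x _ _ [].
    apply: (@le_trans _ _ 0); last exact: ltW.
    have <- : plaw u [set _ | False] = 0 by rewrite plaw_const asboolF.
    apply: (plaw_le hX gr gs ag) => //; first exact: path_event_const.
    by move=> x _ xu [_ /(_ u xu)]; rewrite ltNge ue.
  pose Ee n := [set w | D w /\ (reach (A v) (A v) `&` S) (shift_traj (tr z w) (grid_up n (T w)))].
  have mEe n : measurable (Ee n) by exact: (mS (optional_grid_time n oD) pRS).
  apply: (@le_trans _ _ (P z [set w | exists N, forall n, (N <= n)%N -> Ee n w])); last first.
    apply: prob_eventually_le => // n.
    exact: (markov_grid_up_le n oD pRS (ltW e0) RSle).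
  apply: prob_le_ae => //; first exact: measurable_eventually.
  have zA : z \in A v by rewrite !inE eqxx.
  move: (ag z) (ae_reach_small zA e0) (ae_grid_vertex hX z).
  apply: filterS3 => w gw sw vw [N HN].
  have Dw : D w by case: (HN N (leqnn _)).
  have TN : T w + 1 < (Num.truncn (T w + 1)).+1%:R by rewrite truncnS_gt.
  have [K HK] := sw (Num.truncn (T w + 1)).+1.
  have [|d d0 Hd] := (gr gw).2 K (T w) (T0 w Dw); first by rewrite (_ : tr z w (T w) = None) //; case: Dw.
  have [M1 H1] := grid_up_near (T0 w Dw) d0; have [M2 H2] := grid_up_near (T0 w Dw) (@ltr01 R).
  exists (maxn N (maxn M1 M2)) => n; rewrite !geq_max => /andP[/HN[_ Rn] /andP[/H1 n1 /H2/andP[n2 n3]]].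
  split=> //; split=> // u; rewrite /shift_traj addr0 => xu; apply: (HK _ _ _ xu).
    by rewrite (le_trans (T0 w Dw) n2) /= (le_lt_trans n3).
  by apply/negP => uK; have := Hd _ n1; rewrite /= xu.
have {}N0 := ae_forall_countable cV N0.
move: (ag z) N0; apply: filterS2 => w gw Nw Bw xT q q0.
have Dw : D w by [].
apply: contrapT => nN.
have xq s : T w < s < T w + q -> tr z w s <> None by move=> sq xs; apply: nN; exists s.
have [u xu] : exists u, tr z w (T w + q / 2) = Some u.
  have := xq (T w + q / 2); case: (tr z w _) => [u|] H; first by exists u.
  by exfalso; apply: H => //; apply/andP; split; lra.
apply: (Nw u); have q2 : 0 < q / 2 by lra.
have [M HM] := grid_up_near (T0 w Dw) q2.
exists M => n /HM /andP[_ n2]; split=> //.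
have n1 := grid_up_gt n (T0 w Dw); have s0 : 0 <= grid_up n (T w) by rewrite (le_trans (T0 w Dw)) ?ltW.
have gx := gs s0 gw.
have oC : right_open (~` in_fset (A u)) (shift_traj (tr z w) (grid_up n (T w))) by case: (gr gx) =>
    _; apply.
have t0 : 0 <= T w + q / 2 - grid_up n (T w) by rewrite subr_ge0.
have xA : in_fset (A u) (shift_traj (tr z w) (grid_up n (T w)) (T w + q / 2 - grid_up n (T w))).
  by rewrite /shift_traj subrKC xu /= !inE eqxx orbT.
have [fh hr] := first_hit_exists oC (lexx 0) t0 xA.
exists (hit_time (in_fset (A u)) (shift_traj (tr z w) (grid_up n (T w))) 0); split=> //; first by case: fh.
move=> s /andP[s1 s2]; apply: xq; apply/andP; split; first exact: (lt_le_trans n1 (ler_wpDr s1 (lexx _))).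
have sr := le_trans s2 hr.
by apply: (@le_lt_trans _ _ (T w + q / 2)); [rewrite -lerBrDl|lra].
Qed.

Hypothesis same_after : forall y z, same_law (from_infinity (X y)) (from_infinity (X z)).
Variable z0 : V.

Lemma strong_markov_infinity z B T C : opt z B T -> traj_events C ->
  P z [set w | (B w /\ tr z w (T w) = None) /\ C (shift_traj (tr z w) (T w))] =
  (P z [set w | B w /\ tr z w (T w) = None] * law (from_infinity (X z0)) C)%E.
Proof.
move=> oB; have oD := optional_state0 cV gr (aW z) None oB.
have reg := ae_regular oB.
set D := B `&` _ in oD; have [T0 _] := oD.
have tp C1 : traj_events C1 -> pev C1 := @traj_events_path _ _ (@good_path R V) C1.
have mF y C1 : traj_events C1 -> measurable (traj (from_infinity (X y)) @^-1` C1).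
  by move=> /tp /(from_infinity_event y)[].
apply: (@law_mul_cylinders _ _ cV _ _ (P z) D (fun w => shift_traj (tr z w) (T w)) (from_infinity (X z0))).
- exact: (optional_mem (aW z) oD).
- by move=> C1 /tp pC1; exact: (mS oD pC1).
- exact: mF.
move=> {}C cC; have tC := cylinders_traj cC; have pC := tp _ tC.
have pA := path_event_after pC.
set c := law _ C.
have Cc v : law (X v) (after_infinity C) = c.
  rewrite /c (same_after z0 v tC).
  by have [_ ->] := from_infinity_event v pC.
have cf : c \is a fin_num by apply: fin_num_measure; exact: mF.
have c1 : P z [set w | D w /\ after_infinity C (shift_traj (tr z w) (grid_up n (T w)))] @[n --> \oo] -->
    P z (D `&` (fun w => shift_traj (tr z w) (T w)) @^-1` C).
  apply: cvg_prob_eventually.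
  - by move=> n; exact: (mS (optional_grid_time n oD) pA).
  - exact: (mS oD pC).
  move: (ag z) reg; apply: filterS2 => w gw rw.
  have [Dw|nD] := pselect (D w); last by exists 0%N => n _; split=> -[].
  have [e e0 He] := right_shift_cylinder cC (gr gw) (T0 w Dw).
  (* For grid times before [s], the next visit to infinity is at most [s], hence within [e] of [T],
     where the cylinder event does not change. *)
  have [s /andP[s1 s2] xs] := rw Dw.1 Dw.2 e e0.
  have sT0 : 0 < s - T w by rewrite subr_gt0.
  have [M HM] := grid_up_near (T0 w Dw) sT0.
  exists M => n /HM /andP[n1 n2]; rewrite subrKC in n2.
  have g0 := le_trans (T0 w Dw) n1.
  have ix : hits_infinity (shift_traj (tr z w) (grid_up n (T w))).
    by exists (s - grid_up n (T w)); rewrite ?subr_ge0 // /shift_traj subrKC.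
  have [h0 _ hN] := hit_infinity_first (right_cont_shift g0 (gr gw)) ix.
  have hs : hit_infinity (shift_traj (tr z w) (grid_up n (T w))) <= s - grid_up n (T w).
    rewrite leNgt; apply/negP => sh; apply: (hN (s - grid_up n (T w))); first by rewrite subr_ge0 n2.
    by rewrite /shift_traj subrKC.
  set h := hit_infinity _ in h0 hs *.
  have := He (grid_up n (T w) + h).
  have -> : T w <= grid_up n (T w) + h <= T w + e by apply/andP; split; lra.
  move=> /(_ isT) hC; rewrite /after_infinity /= -/h.
  rewrite (_ : shift_traj (shift_traj _ _) h = shift_traj (tr z w) (grid_up n (T w) + h)); first by tauto.
  by apply/funext => r; rewrite /shift_traj addrA.
rewrite -(cvg_lim (@ereal_hausdorff R) c1); apply: lim_near_cst => //.
by apply: nearW => n; exact: (markov_grid_up_const n oD pA cf Cc).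
Qed.

Lemma strong_markov_walk z B T a C : opt z B T -> traj_events C ->
  P z [set w | (B w /\ tr z w (T w) = a) /\ C (shift_traj (tr z w) (T w))] =
  (P z [set w | B w /\ tr z w (T w) = a] * law (rwinf_family X z0 a) C)%E.
Proof.
move=> oB tC; case: a => [v|]; last exact: strong_markov_infinity.
exact: (strong_markov_vertex hX gr gs ag v oB (@traj_events_path _ _ (@good_path R V) C tC)).
Qed.

(** * The process started from infinity *)

Let H w := hit_infinity (tr z0 w).
Let Binf : set (pr_space (X z0)) := [set w | exists2 r, 0 <= r & tr z0 w r = None].
Let oH : opt z0 Binf H.
Proof. exact: (optional_infinity cV gr (aW z0) (@subset_refl _ good_path)). Qed.

(** Induction on the generators: the state of the shifted process at time [s] is that of the walk at
    time [H + s], to which [optional_state] applies. *)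
Lemma history_from_infinity q t E : 0 <= q -> history (from_infinity (X z0)) q E ->
  history (X z0) t [set w | E w /\ (Binf w /\ H w + q < t)].
Proof.
move=> q0; have sF := ad_sa (aW z0) t; have oHq := optional_add (aW z0) q0 oH.
pose Q (E : set (pr_space (X z0))) := history (X z0) t [set w | E w /\ (Binf w /\ H w + q < t)].
have mH : history (X z0) t [set w | Binf w /\ H w + q < t] by case: oHq => _; apply.
apply: (@smallest_sub _ (sigma_algebra setT) _ Q).
  split.
  - by apply: (sa_ext sF (sa_const sF False)) => w; split=> [//|[]].
  - move=> A QA; apply: (sa_ext sF (sa_and sF mH (sa_not sF QA))) => w; rewrite /setD /=; tauto.
  - move=> A QA; apply: (sa_ext sF (sa_exists sF (countableP _) QA)) => w; rewrite /bigcup /=.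
    by split=> [[n [An h]]|[[n _ An] h]]; [split=> //; exists n|exists n].
move=> {}E [[s [a [s0 sq ->]]]|nE]; last first.
  by apply: sub_sigma_algebra; right; apply: (negligibleS _ nE) => w [].
(* [H + q < t] means [H + s < t - (q - s)], the form in which the state at [H + s] is available. *)
have [_ /(_ (t - (q - s)))] := optional_state cV gr (aW z0) a s0 oH.
have tq : t - (q - s) <= t by lra.
move=> /(ad_mono (aW z0) tq) h; apply: (sa_ext sF h) => w /=; split.
- by move=> [[iw xa] lt]; split=> //; split=> //; lra.
- by move=> [xa [iw lt]]; split=> //; lra.
Qed.

Lemma good_from_infinity : {ae P z0, forall w, good_path (traj (from_infinity (X z0)) w)}.
Proof.
move: (ag z0) (ae_infinite z0); apply: filterS2 => w gw iw; apply: gs => //.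
by have [] := hit_infinity_first (gr gw) iw.
Qed.

Lemma measurable_from_infinity t a : 0 <= t ->
  measurable [set w | traj (from_infinity (X z0)) w t = a].
Proof.
move=> t0; have pC : pev [set x | x t = a] by apply: sub_sigma_algebra; left; exists t, a.
by have [] := from_infinity_event z0 pC.
Qed.

Let aY : adapted (@good_path R V) (traj (from_infinity (X z0))) (history (from_infinity (X z0)))
    measurable :=
  adapted_process measurable_from_infinity good_from_infinity.

(* Reduces the process started from infinity to the one started from [z0]. *)
Lemma optional_from_infinity B T : optional (history (from_infinity (X z0))) B T ->
  opt z0 (B `&` Binf) (fun w => H w + T w).
Proof.
move=> [T0 FB]; have [H0 _] := oH; split; first by move=> w [/T0 Tw /H0 Hw]; exact: addr_ge0.
move=> t; have sF := ad_sa (aW z0) t.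
apply: (sa_ext sF (P := fun w => exists q : rat, 0 <= ratr q :> R /\ ((B w /\ T w < ratr q) /\
    (Binf w /\ H w + ratr q < t)))).
  apply: (sa_exists sF (countableP _)) => q.
  have [q0|q0] := boolP (0 <= ratr q :> R); last first.
    by apply: (sa_ext sF (sa_const sF False)) => w; split=> [//|[]].
  have h := @history_from_infinity _ t _ q0 (FB (ratr q)); apply: (sa_ext sF h) => w /=.
  by split=> [|[]].
move=> w /=; split.
- by move=> [q [q0 [[Bw Tq] [iw Hq]]]]; split=> //; lra.
- move=> [[Bw iw] h]; have Tw := T0 w Bw.
  have [|q /andP[q1 q2]] := @rat_between R (T w) (t - H w); first lra.
  by exists q; split; [lra|split=> //; split=> //; lra].
Qed.

(** The past event [B] and the finiteness of [tau] are absorbed into the domain of the optional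
    time, so that the rest of the argument needs neither. *)
Lemma optional_stopping (Y : process R V) (tau : pr_space Y -> \bar R) (B : set (pr_space Y)) :
  stopping_time tau -> stopped_history tau B ->
  optional (history Y) (B `&` [set w | (tau w < +oo)%E]) (fun w => fine (tau w)).
Proof.
move=> [tau0 stau] [mB FB]; have sF t := @history_sa _ _ Y t.
have fin w : (tau w < +oo)%E -> tau w = (fine (tau w))%:E.
  by move=> tf; rewrite fineK // ge0_fin_numE.
split; first by move=> w [_ /fin tw]; rewrite -lee_fin -tw.
have mono s t : s <= t -> history Y s `<=` history Y t.
  move=> st; apply: sub_sigma_algebra2 => E [[r [a [r0 rs ->]]]|nE]; [left|by right].
  by exists r, a; split=> //; exact: le_trans st.
move=> t; apply: (sa_ext (sF t) (P := fun w => exists q : rat, (0 <= ratr q :> R /\ ratr q < t) /\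
    (B w /\ (tau w <= (ratr q)%:E)%E))).
  apply: (sa_exists (sF t) (countableP _)) => q.
  have [[q0 qt]|nq] := pselect (0 <= ratr q :> R /\ ratr q < t); last first.
    by apply: (sa_ext (sF t) (sa_const (sF t) False)) => w; split=> [//|[]].
  by apply: (sa_ext (sF t) (mono _ _ (ltW qt) _ (FB _ q0))) => w /=; split=> [h|[]//].
move=> w /=; split.
- move=> [q [[q0 qt] [Bw tq]]]; have tf := le_lt_trans tq (ltry _).
  by split=> //; rewrite -lte_fin -(fin _ tf); apply: le_lt_trans tq _; rewrite lte_fin.
- move=> [[Bw tf] tt]; have [q /andP[q1 q2]] := rat_between tt.
  have f0 : 0 <= fine (tau w) by rewrite -lee_fin -(fin _ tf).
  exists q; split; first by split=> //; lra.
  by split=> //; rewrite (fin _ tf) lee_fin ltW.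
Qed.

Theorem strong_markov_family : strong_markov (rwinf_family X z0).
Proof.
move=> z tau stau B a C hB tC /=.
have oB := optional_stopping stau hB.
have pC := @traj_events_path _ _ (@good_path R V) C tC.
set D0 := B `&` _ in oB *; case: z tau stau B hB D0 oB => [z|] tau stau B hB D0 oB.
  have oD := optional_state0 cV gr (aW z) a oB.
  split; first exact: (optional_mem (aW z) oD).
    exact: (mS oD pC).
  exact: (strong_markov_walk a oB tC).
have oD := optional_state0 cV gr aY a oB.
split; first exact: (optional_mem aY oD).
  exact: (optional_event cV gr gs aY oD pC).
have oX := optional_from_infinity oB.
have SM := strong_markov_walk a oX tC.
have E1 : P z0 (D0 `&` [set w | traj (from_infinity (X z0)) w (fine (tau w)) = a]) =
    P z0 [set w | (D0 `&` Binf) w /\ tr z0 w (H w + fine (tau w)) = a].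
  apply: prob_ae_eq.
  - exact: (optional_mem aY oD).
  - exact: (optional_mem (aW z0) (optional_state0 cV gr (aW z0) a oX)).
  by apply: filterS (ae_infinite z0) => w iw; split=> [[Dw xa]|[[Dw _] xa]].
rewrite [in RHS]E1 -SM; apply: prob_ae_eq.
- exact: (optional_event cV gr gs aY oD pC).
- exact: (mS (optional_state0 cV gr (aW z0) a oX) pC).
apply: filterS (ae_infinite z0) => w iw.
have E2 : shift_traj (tr z0 w) (H w + fine (tau w)) =
    shift_traj (traj (from_infinity (X z0)) w) (fine (tau w)).
  by apply/funext => r; rewrite /from_infinity /= /shift_traj addrA.
by rewrite /= E2; split=> [[[Dw xa] Cw]|[[[Dw _] xa] Cw]].
Qed.

End reflected_walk_at_infinity.

(** * Spanning trees *)

Section spanning_trees.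
Context {V : pointedType} (U : Type) (k : V -> U).
Implicit Types (F H : {fset {fset V}}) (a b u v x y : V) (p q : U).
Local Notation joined := (@joined V U k).

Lemma fset2_eq a b u v : [fset a; b]%fset = [fset u; v]%fset ->
  (a = u /\ b = v) \/ (a = v /\ b = u).
Proof.
move=> E; have ha : a \in [fset u; v]%fset by rewrite -E !inE eqxx.
have hb : b \in [fset u; v]%fset by rewrite -E !inE eqxx orbT.
have hu : u \in [fset a; b]%fset by rewrite E !inE eqxx.
have hv : v \in [fset a; b]%fset by rewrite E !inE eqxx orbT.
move: ha hb hu hv => /fset2P[->|->] /fset2P[->|->] /fset2P[uE|uE] /fset2P[vE|vE];
  by [left|right|left; rewrite ?uE ?vE|right; rewrite ?uE ?vE].
Qed.

Lemma joined_trans F p q r : joined F p q -> joined F q r -> joined F p r.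
Proof. exact: rt_trans. Qed.

Lemma joined_edge F x y : [fset x; y]%fset \in F -> joined F (k x) (k y).
Proof. by move=> xy; apply: rt_step; exists x, y. Qed.

Lemma joined_ind F (Q : U -> U -> Prop) : (forall x y, [fset x; y]%fset \in F -> Q (k x) (k y)) ->
  (forall p, Q p p) -> (forall p q r, joined F p q -> joined F q r -> Q p q -> Q q r -> Q p r) ->
  forall p q, joined F p q -> Q p q.
Proof.
move=> QF Qr Qt p q; elim => [{}p {}q [x [y [xy -> ->]]]|{}p|{}p r {}q h1 Q1 h2 Q2].
- exact: QF.
- exact: Qr.
- exact: (Qt p r q h1 h2 Q1 Q2).
Qed.

Lemma joined_sym F p q : joined F p q -> joined F q p.
Proof.
move: p q; apply: joined_ind => [x y xy|p|p q r _ _ qp rq]; last exact: joined_trans rq qp.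
  by apply: joined_edge; rewrite fsetUC.
exact: rt_refl.
Qed.

Lemma joined_sub F F' p q : (F `<=` F')%fset -> joined F p q -> joined F' p q.
Proof.
move=> /fsubsetP FF; move: p q; apply: joined_ind => [x y xy|p|p q r _ _].
- exact/joined_edge/FF.
- exact: rt_refl.
- exact: joined_trans.
Qed.

Lemma joined_add F u v p q : joined ([fset u; v]%fset |` F)%fset p q ->
  joined F p q \/ (joined F p (k u) /\ joined F (k v) q) \/ (joined F p (k v) /\ joined F (k u) q).
Proof.
have rr s : joined F s s := rt_refl _ _ s.
move: p q; apply: joined_ind => [x y|p|p r q _ _]; last 1 first.
- move=> [h1|[[h1 h2]|[h1 h2]]] [h3|[[h3 h4]|[h3 h4]]].
  + by left; exact: joined_trans h1 h3.
  + by right; left; split=> //; exact: joined_trans h1 h3.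
  + by right; right; split=> //; exact: joined_trans h1 h3.
  + by right; left; split=> //; exact: joined_trans h2 h3.
  + by right; left.
  + by left; exact: joined_trans h1 h4.
  + by right; right; split=> //; exact: joined_trans h2 h3.
  + by left; exact: joined_trans h1 h4.
  + by right; right.
- rewrite !inE => /orP[/eqP/fset2_eq[[-> ->]|[-> ->]]|xy]; last by left; exact: joined_edge.
    by right; left.
  by right; right.
- by left.
Qed.

Lemma joined_del F u v p q : joined (F `\ [fset u; v])%fset (k u) (k v) -> joined F p q ->
  joined (F `\ [fset u; v])%fset p q.
Proof.
move=> uv pq; have sub : (F `<=` [fset u; v]%fset |` (F `\ [fset u; v]%fset))%fset.
  by apply/fsubsetP => e eF; rewrite !inE eF andbT orbN.
case: (joined_add (joined_sub sub pq)) => [//|[[h1 h2]|[h1 h2]]].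
  exact: joined_trans (joined_trans h1 uv) h2.
exact: joined_trans (joined_trans h1 (joined_sym uv)) h2.
Qed.

Variable D : set U.
Local Notation tree := (spanning_tree k D).

(** As long as some edge closes a cycle it can be deleted without disconnecting [D]. *)
Lemma spanning_tree_exists F : (forall p q, D p -> D q -> joined F p q) ->
  exists2 T, (T `<=` F)%fset & tree T.
Proof.
have [n] := ubnP #|` F|; elim: n F => // n IH F Fn conn.
have [[x [y [xy xyJ]]]|acyc] := pselect (exists x y, [fset x; y]%fset \in F /\
    joined (F `\ [fset x; y])%fset (k x) (k y)); last first.
  by exists F => //; split=> // x y xy xyJ; apply: acyc; exists x, y.
have [|p q Dp Dq|T TF tT] := IH (F `\ [fset x; y])%fset.
- by move: Fn; rewrite (cardfsD1 [fset x; y]%fset) xy.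
- exact: joined_del xyJ (conn p q Dp Dq).
- by exists T => //; apply: fsubset_trans TF (fsubsetDl _ _).
Qed.

(** A spanning tree minus an edge splits [D] into two components, and any edge between these
    completes it to a spanning tree again. *)
Lemma spanning_tree_exchange H a b u v : D (k a) -> D (k u) -> D (k v) ->
  tree ([fset a; b]%fset |` H)%fset -> [fset a; b]%fset \notin H -> ~ joined H (k u) (k v) ->
  tree ([fset u; v]%fset |` H)%fset.
Proof.
move=> Da Du Dv [conn acyc] abH nuv.
set g := [fset u; v]%fset; set e := [fset a; b]%fset in conn acyc abH *.
have gH : g \notin H by apply/negP => /joined_edge.
have sub : (H `<=` g |` H)%fset := fsubsetU1 _ _.
have uvJ : joined (g |` H)%fset (k u) (k v) by apply: joined_edge; rewrite fset1U1.
have side p : D p -> joined H p (k a) \/ joined H p (k b).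
  by move=> Dp; case: (joined_add (conn p (k a) Dp Da)) => [|[[]|[]]]; [left|left|right].
have abJ : joined (g |` H)%fset (k a) (k b).
  have [ua|ub] := side _ Du; have [va|vb] := side _ Dv.
  - by case: nuv; exact: joined_trans ua (joined_sym va).
  - apply: joined_trans (joined_sub sub (joined_sym ua)) (joined_trans uvJ (joined_sub sub vb)).
  - apply: joined_sym; apply: joined_trans (joined_sub sub (joined_sym ub)) (joined_trans uvJ
      (joined_sub sub va)).
  - by case: nuv; exact: joined_trans ub (joined_sym vb).
split=> [p q Dp Dq|x y].
  case: (joined_add (conn p q Dp Dq)) => [/(joined_sub sub)//|[[h1 h2]|[h1 h2]]].
    exact: joined_trans (joined_sub sub h1) (joined_trans abJ (joined_sub sub h2)).
  exact: joined_trans (joined_sub sub h1) (joined_trans (joined_sym abJ) (joined_sub sub h2)).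
rewrite !inE => /orP[/eqP xyE|xyH].
  rewrite xyE fsetU1K // => xyJ; apply: nuv.
  by case: (fset2_eq xyE) => -[<- <-] //; exact: joined_sym.
have ng : [fset x; y]%fset != g by apply: contraNneq gH => <-.
have -> : ((g |` H) `\ [fset x; y] = g |` (H `\ [fset x; y]))%fset.
  apply/fsetP => f; rewrite !inE; case: (eqVneq f g) => [->|_] //=.
  by rewrite eq_sym ng.
have sD : (H `\ [fset x; y] `<=` H)%fset := fsubsetDl _ _.
have xyJ := joined_edge xyH.
have xye : [fset x; y]%fset \in (e |` H)%fset by rewrite inE xyH orbT.
move=> /joined_add[|[[h1 h2]|[h1 h2]]].
- by move=> /(joined_sub (fsetSD _ (fsubsetU1 e H)))/acyc; apply.
- apply: nuv; apply: joined_trans (joined_sub sD (joined_sym h1)) (joined_trans xyJ _).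
  exact/joined_sym/(joined_sub sD).
- apply: nuv; apply: joined_trans (joined_sub sD h2) (joined_trans (joined_sym xyJ) _).
  exact: joined_sub sD h1.
Qed.

Lemma spanning_tree_split T u v x : tree T -> D (k x) -> D (k u) -> [fset u; v]%fset \in T ->
  ~ (joined (T `\ [fset u; v])%fset (k u) (k x) /\ joined (T `\ [fset u; v])%fset (k v) (k x)) /\
  (joined (T `\ [fset u; v])%fset (k u) (k x) \/ joined (T `\ [fset u; v])%fset (k v) (k x)).
Proof.
move=> [conn acyc] Dx Du uvT; split.
  by move=> [h1 h2]; apply: (acyc u v uvT); exact: joined_trans h1 (joined_sym h2).
have := conn _ _ Du Dx; rewrite -{1}(fsetD1K uvT) => /joined_add[|[[_ h]|[_ h]]]; first by left.
  by right.
by left.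
Qed.

End spanning_trees.

(** * Kirchhoff's theorem on edge probabilities and potentials *)

Section kirchhoff.
Context {R : realType} {V : pointedType} (G : network R V) (U : Type) (k : V -> U) (D : set U).
Local Notation joined := (@joined V U k).
Local Notation tree := (spanning_tree k D).
Implicit Types (F H T : {fset {fset V}}) (g : {fset V}).

Definition grad_prod g (h f : V -> R) : R :=
  (\sum_(u <- g) \sum_(v <- g) (h u - h v) * (f u - f v)) / 2.

Lemma grad_prod_pair a b h f : grad_prod [fset a; b]%fset h f = (h a - h b) * (f a - f b).
Proof.
rewrite /grad_prod; have [->|ab] := eqVneq a b.
  by rewrite fsetUid !big_seq_fset1 !subrr !mul0r.
by rewrite !big_fsetU1 ?inE //= !big_seq_fset1 !big_fsetU1 ?inE //= !big_seq_fset1; field.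
Qed.

Definition joined_to (p : U) F (v : V) : R := (`[< joined F (k v) p >])%:R.

(** Deleting an edge off the tree path from [x] to [y] leaves them joined, and the first factor
    vanishes. An edge on the path contributes the increment of [f] along it, and these telescope. *)
Lemma tree_telescope T x y (f : U -> R) : of_edges G T -> tree T ->
  (forall u v, [fset u; v]%fset \in T -> D (k u)) -> D (k x) -> D (k y) ->
  \sum_(g <- T) (1 - joined_to (k x) (T `\ g)%fset y) *
     grad_prod g (joined_to (k x) (T `\ g)%fset) (f \o k) = f (k x) - f (k y).
Proof.
move=> eT tT DT Dx Dy.
pose J F p : R := (`[< joined F p (k x) >])%:R.
pose S p := \sum_(g <- T) (1 - J (T `\ g)%fset p) * grad_prod g (joined_to (k x) (T `\ g)%fset) (f \o k).
have JE F p q : joined F p q -> J F p = J F q.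
  move=> pq; congr (nat_of_bool _)%:R; apply: asbool_equiv_eq; split; last exact: joined_trans.
  by apply: joined_trans; exact: joined_sym.
suff key p q : joined T p q -> S q - S p = f p - f q.
  have Sx : S (k x) = 0.
    by rewrite /S big1 // => g _; rewrite /J asboolT ?subrr ?mul0r //; exact: rt_refl.
  have [conn _] := tT; rewrite -[LHS]/(S (k y)) -(key _ _ (conn _ _ Dx Dy)).
  by rewrite Sx subr0.
move: p q; apply: joined_ind => [u v uvT|p|p r q _ _ h1 h2]; last 2 first.
- by rewrite !subrr.
- by move: h1 h2; lra.
rewrite /S -sumrB (big_fsetD1 [fset u; v]%fset) //= big_seq big1 ?addr0 => [|g].
  have Du := DT _ _ uvT; set F := (T `\ [fset u; v])%fset.
  have [nb ob] := spanning_tree_split tT Dx Du uvT.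
  rewrite -mulrBl grad_prod_pair /= /J /joined_to -/F.
  case: asboolP => hu; case: asboolP => hv.
  - by case: nb.
  - by rewrite /=; lra.
  - by rewrite /=; lra.
  - by case: ob.
rewrite !inE => /andP[gu gT]; rewrite -mulrBl (JE _ (k u) (k v)) ?subrr ?mul0r //.
by apply: joined_edge; rewrite !inE uvT andbT eq_sym.
Qed.

Lemma big_fpowerset_reindex (E : {fset {fset V}}) g (Q : pred {fset {fset V}}) (Fn : {fset {fset V}} -> R) :
  g \in E ->
  \sum_(T <- fpowerset E | (g \in T) && Q T) Fn (T `\ g)%fset =
  \sum_(H <- fpowerset E | (g \notin H) && Q (g |` H)%fset) Fn H.
Proof.
move=> gE; rewrite -big_filter -[RHS]big_filter.
rewrite -(big_map (fun T => T `\ g)%fset predT Fn); apply: perm_big; apply: uniq_perm.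
- rewrite map_inj_in_uniq ?filter_uniq ?fset_uniq // => S T; rewrite !mem_filter => /andP[/andP[gS
    _] _] /andP[/andP[gT _] _] ST.
  by rewrite -(fsetD1K gS) -(fsetD1K gT) ST.
- by rewrite filter_uniq ?fset_uniq.
move=> H; apply/mapP/idP.
- move=> [T]; rewrite !mem_filter !fpowersetE => /andP[/andP[gT QT] TE] ->.
  by rewrite fsetD1K // QT !inE eqxx /= (fsubset_trans _ TE) // fsubsetDl.
- rewrite !mem_filter !fpowersetE => /andP[/andP[gH QH] HE].
  exists (g |` H)%fset; last by rewrite fsetU1K.
  by rewrite mem_filter fpowersetE fset1U1 QH /= fsubUset fsub1set gE HE.
Qed.

Variable E : {fset {fset V}}.
Hypothesis eE : of_edges G E.
Hypothesis DE : forall u v, [fset u; v]%fset \in E -> D (k u).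

Let trees_weight := \sum_(F <- fpowerset E | `[< tree F >]) tree_weight G F.

Lemma tree_weightD1 T g : g \in T -> tree_weight G T = conductance G g * tree_weight G (T `\ g)%fset.
Proof. by move=> gT; rewrite /tree_weight (big_fsetD1 g). Qed.

(* Both sides of the identity are sums over pairs of an edge [g] and a forest [H],
   where [H] is a spanning tree minus [e] on the left and minus [g] on the right;
   by the exchange property these are the same forests when [H] separates [g]. *)
Lemma kirchhoff x y : [fset x; y]%fset \in E -> trees_weight != 0 ->
  exists phi : U -> R,
    phi (k x) - phi (k y) =
      ust_prob G k D E [fset [fset x; y]]%fset [fset [fset x; y]]%fset / cond G x y /\
    forall f : U -> R, energy_form G E (phi \o k) (f \o k) = f (k x) - f (k y).
Proof.
set e := [fset x; y]%fset => eiE W0; have xyA : adj G x y := eE eiE.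
have Dx : D (k x) := DE eiE.
have Dy : D (k y) by apply: (@DE y x); rewrite fsetUC.
pose QH H := (e \notin H) && `[< tree (e |` H)%fset >].
(* [phi p] is [1 / cond G x y] times the probability that the tree contains [e] and that deleting
   [e] leaves [p] on the side of [x]. *)
pose phi p := (\sum_(H <- fpowerset E | QH H) tree_weight G H * (`[< joined H p (k x) >])%:R) /
    trees_weight.
exists phi; split.
  have -> : ust_prob G k D E [fset e]%fset [fset e]%fset =
      cond G x y * (\sum_(H <- fpowerset E | QH H) tree_weight G H) / trees_weight.
    rewrite /ust_prob -/trees_weight; congr (_ / _).
    rewrite -(big_fpowerset_reindex (fun T => `[< tree T >]) (tree_weight G) eiE) mulr_sumr.
    rewrite (eq_bigl (fun F => (e \in F) && `[< tree F >])) => [|F].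
      by apply: eq_bigr => F /andP[eF _]; rewrite (tree_weightD1 eF) condE.
    rewrite andbC; congr (_ && _); apply/eqP/idP => [/fsetP/(_ e)|eF].
      by rewrite !inE eqxx andbT.
    by apply/fsetP => g; rewrite !inE; case: (eqVneq g e) => [->|]; rewrite ?eF ?andbF.
  rewrite /phi -mulrBl -sumrB.
  rewrite (eq_bigr (fun H => tree_weight G H)) => [|H /andP[eH /asboolP tH]].
    have c0 : cond G x y != 0 by rewrite gt_eqF ?cond_gt0.
    by move: trees_weight W0 => W W0; field; rewrite W0 c0.
  rewrite -mulrBr (asboolT (rt_refl _ _ _)) asboolF ?subr0 ?mulr1 // => yx.
  have [_ /(_ x y)] := tH; rewrite -/e fset1U1 fsetU1K // => /(_ isT); apply.
  exact: joined_sym.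
move=> f.
have split_sum (c : {fset {fset V}} -> {fset V} -> R) (Q : pred {fset {fset V}}) :
    \sum_(T <- fpowerset E | Q T) \sum_(g <- T) c (T `\ g)%fset g =
    \sum_(g <- E) \sum_(H <- fpowerset E | (g \notin H) && Q (g |` H)%fset) c H g.
  transitivity (\sum_(T <- fpowerset E | Q T) \sum_(g <- E | g \in T) c (T `\ g)%fset g).
    rewrite big_seq_cond [RHS]big_seq_cond; apply: eq_bigr => T /andP[]; rewrite fpowersetE => TE _.
    rewrite -[RHS]big_filter; apply: perm_big; apply: uniq_perm; rewrite ?filter_uniq ?fset_uniq //.
    by move=> g; rewrite mem_filter andb_idr // => /(fsubsetP TE).
  rewrite (exchange_big_dep predT) //= big_seq [RHS]big_seq; apply: eq_bigr => g gE.
  by rewrite -(big_fpowerset_reindex Q (fun H => c H g) gE); apply: eq_bigl => T; rewrite andbC.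
have E1 : trees_weight * (f (k x) - f (k y)) =
    \sum_(g <- E) \sum_(H <- fpowerset E | (g \notin H) && `[< tree (g |` H)%fset >])
      tree_weight G H * (1 - joined_to (k x) H y) * edge_form G g (joined_to (k x) H) (f \o k).
  rewrite -(split_sum (fun H g => tree_weight G H * (1 - joined_to (k x) H y) * edge_form G g
      (joined_to (k x) H) (f \o k))
    (fun T => `[< tree T >])).
  rewrite mulr_suml big_seq_cond [RHS]big_seq_cond; apply: eq_bigr => T /andP[].
  rewrite fpowersetE => /fsubsetP TE /asboolP tT.
  rewrite -(tree_telescope f _ tT _ Dx Dy); last 2 first.
  - by move=> g /TE; exact: eE.
  - by move=> u v /TE; exact: DE.
  rewrite mulr_sumr big_seq [RHS]big_seq; apply: eq_bigr => g gT.
  rewrite (tree_weightD1 gT) /edge_form -/(grad_prod _ _ _); ring.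
have gpE g h : edge_form G g h (f \o k) = conductance G g * grad_prod g h (f \o k) by [].
apply: (mulfI W0); rewrite E1 /energy_form mulr_sumr big_seq [RHS]big_seq; apply: eq_bigr => g gE.
have [u [v [uv gE']]] := edge_pair (eE gE); subst g.
have Du := DE gE; have Dv : D (k v) by apply: (@DE v u); rewrite fsetUC.
under eq_bigr do rewrite gpE grad_prod_pair.
rewrite gpE grad_prod_pair /= /phi -mulrBl -sumrB.
set c := conductance _ _; set df := f (k u) - f (k v).
set s := \sum_(H <- _ | QH H) _.
have -> : trees_weight * (c * (s / trees_weight * df)) = s * (c * df).
  by move: trees_weight W0 => W W0; field.
rewrite {}/s mulr_suml.
have joinedE H a b : joined_to (k x) H a = joined_to (k x) H b \/ ~ joined H (k a) (k b).
  have [ab|] := pselect (joined H (k a) (k b)); last by right.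
  left; congr (nat_of_bool _)%:R; apply: asbool_equiv_eq; split; last exact: joined_trans.
  by apply: joined_trans; exact: joined_sym.
rewrite big_mkcond [RHS]big_mkcond; apply: eq_bigr => H _.
have [uvE|uvJ] := joinedE H u v.
  rewrite /joined_to in uvE; rewrite /joined_to uvE !subrr ?(mulr0, mul0r).
  by do 2 case: ifP.
have uvH : [fset u; v]%fset \notin H by apply/negP => /joined_edge.
have [yx|yx] := pselect (joined H (k y) (k x)).
  have -> : QH H = false.
    apply/negP => /andP[eH /asboolP[_ /(_ x y)]]; rewrite -/e fset1U1 fsetU1K // => /(_ isT); apply.
    exact: joined_sym.
  by rewrite /joined_to (asboolT yx) subrr mulr0 mul0r if_same.
have eH : e \notin H.
  by apply/negP => eH; apply: yx; exact/joined_sym/joined_edge.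
rewrite /QH eH uvH /= [joined_to _ _ y]/joined_to (asboolF yx) subr0 mulr1.
have -> : `[< tree (e |` H)%fset >] = `[< tree ([fset u; v] |` H)%fset >].
  apply: asbool_equiv_eq; split => tH.
    exact: (spanning_tree_exchange Dx Du Dv tH).
  by apply: (spanning_tree_exchange Du Dx Dy tH) => // xy; apply: yx; exact: joined_sym.
by case: ifP => // _; rewrite /joined_to /=; ring.
Qed.

End kirchhoff.

(** * Comparison of the free and wired spanning forests *)

Section free_wired.
Context {R : realType} {V : pointedType} (G : network R V).
Hypothesis weight_gt0 : forall x, 0 < vweight G x.

Definition ball_edges n : {fset {fset V}} :=
  [fset e in contracted_edges G (nball G point n) | (e `<=` nball G point n)%fset]%fset.

Lemma mem_ball_edges n e :
  (e \in ball_edges n) <-> edges G e /\ (e `<=` nball G point n)%fset.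
Proof.
rewrite !inE /=; split=> [/andP[/mem_contracted_edges[]]//|[ee en]].
apply/andP; split=> //; apply/mem_contracted_edges; split=> //.
have [a [b [_ eE]]] := edge_pair ee.
have ae : a \in e by rewrite eE !inE eqxx.
by exists a => //; exact: (fsubsetP en).
Qed.

Lemma nball_exhaustion : exhaustion G (nball G point) ball_edges.
Proof.
have ES n : (ball_edges n `<=` ball_edges n.+1)%fset.
  apply/fsubsetP => e /mem_ball_edges[ee en]; apply/mem_ball_edges; split=> //.
  exact: fsubset_trans en (nball_sub G point n).
split.
- by move=> n e /mem_ball_edges.
- by move=> n; split; [exact: nball_sub|exact: ES].
- have conn n x : x \in nball G point n -> joined id (ball_edges n) point x.
    elim: n x => [|n IH] x; first by rewrite inE => /eqP ->; exact: rt_refl.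
    rewrite inE => /orP[/IH|/bigfcupP[y]]; first exact: joined_sub.
    rewrite andbT => yn /mem_nbr yx; apply: joined_trans (joined_sub (ES n) (IH y yn)) _.
    apply: (@joined_edge _ _ id); apply/mem_ball_edges; split=> //.
    apply/fsubsetP => v /fset2P[->|->]; last exact: nballS yx.
    exact: (fsubsetP (nball_sub G point n)).
  by move=> n x y /conn xn /conn yn; exact: joined_trans (joined_sym xn) yn.
- exact: nball_cover.
- move=> e ee; have [a [b [_ eE]]] := edge_pair ee; rewrite eE in ee *.
  have [n an] := nball_cover G point a; exists n.+1; apply/mem_ball_edges; split=> //.
  apply/fsubsetP => v /fset2P[->|->]; last exact: nballS an ee.
  exact: (fsubsetP (nball_sub G point n)).
Qed.

Lemma tree_weight_gt0 F : of_edges G F -> 0 < tree_weight G F.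
Proof.
by move=> eF; rewrite /tree_weight big_seq; apply: prodr_gt0 => e /eF; exact: conductance_gt0.
Qed.

(** The optimal choice is [t = a / q]; if [q = 0], the left-hand side is linear in [t] and bounded,
    hence [a = 0]. *)
Lemma cauchy_schwarz_le (a q M : R) : 0 <= q -> (forall t, 2 * t * a <= M + t ^+ 2 * q) ->
  a ^+ 2 <= q * M.
Proof.
move=> q0 H; have [q1|q1] := ltP 0 q.
  have := H (a / q); rewrite -(ler_pM2l q1) => h.
  have E1 : q * (2 * (a / q) * a) = 2 * a ^+ 2 by field; rewrite gt_eqF.
  have E2 : q * (M + (a / q) ^+ 2 * q) = q * M + a ^+ 2 by field; rewrite gt_eqF.
  by move: h; rewrite E1 E2; lra.
have qE : q = 0 by lra.
rewrite {}qE in H *; rewrite mul0r.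
have [->|a0] := eqVneq a 0; first by rewrite expr0n.
have := H ((M + 1) / (2 * a)).
rewrite (_ : 2 * ((M + 1) / (2 * a)) * a = M + 1); last by field; rewrite a0.
by rewrite mulr0; lra.
Qed.

Lemma free_edge_bound n x y (f : V -> R) M : [fset x; y]%fset \in ball_edges n -> energy_le G f M ->
  cond G x y * (f x - f y) ^+ 2 <=
  ust_prob G id [set` nball G point n] (ball_edges n) [fset [fset x; y]]%fset [fset [fset x; y]]%fset * M.
Proof.
move=> en fM; have xh := nball_exhaustion.
have eE : of_edges G (ball_edges n) by move=> e /mem_ball_edges[].
have DE u v : [fset u; v]%fset \in ball_edges n -> [set` nball G point n] u.
  by move=> /mem_ball_edges[_ /fsubsetP]; apply; rewrite !inE eqxx.
have [T TE tT] := @spanning_tree_exists _ _ id [set` nball G point n] (ball_edges n)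
    (@exhaustion_connected _ _ _ _ _ xh n).
have W0 : \sum_(F <- fpowerset (ball_edges n) | `[< spanning_tree id [set` nball G point n] F >])
    tree_weight G F != 0.
  rewrite big_seq_cond psumr_neq0 => [|F /andP[]]; last first.
    by rewrite fpowersetE => /fsubsetP FE _; apply/ltW/tree_weight_gt0 => e /FE/eE.
  apply/hasP; exists T; rewrite ?fpowersetE // asboolT //= TE tree_weight_gt0 //.
  by move=> e /(fsubsetP TE)/eE.
have [phi [phixy phif]] := kirchhoff eE DE en W0.
set P := ust_prob _ _ _ _ _ _ in phixy *.
have c0 : 0 < cond G x y by apply: cond_gt0; exact: eE.
have q0 : 0 <= P / cond G x y.
  by rewrite -phixy -(phif phi); exact: energy_form_ge0.
have : (f x - f y) ^+ 2 <= P / cond G x y * M.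
  apply: cauchy_schwarz_le => // t.
  have := energy_form_ge0 (fun v => 1 * f v + (- t) * phi v) eE.
  rewrite energy_form_sq (energy_form_sym _ _ f phi) (phif f) (phif phi) phixy.
  have := fM _ eE; rewrite /=; lra.
rewrite -(ler_pM2l c0); set s := P in q0 *.
by rewrite (_ : cond G x y * (s / cond G x y * M) = s * M) //; field; rewrite gt_eqF.
Qed.

(** Subtracting the value at the contracted vertex from Kirchhoff's potential makes it vanish
    outside the ball and changes no gradient. *)
Lemma wired_edge_potential n x y : adj G x y -> x \in nball G point n ->
  exists psi : V -> R, let q := ust_prob G (Defs.contract (nball G point n)) (contracted_vertices
      (nball G point n))
      (contracted_edges G (nball G point n)) [fset [fset x; y]]%fset [fset [fset x; y]]%fset / cond G x y in
    [/\ forall v, v \notin nball G point n -> psi v = 0, psi x - psi y = q &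
        energy_le G psi q].
Proof.
move=> xy xn; set K := nball G point n; set E := contracted_edges G K.
have eE : of_edges G E by exact: of_edges_star.
have eiE : [fset x; y]%fset \in E.
  by apply/mem_contracted_edges; split=> //; exists x; rewrite // !inE eqxx.
have DE u v : [fset u; v]%fset \in E -> contracted_vertices K (Defs.contract K u).
  by move=> _; rewrite /contracted_vertices /Defs.contract /=; case: ifP => uK; [right; exists u|left].
(* If the total weight of the trees is 0, division by it gives 0 and the zero potential works; this
   spares a proof that the contracted graph is connected. *)
have [W0|W0] := eqVneq (\sum_(F <- fpowerset E | `[< spanning_tree (Defs.contract K)
    (contracted_vertices K) F >]) tree_weight G F) 0.
  exists (fun=> 0); rewrite /ust_prob W0 invr0 mulr0 mul0r subrr; split=> //.
  move=> S eS; rewrite /energy_form big1 // => g _; rewrite /edge_form big1 ?mul0r ?mulr0 // => u _.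
  by rewrite big1 // => v _; rewrite subrr mul0r.
have [phi [phixy phif]] := kirchhoff eE DE eiE W0.
exists (fun v => phi (Defs.contract K v) - phi None); split.
- by move=> v vK; rewrite /Defs.contract (negPf vK) subrr.
- by rewrite -phixy; ring.
have psi0 v : v \notin K -> phi (Defs.contract K v) - phi None = 0.
  by move=> vK; rewrite /Defs.contract (negPf vK) subrr.
have := fin_supp_energy_le (G := G) psi0.
have -> : energy_form G E (fun v => phi (Defs.contract K v) - phi None) (fun v => phi
    (Defs.contract K v) - phi None) =
    energy_form G E (phi \o Defs.contract K) (phi \o Defs.contract K).
  apply: eq_bigr => g _; rewrite /edge_form; congr (_ * (_ / _)).
  by apply: eq_bigr => u _; apply: eq_bigr => v _; rewrite /=; ring.
by rewrite phif phixy.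
Qed.

(* The free bound for [a * psi + f], where the finitely supported wired potential
   [psi] is orthogonal to [f], is affine in [a] in the limit if the edge
   probabilities coincide. *)
Lemma free_wired_liouville : free_wired_coincide G -> finite_energy_harmonic_constant G.
Proof.
move=> [mu [free wired]] f fharm /energy_ltP[M fM].
have fl x : lap G f x = 0 by apply/trans_probE_lap => //; rewrite -sum_nbr.
suff step x y : adj G x y -> f x = f y.
  move=> x y; apply/esym; apply: (@connected_ind _ _ G (fun v => f v = f x) x) => // a b ab <-.
  by rewrite (step a b ab).
move=> xy; set e := [fset x; y]%fset; set c := cond G x y; set d := f x - f y.
have c0 : 0 < c := cond_gt0 xy.
pose p : R := fine (mu (trace_event [fset e]%fset [fset e]%fset)).
have [N eN] := exhaustion_edges nball_exhaustion xy.
have xN n : (N <= n)%N -> e \in ball_edges n.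
  elim: n => [|n IH]; first by rewrite leqn0 => /eqP <-.
  rewrite leq_eqVlt => /orP[/eqP <- //|/IH]; apply: fsubsetP.
  by have [] := exhaustion_incr nball_exhaustion n.
have freeb g L : energy_le G g L -> c * (g x - g y) ^+ 2 <= p * L.
  move=> gL; have H := free _ _ nball_exhaustion [fset e]%fset [fset e]%fset.
  have HL : ust_prob G id [set` nball G point n] (ball_edges n) [fset e]%fset [fset e]%fset * L @[n
      --> \oo] --> p * L.
    exact: cvgMl.
  rewrite -(cvg_lim _ HL) //; apply: limr_ge; first exact: (cvgP _ HL).
  by near=> n; apply: free_edge_bound gL; apply: xN; near: n; exact: nbhs_infty_ge.
have key a : 2 * a * p * d + c * d ^+ 2 <= p * M.
  pose q n := ust_prob G (Defs.contract (nball G point n)) (contracted_vertices (nball G point n))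
      (contracted_edges G (nball G point n)) [fset e]%fset [fset e]%fset / c.
  have qn n : (N <= n)%N -> c * (a * q n + d) ^+ 2 <= p * (a ^+ 2 * q n + M).
    move=> /xN /mem_ball_edges[_ /fsubsetP/(_ x)]; rewrite !inE eqxx => /(_ isT) xn.
    have [psi [psi0 psixy psiq]] := wired_edge_potential xy xn; rewrite -/e -/c -/(q n) in psixy psiq.
    have h : energy_le G (fun v => a * psi v + 1 * f v) (a ^+ 2 * q n + M).
      move=> S eS; set S' := (S `|` contracted_edges G (nball G point n))%fset.
      have eS' : of_edges G S' by apply: of_edgesU => //; exact: of_edges_star.
      apply: le_trans (energy_form_mono _ (fsubsetUl _ _) eS') _; rewrite energy_form_sq.
      rewrite (energy_form_sym _ _ psi f) (energy_form_fin_supp f eS' (fsubsetUr _ _) psi0).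
      rewrite big1 => [|v _]; last by rewrite fl mulr0.
      have := fM _ eS'; have := ler_wpM2l (sqr_ge0 a) (psiq _ eS'); lra.
    have := freeb _ _ h; congr (c * _ ^+ 2 <= _).
    by rewrite -psixy /d; ring.
  have H := wired _ _ nball_exhaustion [fset e]%fset [fset e]%fset; rewrite -/p in H.
  have qp : q n @[n --> \oo] --> p / c by apply: cvgMl.
  have L1 : c * (a * q n + d) ^+ 2 @[n --> \oo] --> c * (a * (p / c) + d) ^+ 2.
    apply: cvgMr; rewrite expr2; under eq_fun do rewrite expr2.
    by apply: cvgM; apply: cvgD; [apply: cvgMr|exact: cvg_cst|apply: cvgMr|exact: cvg_cst].
  have L2 : p * (a ^+ 2 * q n + M) @[n --> \oo] --> p * (a ^+ 2 * (p / c) + M).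
    by apply: cvgMr; apply: cvgD; [apply: cvgMr|exact: cvg_cst].
  have : c * (a * (p / c) + d) ^+ 2 <= p * (a ^+ 2 * (p / c) + M).
    apply: (ler_cvg_to L1 L2); near=> n; apply: qn; near: n; exact: nbhs_infty_ge.
  (* The terms quadratic in [a] cancel because the free and wired limits are the same [p]; what
     remains is affine in [a]. *)
  have -> : c * (a * (p / c) + d) ^+ 2 = a ^+ 2 * p ^+ 2 / c + 2 * a * p * d + c * d ^+ 2.
    by field; rewrite gt_eqF.
  have -> : p * (a ^+ 2 * (p / c) + M) = a ^+ 2 * p ^+ 2 / c + p * M by field; rewrite gt_eqF.
  by lra.
apply/eqP; rewrite -subr_eq0 -/d; apply/negPn/negP => d0.
have d2 : 0 < c * d ^+ 2 by rewrite mulr_gt0 // lt_neqAle sqr_ge0 andbT eq_sym expf_eq0 /= d0.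
have [p0|p0] := eqVneq p 0; first by have := key 0; rewrite p0; lra.
(* For this [a] the linear term equals [p * M], leaving [c * d ^+ 2 <= 0]. *)
have := key (M / (2 * d)).
rewrite (_ : 2 * (M / (2 * d)) * p * d = p * M); last by field; rewrite d0.
by lra.
Unshelve. all: by end_near.
Qed.

End free_wired.

Theorem corollary1p6 (R : realType) (V : pointedType) (G : network R V)
  (PRW : V -> probability (wpath V) R)
  (hRW : forall x, rw_law G x (PRW x))
  (htransient : transient PRW)
  (nu : {sigma_finite_measure set (dpath_star V) -> \bar R})
  (hnu : interlacement_intensity G PRW nu)
  (m : V -> R) (m_gt0 : forall x, 0 < m x)
  (hm : admissible G m nu)
  (I : interlacement R V) (hI : is_interlacement I nu)
  (X : V -> process R V) (hX : is_rwinf G m X)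
  (hABC : finite_energy_harmonic_constant G \/
          reflected_from_infinity_is_Z m X I \/
          free_wired_coincide G)
  (z0 : V) :
  strong_markov (rwinf_family X z0).
Proof.
have weight_gt0 := transient_weight_gt0 G htransient.
apply: (strong_markov_family m_gt0 weight_gt0 hX hRW htransient) => y z.
have [hA|[hB|hC]] := hABC.
- exact: (from_infinity_law m_gt0 weight_gt0 hX hRW htransient hA).
- by move=> C tC; rewrite (hB y C tC) (hB z C tC).
- exact: (from_infinity_law m_gt0 weight_gt0 hX hRW htransient (free_wired_liouville weight_gt0 hC)).
Qed.
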